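(* There is an algorithm which, given as input an Eisenstein-Jacobi network $EJ_\alpha$ with $n$ nodes, where $\alpha = a + b\rho$ is a nonzero element of $\mathbb{Z}[\rho]$ with $0 \le a \le b$ and $n = a^2+b^2+ab$, constructs, for every pair of distinct nodes $u, v$ of $EJ_\alpha$ and every integer $l$ with $D(u,v) \le l \le n-1$, a path from $u$ to $v$ in $EJ_\alpha$ of length exactly $l$, and whose total running time is $O(n^4)$. Here $D(u,v)$ denotes the length of a shortest path between $u$ and $v$.
   Context: Let $\rho = (1+i\sqrt{3})/2$, so that $\rho^2 = \rho - 1$, and let $\mathbb{Z}[\rho] = \{x + y\rho \mid x, y \in \mathbb{Z}\}$ be the ring of Eisenstein-Jacobi integers. For nonzero $\alpha = a + b\rho \in \mathbb{Z}[\rho]$ with $0 \le a \le b$, the Eisenstein-Jacobi (EJ) network $EJ_\alpha$ is the undirected graph whose node set is the quotient ring $\mathbb{Z}[\rho]_\alpha = \mathbb{Z}[\rho]/(\alpha)$, which has $a^2 + b^2 + ab$ elements, and in which two nodes $\beta, \gamma$ are adjacent if and only if $\beta - \gamma$ is congruent modulo $\alpha$ to one of $1, -1, \rho, -\rho, \rho^2, -\rho^2$. A path visits no node more than once, and its length is its number of edges. Running time is counted in elementary operations, where accessing the (at most six) neighbours of a node takes constant time. *)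

(* Defs.v *)
From HB Require Import structures.
From mathcomp Require Import all_boot all_order all_algebra all_field.
From mathcomp Require Import boolp.
From mathcomp Require Import generic_quotient ring_quotient ring zify.

Set Implicit Arguments.
Unset Strict Implicit.
Unset Printing Implicit Defensive.

Import Order.TTheory GRing.Theory Num.Theory.

Local Open Scope ring_scope.
Local Open Scope quotient_scope.

(* [EJInt x y] stands for x + y rho with rho = (1 + i sqrt 3) / 2; see
   [EJval] below for the embedding into the complex algebraic numbers. *)
Record EJint := EJInt { EJre : int; EJrho : int }.

Definition EJint_pair (z : EJint) : int * int := (EJre z, EJrho z).
Definition EJint_of_pair (p : int * int) : EJint := EJInt p.1 p.2.
Lemma EJint_pairK : cancel EJint_pair EJint_of_pair. Proof. by case. Qed.

HB.instance Definition _ := Choice.copy EJint (can_type EJint_pairK).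

Definition EJadd (z w : EJint) :=
  EJInt (EJre z + EJre w) (EJrho z + EJrho w).
Definition EJopp (z : EJint) := EJInt (- EJre z) (- EJrho z).
(* rho ^ 2 = rho - 1 *)
Definition EJmul (z w : EJint) :=
  EJInt (EJre z * EJre w - EJrho z * EJrho w)
        (EJre z * EJrho w + EJrho z * EJre w + EJrho z * EJrho w).

Fact EJaddA : associative EJadd.
Proof. by move=> [x y] [x' y'] [x'' y'']; rewrite /EJadd /= !addrA. Qed.
Fact EJaddC : commutative EJadd.
Proof.
by move=> [x y] [x' y']; rewrite /EJadd /= (addrC x) (addrC y).
Qed.
Fact EJadd0 : left_id (EJInt 0 0) EJadd.
Proof. by move=> [x y]; rewrite /EJadd /= !add0r. Qed.
Fact EJaddN : left_inverse (EJInt 0 0) EJopp EJadd.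
Proof. by move=> [x y]; rewrite /EJadd /= !addNr. Qed.

HB.instance Definition _ :=
  GRing.isZmodule.Build EJint EJaddA EJaddC EJadd0 EJaddN.

Fact EJmulA : associative EJmul.
Proof. by move=> [x y] [x' y'] [x'' y'']; rewrite /EJmul /=; congr EJInt; ring. Qed.
Fact EJmulC : commutative EJmul.
Proof. by move=> [x y] [x' y']; rewrite /EJmul /=; congr EJInt; ring. Qed.
Fact EJmul1 : left_id (EJInt 1 0) EJmul.
Proof. by move=> [x y]; rewrite /EJmul /=; congr EJInt; ring. Qed.
Fact EJmulDl : left_distributive EJmul EJadd.
Proof.
by move=> [x y] [x' y'] [x'' y'']; rewrite /EJmul /EJadd /=; congr EJInt; ring.
Qed.
Fact EJone_neq0 : EJInt 1 0 != 0.
Proof. by []. Qed.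

HB.instance Definition _ :=
  GRing.Zmodule_isComNzRing.Build EJint EJmulA EJmulC EJmul1 EJmulDl EJone_neq0.

Definition rho : EJint := EJInt 0 1.

Lemma EJintE x y : EJInt x y = 1 *~ x + rho *~ y.
Proof.
have mulnE z w n : EJInt z w *+ n = EJInt (z *+ n) (w *+ n).
  by elim: n => [|n IH]; rewrite ?mulr0n // !mulrS IH.
have mulzE z w n : EJInt z w *~ n = EJInt (z *~ n) (w *~ n).
  by case: n => n; rewrite ?NegzE ?mulrNz -!pmulrn mulnE.
rewrite [in 1 *~ x]/1 /= !mulzE !mul0rz !intz.
by congr EJInt; rewrite ?addr0 ?add0r.
Qed.

Definition rhoC : algC := (1 + 'i * sqrtC 3%:R) / 2%:R.
Definition EJval (z : EJint) : algC := (EJre z)%:~R + (EJrho z)%:~R * rhoC.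

Lemma rhoC_sqr : rhoC ^+ 2 = rhoC - 1.
Proof.
have two0 : (2%:R : algC) != 0 by rewrite pnatr_eq0.
have E : ('i * sqrtC 3%:R) ^+ 2 = - 3%:R :> algC.
  by rewrite exprMn sqrCi sqrtCK mulN1r.
rewrite /rhoC; move: ('i * _) E => t E.
by rewrite expr_div_n sqrrD E; field.
Qed.

Lemma EJval_add : {morph EJval : z w / z + w}.
Proof.
move=> [x y] [x' y']; rewrite /EJval /= !rmorphD /=.
by move: rhoC => t; ring.
Qed.

Lemma EJval_mul : {morph EJval : z w / z * w}.
Proof.
move=> [x y] [x' y']; rewrite /EJval /= !(rmorphD, rmorphB, rmorphM) /=.
have E := rhoC_sqr; rewrite expr2 in E.
move: rhoC E => t E; rewrite mulrDr !mulrDl.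
rewrite [_ * t * (_ * t)]mulrACA E; ring.
Qed.

Lemma EJval1 : EJval 1 = 1.
Proof. by rewrite /EJval /= mul0r addr0. Qed.

Lemma EJval_rho : EJval rho = rhoC.
Proof. by rewrite /EJval /= mul1r add0r. Qed.

Lemma EJval_inj : injective EJval.
Proof.
suff ker x y : x%:~R + y%:~R * rhoC = 0 -> x = 0 /\ y = 0.
  move=> [x y] [x' y'] E.
  have [|/eqP + /eqP] := ker (x - x') (y - y').
    apply/eqP; rewrite !rmorphB /= mulrBl; move/eqP: E.
    by rewrite /EJval /= -subr_eq0 opprD addrACA.
  by rewrite !subr_eq0 => /eqP-> /eqP->.
move=> E; have Ex : x%:~R = - (y%:~R * rhoC) by apply/eqP; rewrite -addr_eq0 E.
have N0 : x ^+ 2 + x * y + y ^+ 2 = 0.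
  apply: (@intr_inj algC); rewrite !(rmorphD, rmorphM, rmorphXn) /= Ex rmorph0.
  have := rhoC_sqr; move: rhoC => t Et.
  by rewrite sqrrN exprMn Et; ring.
by split; nia.
Qed.

Definition EJideal (alpha : EJint) : {pred EJint} :=
  fun z => `[< exists q, z = q * alpha >].

Fact EJideal_zmod_closed alpha : zmod_closed (EJideal alpha).
Proof.
split=> [|_ _ /asboolP[q ->] /asboolP[r ->]]; apply/asboolP.
  by exists 0; rewrite mul0r.
by exists (q - r); rewrite mulrBl.
Qed.

HB.instance Definition _ alpha :=
  GRing.isZmodClosed.Build EJint (EJideal alpha) (EJideal_zmod_closed alpha).

(* The quotient Z[rho] / (alpha).  Only its additive structure matters for the
   network; the quotient rings of [ring_quotient] would rule out the case where
   alpha is a unit. *)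
Definition EJnode (alpha : EJint) : zmodType := Quotient.quot (EJideal alpha).

Definition EJclass (alpha : EJint) (z : EJint) : EJnode alpha :=
  \pi_(Quotient.quot (EJideal alpha)) z.

Lemma EJclassD alpha z w :
  EJclass alpha (z + w) = EJclass alpha z + EJclass alpha w.
Proof. by rewrite /EJclass piE. Qed.

Lemma EJclassB alpha z w :
  EJclass alpha (z - w) = EJclass alpha z - EJclass alpha w.
Proof. by rewrite /EJclass !piE. Qed.

Lemma EJclass_eq alpha z w :
  EJclass alpha z = EJclass alpha w <-> exists q, z - w = q * alpha.
Proof.
split=> [/eqP|H].
  by rewrite /EJclass -Quotient.idealrBE => /asboolP.
by apply/eqP; rewrite /EJclass -Quotient.idealrBE; apply/asboolP.
Qed.

Lemma EJclass_surj alpha (u : EJnode alpha) : exists z, u = EJclass alpha z.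
Proof. by exists (repr u); rewrite /EJclass reprK. Qed.

Definition EJadj (alpha : EJint) : rel (EJnode alpha) := fun u v =>
  u - v \in [seq EJclass alpha e
            | e <- [:: 1; -1; rho; - rho; rho ^+ 2; - rho ^+ 2]].

(* [s] is the list of all nodes of a path, both ends included *)
Definition EJpath (alpha : EJint) (u v : EJnode alpha)
    (s : seq (EJnode alpha)) : bool :=
  if s is w :: s' then
    [&& w == u, path (@EJadj alpha) w s', last w s' == v & uniq s]
  else false.

Definition path_length (T : Type) (s : seq T) : nat := (size s).-1.

Definition has_EJpath (alpha : EJint) (u v : EJnode alpha) : pred nat :=
  fun l => `[< exists s, EJpath u v s /\ path_length s = l >].

Lemma EJconnected alpha (u v : EJnode alpha) : exists l, has_EJpath u v l.
Proof.
suff [s Hs Hl] : exists2 s, path (@EJadj alpha) u s & last u s = v.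
  move: Hl; case/shortenP: Hs => s' Hs' Us' _ Hl.
  exists (path_length (u :: s')); apply/asboolP; exists (u :: s'); split=> //.
  by apply/and4P; split=> //; apply/eqP.
pose C w := exists2 s, path (@EJadj alpha) u s & last u s = w.
have step w e : e \in [:: 1; -1; rho; - rho; rho ^+ 2; - rho ^+ 2] ->
    C w -> C (w - EJclass alpha e).
  move=> He [s Hs Hl]; exists (rcons s (w - EJclass alpha e)); last first.
    by rewrite last_rcons.
  rewrite rcons_path Hs Hl /= /EJadj opprB addrC subrK; exact: map_f.
have iterstep w e k : e \in [:: 1; -1; rho; - rho; rho ^+ 2; - rho ^+ 2] ->
    C w -> C (w - EJclass alpha (e *+ k)).
  move=> He Hw; elim: k => [|k IH].
    by rewrite mulr0n -(subrr 0) EJclassB subrr subr0.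
  by rewrite mulrSr EJclassD opprD addrA; apply: step.
have [z Ez] := EJclass_surj (u - v).
have -> : v = u - EJclass alpha z by rewrite -Ez opprB addrC subrK.
have Cu : C u by exists [::].
case: z {Ez} => x y; rewrite EJintE EJclassD opprD addrA.
case: x => m; case: y => k.
- by apply/iterstep/iterstep.
- by rewrite NegzE mulrNz -mulNrz; apply/iterstep/iterstep.
- by rewrite NegzE mulrNz -mulNrz; apply/iterstep/iterstep.
- by rewrite !NegzE !mulrNz -!mulNrz; apply/iterstep/iterstep.
Qed.

Definition EJdist (alpha : EJint) (u v : EJnode alpha) : nat :=
  ex_minn (EJconnected u v).

Definition EJalpha (a b : nat) : EJint := a%:R + b%:R * rho.

Definition EJorder (a b : nat) : nat := (a ^ 2 + b ^ 2 + a * b)%N.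

Lemma EJalphaE a b : EJalpha a b = EJInt a b.
Proof.
by rewrite /EJalpha EJintE mulr_natl -!pmulrn.
Qed.

Lemma EJideal_alphaE a b x y :
  (exists q, EJInt x y = q * EJalpha a b) <->
  exists p q : int, x = p * a%:Z - q * b%:Z /\ y = p * b%:Z + q * (a + b)%N%:Z.
Proof.
rewrite EJalphaE; split=> [[[p q] [-> ->]]|[p [q [-> ->]]]].
  by exists p, q; split; rewrite ?PoszD; ring.
by exists (EJInt p q); congr EJInt; rewrite ?PoszD /=; ring.
Qed.

Lemma ltn_mulz_eq (x y d : nat) (K : int) : (x < d)%N -> (y < d)%N ->
  x%:Z - y%:Z = K * d%:Z -> K = 0 /\ x = y.
Proof.
move=> xd yd; case: K => [[|n]|n] E; first by split=> //; lia.
  by exfalso; move: E; rewrite -PoszM mulSn; lia.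
by exfalso; move: E; rewrite NegzE mulNr -PoszM mulSn; lia.
Qed.

(* EJ_alpha has a^2 + b^2 + a b nodes, so that numberings of its nodes by
   0, ..., n-1 exist. *)
Lemma EJnumbering a b : EJalpha a b != 0 ->
  exists nu : 'I_(EJorder a b) -> EJnode (EJalpha a b), bijective nu.
Proof.
move=> nz.
have d0 : (0 < gcdn a b)%N.
  rewrite gcdn_gt0 !lt0n -negb_and; apply: contraNN nz => /andP[/eqP-> /eqP->].
  by rewrite EJalphaE.
have /dvdnP[a' Ea] := dvdn_gcdl a b; have /dvdnP[b' Eb] := dvdn_gcdr a b.
set d := gcdn a b in d0 Ea Eb.
have cop : coprime a' b'.
  by rewrite /coprime -(eqn_pmul2r d0) muln_gcdl -Ea -Eb mul1n.
pose m := (d * (a' ^ 2 + b' ^ 2 + a' * b'))%N.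
have nE : EJorder a b = (m * d)%N by rewrite /EJorder /m Ea Eb !expnMn -!mulnn; ring.
have m0 : (0 < m)%N.
  rewrite muln_gt0 d0 -addnA lt0n addn_eq0 expn_eq0 /= negb_and -lt0n.
  have [a0|//] := posnP a'; move: cop; rewrite a0 /coprime gcd0n => /eqP->.
  by [].
set alpha := EJalpha a b in nz *.
have classE x y x' y' : EJclass alpha (EJInt x y) = EJclass alpha (EJInt x' y')
  <-> exists p q : int, x - x' = p * a%:Z - q * b%:Z /\
                        y - y' = p * b%:Z + q * (a + b)%N%:Z.
  by rewrite EJclass_eq -EJideal_alphaE.
pose nu (i : 'I_(EJorder a b)) :=
  EJclass alpha (EJInt (i %% m)%N (i %/ m)%N).
have inj : injective nu.
  move=> i j /classE[p [q [E1 E2]]].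
  have yi : (i %/ m < d)%N by rewrite ltn_divLR // mulnC -nE.
  have yj : (j %/ m < d)%N by rewrite ltn_divLR // mulnC -nE.
  have xi := ltn_pmod i m0; have xj := ltn_pmod j m0.
  have E2' : (i %/ m)%N%:Z - (j %/ m)%N%:Z
             = (p * b'%:Z + q * (a' + b')%N%:Z) * d%:Z.
    by rewrite E2 Ea Eb !PoszD !PoszM; ring.
  have [K0 Ey] := ltn_mulz_eq yi yj E2'.
  have [t Et] : exists t, q = t * b'%:Z.
    apply/dvdzP; have /Gauss_dvdzl <- : coprimez b' a'.
      by rewrite coprimezE /= coprime_sym.
    apply/dvdzP; exists (- p - q); move: K0; rewrite PoszD => K0.
    rewrite mulrBl mulNr; apply/eqP; rewrite -subr_eq0 -K0; apply/eqP; ring.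
  have [b0|b0] := posnP b'.
    have a1 : a' = 1%N by move: cop; rewrite b0 /coprime gcdn0 => /eqP.
    have mE : m = d by rewrite /m b0 a1 -!mulnn; lia.
    have E : (i %% m)%N%:Z - (j %% m)%N%:Z = p * m%:Z.
      by rewrite E1 Ea Eb b0 a1 mE mul0n mul1n mulr0 subr0.
    have [_ Ex] := ltn_mulz_eq xi xj E.
    by apply: val_inj; rewrite /= (divn_eq i m) (divn_eq j m) Ey Ex.
  have Ep : p = - t * (a' + b')%N%:Z.
    have b'0 : b'%:Z != 0 by lia.
    by apply: (mulIf b'0); move: K0; rewrite Et !PoszD => K0; lia.
  have E : (i %% m)%N%:Z - (j %% m)%N%:Z = - t * m%:Z.
    by rewrite E1 Ep Et Ea Eb /m -!mulnn !(PoszD, PoszM); ring.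
  have [_ Ex] := ltn_mulz_eq xi xj E.
  by apply: val_inj; rewrite /= (divn_eq i m) (divn_eq j m) Ey Ex.
have surj u : exists i, nu i == u.
  have [[x y] ->] := EJclass_surj u.
  have [k1 [k2 Ek]] := Bezoutz b a.
  have Ed : k1 * b%:Z + k2 * a%:Z = d%:Z by rewrite Ek /gcdz /= gcdnC.
  pose y1 := (y %/ d)%Z; pose p := k1 - k2; pose q := k2.
  pose x1 := x - y1 * (p * a%:Z - q * b%:Z).
  have m0z : m%:Z != 0 by lia.
  have d0z : d%:Z != 0 by lia.
  have Ey := divz_eq y d; have Ex := divz_eq x1 m.
  have := modz_ge0 x1 m0z; have := ltz_pmod x1 (m0 : 0 < m%:Z).
  have := modz_ge0 y d0z; have := ltz_pmod y (d0 : 0 < d%:Z).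
  case: (x1 %% m)%Z Ex => // x2 Ex; case: (y %% d)%Z Ey => // y2 Ey y2d _ x2m _.
  have lt_n : (y2 * m + x2 < EJorder a b)%N.
    rewrite nE; apply: leq_trans (_ : y2.+1 * m <= _)%N.
      by rewrite mulSn addnC ltn_add2r.
    by rewrite mulnC leq_mul2l orbC; move: y2d; rewrite ltz_nat => ->.
  exists (Ordinal lt_n); apply/eqP/classE; rewrite /= modnMDl divnMDl //.
  rewrite modn_small // divn_small // addn0.
  pose r := (x1 %/ m)%Z.
  exists (- (y1 * p + r * (a' + b')%N%:Z)), (- (y1 * q - r * b'%:Z)).
  have mE : m%:Z = (a' + b')%N%:Z * a%:Z + b'%:Z * b%:Z.
    by rewrite Ea Eb /m -!mulnn !(PoszD, PoszM); ring.
  have zE : (a' + b')%N%:Z * b%:Z - b'%:Z * (a + b)%N%:Z = 0.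
    by rewrite Ea Eb !(PoszD, PoszM); ring.
  have xE : x = x1 + y1 * (p * a%:Z - q * b%:Z) by rewrite /x1 subrK.
  split.
    rewrite xE Ex -/r mE; ring.
  rewrite [in LHS]Ey -/y1 -Ed.
  apply/eqP; rewrite -subr_eq0; apply/eqP.
  rewrite -[RHS](mulr0 (- - r)) -zE /p /q !PoszD; ring.
pose g u := xchoose (surj u).
have gK u : nu (g u) = u by apply/eqP/(xchooseP (surj u)).
by exists nu; exists g => // i; apply: inj.
Qed.

(* Structured programs for a random-access machine over the natural numbers,
   with registers, an addressable memory and a write-only output tape.  The
   arithmetic is restricted to addition, truncated subtraction and comparisons,
   so that the unit cost of an operation is not abused through fast-growing
   numbers. *)
Inductive expr :=
| Lit of nat
| Reg of nat
| Cell of expr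
| Add of expr & expr
| Sub of expr & expr
| Ltn of expr & expr
| Eqn of expr & expr.

Inductive prog :=
| Skip
| SetReg of nat & expr
| SetMem of expr & expr
| Emit of expr
| Seq of prog & prog
| If of expr & prog & prog
| While of expr & prog.

Record state := State {
  regs : nat -> nat;
  memory : nat -> nat;
  tape : seq nat }.

Fixpoint eval (s : state) (e : expr) : nat :=
  match e with
  | Lit k => k
  | Reg r => regs s r
  | Cell e => memory s (eval s e)
  | Add e1 e2 => (eval s e1 + eval s e2)%N
  | Sub e1 e2 => (eval s e1 - eval s e2)%N
  | Ltn e1 e2 => (eval s e1 < eval s e2)%N
  | Eqn e1 e2 => eval s e1 == eval s e2
  end.

Fixpoint expr_cost (e : expr) : nat :=
  match e with
  | Lit _ | Reg _ => 1
  | Cell e => (expr_cost e).+1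
  | Add e1 e2 | Sub e1 e2 | Ltn e1 e2 | Eqn e1 e2 =>
      (expr_cost e1 + expr_cost e2).+1
  end.

Definition update (f : nat -> nat) (i v : nat) : nat -> nat :=
  fun j => if j == i then v else f j.

(* [exec P s t s']: started in state [s], the program [P] halts in state [s']
   after exactly [t] elementary operations. *)
Inductive exec : prog -> state -> nat -> state -> Prop :=
| ExecSkip s : exec Skip s 1 s
| ExecSetReg r e s :
    exec (SetReg r e) s (expr_cost e).+1
      (State (update (regs s) r (eval s e)) (memory s) (tape s))
| ExecSetMem e1 e2 s :
    exec (SetMem e1 e2) s (expr_cost e1 + expr_cost e2).+1
      (State (regs s) (update (memory s) (eval s e1) (eval s e2)) (tape s))
| ExecEmit e s :
    exec (Emit e) s (expr_cost e).+1
      (State (regs s) (memory s) (rcons (tape s) (eval s e)))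
| ExecSeq P1 P2 s1 s2 s3 t1 t2 :
    exec P1 s1 t1 s2 -> exec P2 s2 t2 s3 ->
    exec (Seq P1 P2) s1 (t1 + t2) s3
| ExecIf e P1 P2 s t s' :
    exec (if eval s e != 0%N then P1 else P2) s t s' ->
    exec (If e P1 P2) s ((expr_cost e).+1 + t) s'
| ExecWhileStop e P s :
    eval s e = 0%N -> exec (While e P) s (expr_cost e).+1 s
| ExecWhileStep e P s1 s2 s3 t1 t2 :
    eval s1 e <> 0%N -> exec P s1 t1 s2 -> exec (While e P) s2 t2 s3 ->
    exec (While e P) s1 ((expr_cost e).+1 + t1 + t2) s3.

Lemma exec_det P s t1 s1 t2 s2 :
  exec P s t1 s1 -> exec P s t2 s2 -> t1 = t2 /\ s1 = s2.
Proof.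
move=> H; elim: H t2 s2 => {P s t1 s1}.
- by move=> s t2 s2 H; inversion H; subst.
- by move=> r e s t2 s2 H; inversion H; subst.
- by move=> e1 e2 s t2 s2 H; inversion H; subst.
- by move=> e s t2 s2 H; inversion H; subst.
- move=> P1 P2 s1 s2 s3 t1 t2 _ IH1 _ IH2 t s H; inversion H; subst.
  have [-> E] := IH1 _ _ ltac:(eassumption); subst.
  by have [-> ->] := IH2 _ _ ltac:(eassumption).
- move=> e P1 P2 s t s' _ IH t2 s2 H; inversion H; subst.
  by have [-> ->] := IH _ _ ltac:(eassumption).
- by move=> e P s E t2 s2 H; inversion H; subst.
- move=> e P s1 s2 s3 t1 t2 E _ IH1 _ IH2 t s H; inversion H; subst => //.
  have [-> E'] := IH1 _ _ ltac:(eassumption); subst.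
  by have [-> ->] := IH2 _ _ ltac:(eassumption).
Qed.

Section InputOutput.

Variables (a b : nat) (nu : 'I_(EJorder a b) -> EJnode (EJalpha a b)).

(* The number of the node u + rho^k; the powers rho^0, ..., rho^5 are
   1, rho, rho^2, -1, -rho, -rho^2. *)
Definition EJneighbour (u : 'I_(EJorder a b)) (k : nat) : nat :=
  if [pick v | nu v == nu u + EJclass (EJalpha a b) (rho ^+ k)] is Some v
  then val v else 0%N.

(* The network is handed over as a table of neighbours: cell 6 u + k, for u < n
   and k < 6, holds the number of the k-th neighbour of node u. *)
Definition EJtable (i : nat) : nat :=
  if insub (i %/ 6)%N is Some u then EJneighbour u (i %% 6)%N else 0%N.

(* Registers 0, 1 and 2 initially hold a, b and n. *)
Definition EJinput : state :=
  State (nth 0%N [:: a; b; EJorder a b]) EJtable [::].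

(* An answer (u, v, l, s) stands for the path [s] from [u] to [v] of length
   [l]; it is written on the tape as u, v, l followed by the nodes of [s]. *)
Definition EJanswer : eqType :=
  ('I_(EJorder a b) * 'I_(EJorder a b) * nat * seq 'I_(EJorder a b))%type.

Definition EJvalid (x : EJanswer) : bool :=
  let: (u, v, l, s) := x in
  EJpath (nu u) (nu v) [seq nu w | w <- s] && (path_length s == l).

Definition EJencode (x : EJanswer) : seq nat :=
  let: (u, v, l, s) := x in
  [:: val u, val v, l & [seq val w | w <- s]].

Definition EJsolution (out : seq nat) : Prop :=
  exists xs : seq EJanswer,
    [/\ out = flatten [seq EJencode x | x <- xs],
        all EJvalid xs &
        forall (u v : 'I_(EJorder a b)) (l : nat), u != v ->
          (EJdist (nu u) (nu v) <= l <= (EJorder a b).-1)%N ->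
          exists s, (u, v, l, s) \in xs].

End InputOutput.

(* Main.v *)
(** Let z be one of the two common neighbours of the ends of an edge of a path.
    If z is not on the path, then inserting z into the edge makes the path
    longer by one and keeps its ends.  Hence all lengths are obtained if some
    shortest path from u to v can be grown by insertions until no node is left.

    Up to multiplication by a power of rho, v - u = -x + y rho with
    0 <= x <= y = D(u, v) <= b, so that a shortest path climbs by one row at each
    step, its steps being rho or rho^2.  The multiples of alpha have a fundamental
    domain consisting of a + b rows, whose left border follows this path and then
    goes straight up.  First the path grows upwards into a strip of three columns
    along the upper part of the border (the spine); then fingers two rows high, in
    the rows 2i and 2i + 1, grow from the border to the right.  Every node that is
    left, at the right end of a row, in an unpaired top row or in the long row
    b - 1 when it is paired with the short row b, can then be inserted into an edge
    of the boundary of a finger.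

    The program runs through all u, all rotations and all parameters of a shortest
    path and prints the current path after each insertion.  All that it prints is
    correct whatever the parameters are, so that the geometry is only needed to see
    that for suitable parameters it covers all nodes. *)

(* No width of a row has to be known while the path grows. The point just past the right end of a
   row is, modulo alpha, the first point of another row; it lies on the left border, so it is
   already visited once the border is complete, and a finger stops there by itself. This is why the
   spine comes before the fingers and why the program only ever tests whether nodes are free.

   Pairing the rows from the bottom forces s to be odd: row s then closes a pair, and the spine can
   leave from an edge of direction -1 in that row.

   For the lengths it suffices that some representative of v - u has hexagonal norm at most D(u, v),
   since the grown paths start at the length of such a representative and each insertion adds one.

   The exponent 4 comes from (a + b + 1)^2 <= 7 n. There are O(n) pairs (s, k), hence O(n^2) runs
   over all start nodes, rotations and parameters. A run tries O(n) insertions, each charged O(n)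
   for the path that it may print. *)
Require Import Defs.
From mathcomp Require Import all_boot all_order all_algebra.
From mathcomp Require Import boolp zify ring.

Set Implicit Arguments.
Unset Strict Implicit.
Unset Printing Implicit Defensive.

Import Order.TTheory GRing.Theory Num.Theory.
Local Open Scope ring_scope.

(** * A fundamental domain for the lattice of multiples of alpha *)

(* Row j of the fundamental domain consists of the points i + j rho with
   rowstart <= i < rowend.  The first s steps of its left border are those of a
   shortest path: k times rho^2, then rho.  Row j continues in row
   [rownext a b j] of a translate of the domain. *)
Definition rowstart (s k j : nat) : int :=
  if (j <= s)%N then - (minn j k)%:Z else - k.+1%:Z.

Definition rowend (a b s k j : nat) : int :=
  if (j < b)%N then (a + b)%:Z + rowstart s k (j + a)
  else a%:Z + rowstart s k (j - b).

Definition rownext (a b j : nat) : nat := if (j < b)%N then (j + a)%N else (j - b)%N.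

Definition in_tile (a b s k : nat) (i : int) (j : nat) : bool :=
  (j < a + b)%N && (rowstart s k j <= i < rowend a b s k j).

(* The shortest path ends with one more step rho^2 if [ex]; thus s is the largest
   odd number of a row that it meets, whatever the parity of its length.  In the
   case excluded by [good_exc] the growth leaves out one node. *)
Record good_params (a b s k : nat) (ex : bool) : Prop := GoodParams {
  good_b : (0 < b)%N;
  good_ab : (a <= b)%N;
  good_odd : odd s;
  good_ks : (k <= s)%N;
  good_kb : (k < b)%N;
  good_sb : (s <= b)%N;
  good_sb_lt : (a < b)%N -> (s < b)%N;
  good_ex : ex -> (s.+1 < a + b)%N;
  good_exc : ~~ [&& a == 1%N, b == 3%N & k == 0%N] }.

Ltac ifs := repeat (case: ifP => ?); lia.

Section Tile.

Variables (a b s k : nat) (ex : bool).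
Hypothesis good : good_params a b s k ex.

Lemma good_sb_cases : (s < b)%N || (a == b).
Proof. by case: good => _ ab _ _ _ _ sbl _ _; case: ltnP => // bs; case: ltnP sbl; lia. Qed.

Ltac use_good H := have sbl := good_sb_cases; case: (H) => b0 ab od ks kb sb _ exl exc; have s0 := odd_gt0 od.

Local Notation h := (a + b)%N.
Local Notation o := (rowstart s k).
Local Notation e := (rowend a b s k).

Lemma good_sh : (s < h)%N.
Proof.
by use_good good; lia.
Qed.

Lemma rowstart0 : o 0 = 0.
Proof. by rewrite /rowstart /= min0n. Qed.

Lemma rowstartS j : o j.+1 = o j \/ o j.+1 = o j - 1.
Proof. by use_good good; rewrite /rowstart; ifs. Qed.

Lemma rowstart_lo j : (j < s)%N -> o j.+1 = if (j < k)%N then o j - 1 else o j.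
Proof. by move=> js; rewrite /rowstart; ifs. Qed.

Lemma rowstart_s : o s = - k%:Z.
Proof. by use_good good; rewrite /rowstart; ifs. Qed.

Lemma rowstart_hi j : (s < j)%N -> o j = o s - 1.
Proof. by use_good good; rewrite /rowstart; ifs. Qed.

Lemma rowstart_ge j : o s - 1 <= o j.
Proof. by use_good good; rewrite /rowstart; ifs. Qed.

Lemma rowendS j : (j.+1 < h)%N -> (j.+1)%N != b -> e j.+1 = e j \/ e j.+1 = e j - 1.
Proof.
rewrite /rowend => jh jb; case: (ltnP j b) => jltb; last first.
  rewrite ltnNge (leq_trans jltb) //=; rewrite subSn //.
  by case: (rowstartS (j - b)) => ->; lia.
have -> : (j.+1 < b)%N by lia.
by rewrite addSn; case: (rowstartS (j + a)) => ->; lia.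
Qed.

Lemma rowend_le j : (j.+1 < h)%N -> e j.+1 <= e j.
Proof.
move=> jh; have [/eqP jb|/(rowendS jh)] := boolP (j.+1 == b); last by case=> ->; lia.
rewrite /rowend; have -> : (j.+1 < b)%N = false by lia.
have -> : (j < b)%N by lia.
have -> : (j.+1 - b)%N = 0%N by lia.
rewrite rowstart0; use_good good => /=.
by rewrite /rowstart; by ifs.
Qed.

Lemma rowend_drop j : (j.+1 < h)%N -> j.+1 = b -> (0 < a)%N /\ e j.+1 = a.
Proof.
move=> jh jb; split; first by lia.
rewrite /rowend; have -> : (j.+1 < b)%N = false by lia.
have -> : (j.+1 - b)%N = 0%N by lia.
by rewrite rowstart0 addr0.
Qed.

Lemma rowstart_lt_rowend j : (j < h)%N -> o j < e j.
Proof.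
move=> jh; use_good good; rewrite /rowend /rowstart.
by ifs.
Qed.

Lemma rowend_spine j : (s <= j)%N -> (j.+1 < h)%N -> o s + 1 < e j.
Proof.
move=> sj jh; have sh := good_sh; use_good good; rewrite rowstart_s /rowend /rowstart.
by ifs.
Qed.

Lemma rowend_spine_top j : (s < j)%N -> (j < h)%N -> o s < e j.
Proof.
move=> sj jh; have sh := good_sh; use_good good; rewrite rowstart_s /rowend /rowstart.
by ifs.
Qed.

Lemma rowend_base j : (j < s)%N -> o j < e j.+1.
Proof.
move=> sj; have sh := good_sh; use_good good; rewrite /rowend /rowstart.
by ifs.
Qed.

(** The drop of the right border at row b is the only place where the spine may leave no room to its
    right in the row above; this exception becomes the case [stuck]. *)
Lemma rowend_spine_pair j : (s < j)%N -> (j.+1 < h)%N ->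
  o s + 1 < e j.+1 \/ (a = 1%N /\ k = 0%N /\ j.+1 = b).
Proof.
move=> sj jh; have sh := good_sh; use_good good; rewrite rowstart_s /rowend /rowstart.
by ifs.
Qed.

(** This is what makes [a + b] finger steps enough in every row. *)
Lemma width_le j : (j < h)%N -> e j - o j <= h%:Z.
Proof.
move=> jh; have sh := good_sh; use_good good; rewrite /rowend /rowstart.
by ifs.
Qed.

Lemma rownext_lt j : (j < h)%N -> (rownext a b j < h)%N.
Proof. by rewrite /rownext; ifs. Qed.

(** The multiples of alpha in the basis alpha - rho alpha = (a + b) - a rho and alpha = a + b rho.
    With this basis passing to the next row, as in [rownext], subtracts a single basis vector. *)
Definition lattice (x y : int) : Prop := exists p q : int,
  x = p * h%:Z + q * a%:Z /\ y = q * b%:Z - p * a%:Z.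

Lemma lattice_next j : (j < h)%N ->
  lattice (e j - o (rownext a b j)) (j%:Z - (rownext a b j)%:Z).
Proof.
rewrite /rowend /rownext => jh; case: ifP => jb; last first.
  by exists 0, 1; split; lia.
by exists 1, 0; split; lia.
Qed.

(* Induction on p + q: one of the two generators leads back from row j' to a row
   of the domain, and there the claim is the bound rowstart < rowend. *)
Lemma tile_disjoint_aux N j j' (p q : nat) : (p + q)%N = N.+1 ->
  (j < h)%N -> (j' < h)%N -> j'%:Z - j%:Z = q%:Z * b%:Z - p%:Z * a%:Z ->
  e j' <= o j + p%:Z * h%:Z + q%:Z * a%:Z.
Proof.
have b0 := good_b good; have ab := good_ab good.
elim: N j' p q => [|N IH] j' p q Epq jh jh' Ej.
  have [[Ep Eq]|[Ep Eq]] : (p = 1 /\ q = 0)%N \/ (p = 0 /\ q = 1)%N by lia.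
    rewrite Ep Eq in Ej *; rewrite /rowend; have -> : (j' < b)%N by lia.
    have -> : (j' + a)%N = j by lia.
    by lia.
  rewrite Ep Eq in Ej *; rewrite /rowend; have -> : (j' < b)%N = false by lia.
  have -> : (j' - b)%N = j by lia.
  by lia.
case: (ltnP j' b) => jb.
  case: p Epq Ej => [|p] Epq Ej; first by nia.
  have jh2 : (j' + a < h)%N by lia.
  have H := IH (j' + a)%N p q ltac:(lia) jh jh2 ltac:(lia).
  have := rowstart_lt_rowend jh2.
  have -> : e j' = h%:Z + o (j' + a)%N by rewrite /rowend jb.
  by lia.
case: q Epq Ej => [|q] Epq Ej; first by nia.
have jh2 : (j' - b < h)%N by lia.
have H := IH (j' - b)%N p q ltac:(lia) jh jh2 ltac:(lia).
have := rowstart_lt_rowend jh2.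
have -> : e j' = a%:Z + o (j' - b)%N by rewrite /rowend ltnNge jb.
by lia.
Qed.

(** Coefficients p and q of opposite signs would put the rows at least a + b apart. For equal signs
    the disjointness bound applies, in one direction or the other. *)
Lemma tile_inj i j i' j' : in_tile a b s k i j -> in_tile a b s k i' j' ->
  lattice (i - i') (j%:Z - j'%:Z) -> i = i' /\ j = j'.
Proof.
have sufH i1 j1 i2 j2 (p q : nat) : in_tile a b s k i1 j1 ->
    in_tile a b s k i2 j2 -> i2 - i1 = p%:Z * h%:Z + q%:Z * a%:Z ->
    j2%:Z - j1%:Z = q%:Z * b%:Z - p%:Z * a%:Z -> i2 = i1 /\ j2 = j1.
  case/andP=> jh1 /andP[oi1 _] /andP[jh2 /andP[_ ie2]] Ei Ej.
  case N : (p + q)%N => [|N'].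
    have [Ep Eq] : (p = 0 /\ q = 0)%N by lia.
    by rewrite Ep Eq in Ei Ej; split; lia.
  by have := tile_disjoint_aux N jh1 jh2 Ej; lia.
move=> T T' [p [q [Ei Ej]]].
have b0 := good_b good; have ab := good_ab good.
have [jh jh'] : (j < h)%N /\ (j' < h)%N by case/andP: T; case/andP: T'.
have [/andP[p0 q0]|/andP[p0 q0]] : (0 <= p) && (0 <= q) \/ (p <= 0) && (q <= 0).
- case: (lerP 0 p) => p0; case: (lerP 0 q) => q0; [by left| | |by right; lia].
    case: (ltrP 0 p) => p1; [exfalso|by right; lia].
    have {p1}[p' Ep] : exists p', p = p'.+1%:Z by exists `|p|.-1%N; lia.
    have {q0}[q' Eq] : exists q', q = - q'.+1%:Z by exists `|q|.-1%N; lia.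
    by rewrite Ep Eq in Ej; nia.
  case: (ltrP 0 q) => q1; [exfalso|by right; lia].
  have {p0}[p' Ep] : exists p', p = - p'.+1%:Z by exists `|p|.-1%N; lia.
  have {q0}[q' Eq] : exists q', q = q'.+1%:Z by exists `|q|.-1%N; lia.
  by rewrite Ep Eq in Ej; nia.
- by apply: (sufH i' j' i j `|p|%N `|q|%N); rewrite ?gez0_abs.
- have [||-> ->] // := sufH i j i' j' `|p|%N `|q|%N T T'; rewrite ?lez0_abs //; lia.
Qed.

(** Leaving a row at its right end means entering the row [rownext] at its start, up to a lattice
    vector. Since no row is empty, the distance from the left border decreases, so every point to
    the right of the border is reduced. *)
Lemma tile_surj (i j : int) : exists i' j',
  in_tile a b s k i' j' /\ lattice (i - i') (j - j'%:Z).
Proof.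
have b0 := good_b good; have ab := good_ab good.
have latD x y x' y' : lattice x y -> lattice x' y' -> lattice (x + x') (y + y').
  move=> [p [q [-> ->]]] [p' [q' [-> ->]]].
  by exists (p + p'), (q + q'); split; ring.
have h0 : h%:Z != 0 by lia.
have right_row m : forall (i1 : int) r, (r < h)%N -> i1 - o r = m%:Z ->
    exists i' j', in_tile a b s k i' j' /\ lattice (i1 - i') (r%:Z - j'%:Z).
  elim/ltn_ind: m => m IH i1 r rh Em.
  case: (ltP i1 (e r)) => ie.
    exists i1, r; split; last by exists 0, 0; split; lia.
    by rewrite /in_tile rh ie; lia.
  have we := rowstart_lt_rowend rh; have L := lattice_next rh.
  have rh' := rownext_lt rh.
  have [i' [j' [T' L']]] := IH `|i1 - e r|%N ltac:(lia)
    (o (rownext a b r) + (i1 - e r)) _ rh' ltac:(lia).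
  exists i', j'; split=> //.
  have := latD _ _ _ _ L L'; congr lattice; lia.
pose t := (j %/ h)%Z; pose r := `|(j %% h)%Z|%N.
have rE : r%:Z = (j %% h)%Z by rewrite /r gez0_abs // modz_ge0.
have rh : (r < h)%N by have := ltz_pmod j (_ : 0 < h%:Z); lia.
have jE : j = t * h%:Z + r%:Z by rewrite rE -divz_eq.
(* The vector (-b, a + b) of the lattice has reduced the row to r. The vector (N, 0), where N is the
   norm of alpha and (p, q) = (b, a), now moves the point to the right of the border. *)
pose N : nat := (b * h + a * a)%N.
pose K : int := (absz (i + t * b%:Z - o r)%R)%:Z.
pose i1 : int := i + t * b%:Z + K * N%:Z.
have N1 : (0 < N)%N by rewrite /N; nia.
have i1o : 0 <= i1 - o r by rewrite /i1 /K; nia.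
have [i' [j' [T' L']]] := right_row `|i1 - o r|%N i1 r rh ltac:(lia).
exists i', j'; split=> //.
have L : lattice (i - i1) (j - r%:Z).
  exists (- t - K * b%:Z), (t - K * a%:Z); rewrite /i1 jE /N; split.
    by rewrite !(PoszD, PoszM); ring.
  by rewrite !(PoszD, PoszM); ring.
have := latD _ _ _ _ L L'; congr lattice; lia.
Qed.

End Tile.

(** * Insertion of a vertex at the apex of a triangle *)

(* D encodes a path: D p is 0 if p is not visited, 7 if p is the last node, and
   d + 1 if the next node is p + rho^d, which is [nb p d].  The edge of direction
   k1 leaving p is replaced by edges of directions k2 and k3, where
   rho^k1 = rho^k2 + rho^k3. *)
Definition insert (nb : nat -> nat -> nat) (k1 k2 k3 p : nat) (D : nat -> nat) :=
  if (D p == k1.+1) && (D (nb p k2) == 0%N)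
  then update (update D (nb p k2) k3.+1) p k2.+1 else D.

(** The tip of a finger is the edge from p to p + rho. Inserting p + 1 leaves an edge rho^2 from p +
    1 to p + rho, and inserting p + 1 + rho into that edge makes p + 1 the bottom of the new tip.
    Both nodes must be free in advance, so that a finger never ends in a half step. *)
Definition finger_step (nb : nat -> nat -> nat) (pD : nat * (nat -> nat)) :=
  let: (p, D) := pD in
  if [&& D p == 2%N, D (nb p 0%N) == 0%N & D (nb (nb p 0%N) 1%N) == 0%N]
  then (nb p 0%N, insert nb 2 1 3 (nb p 0%N) (insert nb 1 0 2 p D)) else (p, D).

Definition pass (nb : nat -> nat -> nat) (k1 k2 k3 m : nat) (D : nat -> nat) :=
  iteri m (insert nb k1 k2 k3) D.

Section Insert.

Variable nb : nat -> nat -> nat.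
Implicit Type D : nat -> nat.

Lemma insert_mono k1 k2 k3 p D x : D x <> 0%N -> insert nb k1 k2 k3 p D x <> 0%N.
Proof. by rewrite /insert /update; case: ifP => // _; case: ifP => // _; case: ifP. Qed.

Lemma insertT k1 k2 k3 p D : D p = k1.+1 -> D (nb p k2) = 0%N ->
  insert nb k1 k2 k3 p D = update (update D (nb p k2) k3.+1) p k2.+1.
Proof. by move=> E1 E2; rewrite /insert E1 E2 !eqxx. Qed.

Lemma insertF k1 k2 k3 p D : D p <> k1.+1 \/ D (nb p k2) <> 0%N ->
  insert nb k1 k2 k3 p D = D.
Proof. by case=> /eqP H; rewrite /insert (negbTE H) ?andbF. Qed.

Lemma insert_other k1 k2 k3 p D x : x <> p -> D x <> 0%N ->
  insert nb k1 k2 k3 p D x = D x.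
Proof.
move=> xp Dx; rewrite /insert; case: ifP => // /andP[_ /eqP Dz].
by rewrite /update; case: eqP => //; case: eqP => // E; case: Dx; rewrite E.
Qed.

Lemma insert_far k1 k2 k3 p D x : x <> p -> x <> nb p k2 ->
  insert nb k1 k2 k3 p D x = D x.
Proof.
by move=> /eqP xp /eqP xq; rewrite /insert; case: ifP => // _; rewrite /update (negbTE xp) (negbTE xq).
Qed.

Lemma passS k1 k2 k3 m D :
  pass nb k1 k2 k3 m.+1 D = insert nb k1 k2 k3 m (pass nb k1 k2 k3 m D).
Proof. by []. Qed.

Lemma pass_mono k1 k2 k3 m D x : D x <> 0%N -> pass nb k1 k2 k3 m D x <> 0%N.
Proof. by move=> H; elim: m => // m IH; rewrite passS; apply: insert_mono. Qed.

Lemma pass_keep k1 k2 k3 m D x : D x <> 0%N -> D x <> k1.+1 ->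
  pass nb k1 k2 k3 m D x = D x.
Proof.
move=> H0 H1; elim: m => // m IH; rewrite passS.
have [E|/eqP ne] := eqVneq x m; last by rewrite insert_other ?IH.
by rewrite insertF ?IH //; left; move: IH H1; rewrite E => ->.
Qed.

(* Distinct edges of direction k1 have distinct apexes, so that a pass treats
   them independently of each other. *)
Lemma pass_apex k1 k2 k3 m D p : (forall x y, (x < m)%N -> (y < m)%N ->
    nb x k2 = nb y k2 -> x = y) ->
  (p < m)%N -> D p = k1.+1 ->
  pass nb k1 k2 k3 m D (nb p k2) <> 0%N /\
  (D (nb p k2) = 0%N -> pass nb k1 k2 k3 m D p = k2.+1).
Proof.
move=> inj pm Dp.
have before i : (i <= p)%N -> pass nb k1 k2 k3 i D p = k1.+1 /\
    (D (nb p k2) = 0%N -> pass nb k1 k2 k3 i D (nb p k2) = 0%N).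
  elim: i => [|i IH] ip; first by [].
  rewrite passS; have [{}IH1 IH2] := IH (ltnW ip).
  split; first by rewrite insert_other ?IH1 //; lia.
  (* A free apex is not the source of an edge, and by injectivity it is not the apex of another one;
     so it stays free until step p. *)
  move=> D0; have [E|/eqP ne] := eqVneq (nb p k2) i.
    by rewrite insertF ?IH2 //; left; move: (IH2 D0); rewrite E => ->.
  rewrite insert_far ?IH2 //.
  by move=> /inj E; have := E pm (ltn_trans ip pm); lia.
have [Bp Bz] := before p (leqnn p).
have at_p : pass nb k1 k2 k3 p.+1 D (nb p k2) <> 0%N /\
    (D (nb p k2) = 0%N -> pass nb k1 k2 k3 p.+1 D p = k2.+1).
  rewrite passS; have [D0|/eqP D0] := eqVneq (D (nb p k2)) 0%N.
    rewrite insertT ?Bz // /update !eqxx; split=> //; by case: ifP.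
  by split=> //; apply/insert_mono/pass_mono.
have Ep : pass nb k1 k2 k3 p.+1 D p <> 0%N.
  by rewrite passS; apply: insert_mono; rewrite Bp.
have after i : (p < i <= m)%N -> pass nb k1 k2 k3 i D (nb p k2) <> 0%N /\
    pass nb k1 k2 k3 i D p = pass nb k1 k2 k3 p.+1 D p.
  elim: i => // i IH /andP[]; rewrite ltnS leq_eqVlt => /orP[/eqP <- _|pi im].
    by split=> //; case: at_p.
  have [|IH1 IH2] := IH; first by rewrite pi ltnW.
  rewrite passS; split; first exact: insert_mono.
  by rewrite insert_other ?IH2 //; lia.
by have [|H1 H2] := after m; [rewrite pm leqnn|split=> // /(proj2 at_p) <-].
Qed.

End Insert.

(** * Growing a path inside the fundamental domain *)

(** F is the covering map from the plane to the node numbers. Only the directions 0 to 3 occur,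
    because these do not lower the row, which is a natural number; they are also the only ones in
    which an apex is sought. *)
Record tile_map (a b s k : nat) (nb : nat -> nat -> nat) (F : int -> nat -> nat) :
    Prop := TileMap {
  tm0 : forall i j, nb (F i j) 0%N = F (i + 1) j;
  tm1 : forall i j, nb (F i j) 1%N = F i j.+1;
  tm2 : forall i j, nb (F i j) 2%N = F (i - 1) j.+1;
  tm3 : forall i j, nb (F i j) 3%N = F (i - 1) j;
  tm_inj : forall i j i' j', in_tile a b s k i j -> in_tile a b s k i' j' ->
    F i j = F i' j' -> i = i' /\ j = j';
  tm_wrap : forall j, (j < a + b)%N ->
    F (rowend a b s k j) j = F (rowstart s k (rownext a b j)) (rownext a b j) }.

Section Growth.

Variables (a b s k : nat) (ex : bool).
Hypothesis good : good_params a b s k ex.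
Variables (nb : nat -> nat -> nat) (F : int -> nat -> nat).
Hypothesis TM : tile_map a b s k nb F.

Local Notation h := (a + b)%N.
Local Notation o := (rowstart s k).
Local Notation e := (rowend a b s k).
Local Notation T := (in_tile a b s k).
Local Notation ins := (insert nb).
Implicit Types (D : nat -> nat) (i c low l : int) (j t : nat).

Lemma tile_eq i j i' j' : T i j -> T i' j' ->
  (F i j == F i' j') = (i == i') && (j == j').
Proof.
move=> t t'; apply/eqP/andP=> [/(tm_inj TM t t')[-> ->]|[/eqP-> /eqP->]].
  by rewrite !eqxx.
by [].
Qed.

Lemma update_tile D i j v i' j' : T i j -> T i' j' ->
  update D (F i j) v (F i' j') = if (i' == i) && (j' == j) then v else D (F i' j').
Proof. by move=> t t'; rewrite /update tile_eq. Qed.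

(* The finger in the rows j and j + 1 reaches column c: its lower side leads to
   (c, j), the next edge is rho, and the way back to the left along row j + 1
   consists of edges of direction 3 as far as column [low]. *)
Definition front j low c D : Prop :=
  [/\ T c j /\ T c j.+1, D (F c j) = 2%N,
      forall i, low < i <= c -> T i j.+1 -> D (F i j.+1) = 4%N,
      forall i, T i j -> (D (F i j) == 0%N) = (c < i)
    & forall i, T i j.+1 -> (D (F i j.+1) == 0%N) = (c < i)].

(** Existing edges are replaced in row j only, while row j + 1 merely gains nodes. The first clause
    therefore also protects the visited nodes of row j + 1, among them the edge recorded in
    [ar_last] for an unpaired top row. *)
Definition only j D D' : Prop :=
  (forall x, D x <> 0%N -> (forall i, T i j -> x <> F i j) -> D' x = D x) /\
  (forall i j', T i j' -> j' <> j -> j' <> j.+1 -> D' (F i j') = D (F i j')).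

Lemma only_refl j D : only j D D. Proof. by []. Qed.

Lemma only_trans j D1 D2 D3 : only j D1 D2 -> only j D2 D3 -> only j D1 D3.
Proof.
move=> [A1 B1] [A2 B2]; split=> [x Dx xj|i j' t n1 n2].
  by rewrite A2 ?A1.
by rewrite B2 ?B1.
Qed.

Lemma only_update2 j D i1 v1 i2 v2 : T i1 j -> T i2 j.+1 -> D (F i2 j.+1) = 0%N ->
  only j D (update (update D (F i2 j.+1) v2) (F i1 j) v1).
Proof.
move=> t1 t2 D0; split=> [x Dx xj|i j' t n1 n2].
  rewrite /update; case: eqP => [E|_]; first by case: (xj _ t1).
  by case: eqP => // E; case: Dx; rewrite E.
have [/negbTE N1 /negbTE N2] : j' != j /\ j' != j.+1 by split; apply/eqP.
by rewrite !update_tile // ?N1 ?N2 !andbF.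
Qed.

Lemma only_insert_right j D i : T i j -> T (i + 1) j -> only j D (ins 1 0 2 (F i j) D).
Proof.
move=> t1 t2; rewrite /insert (tm0 TM) //; case: ifP => // /andP[_ /eqP D0].
split=> [x Dx xj|i' j' t n1 n2].
  by rewrite /update; case: eqP => [E|_]; [case: (xj _ t1)|case: eqP => [E|]; [case: (xj _ t2)|]].
have [/negbTE N1 /negbTE N2] : j' != j /\ j' != j.+1 by split; apply/eqP.
by rewrite !update_tile // ?N1 ?N2 !andbF.
Qed.

Lemma only_insert_up j D i : T i j -> T i j.+1 -> only j D (ins 2 1 3 (F i j) D).
Proof.
move=> t1 t2; rewrite /insert (tm1 TM) //; case: ifP => // /andP[_ /eqP D0].
exact: only_update2.
Qed.

Lemma front_weaken j low low' c D : low <= low' -> front j low c D -> front j low' c D.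
Proof.
move=> ll [H1 H2 H3 H4 H5]; split=> // i /andP[H6 H7] t; apply: H3 => //.
by rewrite H7 (le_lt_trans ll).
Qed.

Lemma front_step j low c D : (j.+1 < h)%N -> low <= c -> front j low c D ->
  c + 1 < e j.+1 ->
  [/\ [&& D (F c j) == 2%N, D (F (c + 1) j) == 0%N & D (F (c + 1) j.+1) == 0%N],
      front j low (c + 1) (ins 2 1 3 (F (c + 1) j) (ins 1 0 2 (F c j) D))
    & only j D (ins 2 1 3 (F (c + 1) j) (ins 1 0 2 (F c j) D))].
Proof.
move=> jh lc [[t1 t2] Dc D4 Z0 Z1] ce.
have t3 : T (c + 1) j.
  by have := rowend_le good jh; move: t1; rewrite /in_tile; lia.
have t4 : T (c + 1) j.+1 by move: t2; rewrite /in_tile; lia.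
have z3 : D (F (c + 1) j) = 0%N by apply/eqP; rewrite Z0 //; lia.
have z4 : D (F (c + 1) j.+1) = 0%N by apply/eqP; rewrite Z1 //; lia.
have o1 : only j D (ins 1 0 2 (F c j) D) by apply: only_insert_right.
have o2 := only_insert_up (ins 1 0 2 (F c j) D) t3 t4.
split; [by rewrite Dc z3 z4 !eqxx| |exact: only_trans o1 o2].
rewrite (@insertT _ 1) ?(tm0 TM) //.
have c1 : (c + 1 == c) = false by lia.
have jS : (j.+1 == j) = false by lia.
rewrite (@insertT _ 2) ?(tm1 TM) //; last 2 first.
- by rewrite !update_tile // c1 !eqxx.
- by rewrite !update_tile // jS !andbF.
split=> //.
- by rewrite update_tile // !eqxx.
- move=> i /andP[li ic] ti; rewrite !update_tile // eqxx jS !andbF andbT.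
  by case: eqP => // ne; apply: D4 => //; lia.
- move=> i ti; rewrite !update_tile // eqxx andbT.
  have -> : (j == j.+1) = false by lia.
  rewrite andbF andbT; have := Z0 i ti.
  case: (i =P c + 1) => [->|n1] /=; first by rewrite ltxx.
  by case: (i =P c) => [->|n2] /= Z; [lia|rewrite Z; lia].
- move=> i ti; rewrite !update_tile // eqxx jS !andbF andbT.
  by have := Z1 i ti; case: (i =P c + 1) => [->|n1] /= Z; [rewrite ltxx|rewrite Z; lia].
Qed.

(* In the second case the border step leaving row j is rho^2. *)
Definition ready j low l D : Prop := front j low l D \/
  [/\ T l j /\ T l j.+1, D (F l j) = 3%N,
      forall i, low < i <= l -> T i j.+1 -> i = l,
      forall i, T i j -> (D (F i j) == 0%N) = (l < i)
    & forall i, T i j.+1 -> (D (F i j.+1) == 0%N) = (l <= i)].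

Lemma ready_insert j low l D : (j.+1 < h)%N -> ready j low l D ->
  front j low l (ins 2 1 3 (F l j) D) /\ only j D (ins 2 1 3 (F l j) D).
Proof.
move=> jh [[[t1 t2] Dl D4 Z0 Z1]|[[t1 t2] Dl D4 Z0 Z1]].
  by rewrite insertF; [split=> //; exact: only_refl|left; rewrite Dl].
split; last exact: only_insert_up.
have z : D (F l j.+1) = 0%N by apply/eqP; rewrite Z1 //; lia.
rewrite insertT ?(tm1 TM) //; have jS : (j.+1 == j) = false by lia.
have jS' : (j == j.+1) = false by lia.
split=> //.
- by rewrite update_tile // !eqxx.
- by move=> i li ti; rewrite !update_tile // (D4 i) // !eqxx jS.
- move=> i ti; rewrite !update_tile // eqxx jS' andbT andbF.
  by have := Z0 i ti; case: (i =P l) => [->|n1] /= Z; [rewrite ltxx|rewrite Z; lia].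
- move=> i ti; rewrite !update_tile // eqxx jS andbT andbF.
  by have := Z1 i ti; case: (i =P l) => [->|n1] /= Z; [rewrite ltxx|rewrite Z; lia].
Qed.

(** The visited node past the end of row j + 1 acts as a barrier: once it is reached, all further
    steps leave the state as it is, so m may be larger than the number of steps needed. *)
Lemma front_grow j low c D m : (j.+1 < h)%N -> low <= c -> front j low c D ->
  D (F (e j.+1) j.+1) <> 0%N -> e j.+1 <= c + 1 + m%:Z ->
  exists D', [/\ iter m (finger_step nb) (F c j, D) = (F (e j.+1 - 1) j, D'),
    front j low (e j.+1 - 1) D' & only j D D'].
Proof.
move=> jh; elim: m c D => [|m IH] c D lc fr bar em.
  have -> : e j.+1 - 1 = c.
    by case: fr => [[_ t2]] _ _ _ _; move: t2; rewrite /in_tile; lia.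
  by exists D; split=> //; exact: only_refl.
have [ce|ce] := ltP (c + 1) (e j.+1).
  have [g fr' on] := front_step jh lc fr ce.
  have [|||D' [E fr'' on']] := IH (c + 1) _ _ fr'; [lia| |lia|].
    by case: on => on1 _; apply: insert_mono; apply: insert_mono.
  exists D'; split=> //; last exact: only_trans on on'.
  by rewrite iterSr /finger_step !(tm0 TM) (tm1 TM) g E.
have Ec : c + 1 = e j.+1.
  by case: fr => [[_ t2]] _ _ _ _; move: t2; rewrite /in_tile; lia.
exists D; rewrite -Ec addrK; split=> //.
elim: m.+1 => // m' IHm; rewrite iterS IHm /finger_step !(tm0 TM) (tm1 TM) Ec.
by have /eqP/negbTE -> := bar; rewrite !andbF.
Qed.

Lemma ready_grow j low l D : (j.+1 < h)%N -> low <= l -> ready j low l D ->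
  D (F (e j.+1) j.+1) <> 0%N ->
  exists D', [/\ iter h (finger_step nb) (F l j, ins 2 1 3 (F l j) D) =
      (F (e j.+1 - 1) j, D'),
    front j low (e j.+1 - 1) D' & only j D D'].
Proof.
move=> jh ll rd bar; have [fr on] := ready_insert jh rd.
have [||D' [E fr' on']] := front_grow (m := h) jh ll fr.
- exact: insert_mono.
- have := width_le good jh; case: fr => [[_ t2]] _ _ _ _; move: t2; rewrite /in_tile; lia.
by exists D'; split=> //; apply: only_trans on on'.
Qed.

End Growth.

(** * The shortest path at the border and the growth of the spine *)

Section Growth2.

Variables (a b s k : nat) (ex : bool).
Hypothesis good : good_params a b s k ex.
Variables (nb : nat -> nat -> nat) (F : int -> nat -> nat).
Hypothesis TM : tile_map a b s k nb F.

Local Notation h := (a + b)%N.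
Local Notation o := (rowstart s k).
Local Notation e := (rowend a b s k).
Local Notation T := (in_tile a b s k).
Local Notation ins := (insert nb).
Local Notation front := (front a b s k F).
Local Notation only := (only a b s k F).
Local Notation ready := (ready a b s k F).
Implicit Types (D B : nat -> nat) (i c low l : int) (j t : nat).

Lemma tile_start j : (j < h)%N -> T (o j) j.
Proof. by move=> jh; rewrite /in_tile jh lexx (rowstart_lt_rowend good jh). Qed.

Lemma ready_frame j low l D D' :
  (forall i j', (j' == j) || (j' == j.+1) -> T i j' -> D' (F i j') = D (F i j')) ->
  ready j low l D -> ready j low l D'.
Proof.
move=> ag [[[t1 t2] Dl D4 Z0 Z1]|[[t1 t2] Dl D4 Z0 Z1]]; [left|right]; split=> //.
- by rewrite ag ?eqxx.
- by move=> i li t; rewrite ag ?eqxx ?orbT ?D4.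
- by move=> i t; rewrite ag ?eqxx ?Z0.
- by move=> i t; rewrite ag ?eqxx ?orbT ?Z1.
- by rewrite ag ?eqxx.
- by move=> i t; rewrite ag ?eqxx ?Z0.
- by move=> i t; rewrite ag ?eqxx ?orbT ?Z1.
Qed.

(** With [low = c] nothing is recorded about edges along row j + 1, so the direction at the corner
    (c, j + 1) may change. This happens when the spine leaves from row s. *)
Lemma front_frame j c D D' : front j c c D ->
  (forall i, T i j -> D' (F i j) = D (F i j)) ->
  (forall i, T i j.+1 -> i <> c -> D' (F i j.+1) = D (F i j.+1)) ->
  D' (F c j.+1) <> 0%N -> front j c c D'.
Proof.
move=> [[t1 t2] Dl D4 Z0 Z1] A0 A1 N; split=> //.
- by rewrite A0.
- by move=> i ic; lia.
- by move=> i t; rewrite A0 ?Z0.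
move=> i t; have [->|/eqP ic] := eqVneq i c.
  by rewrite ltxx; apply/eqP.
by rewrite A1 ?Z1.
Qed.

(** At row s only the visit is recorded, since the direction there is rho^2 or the end mark 7
    according to [ex]. *)
Record base_done D B : Prop := BaseDone {
  bd_dir : forall j, (j < s)%N -> D (F (o j) j) = if (j < k)%N then 3 else 2;
  bd_top : D (F (o s) s) <> 0%N;
  bd_ex : ex -> D (F (o s - 1) s.+1) <> 0%N;
  bd_zero : forall i j, T i j -> D (F i j) <> 0%N ->
    (j <= s)%N /\ i = o j \/ ex /\ j = s.+1 /\ i = o s - 1;
  bd_B : forall j, (j <= s)%N -> B j = F (o j) j }.

Lemma base_mark D B j : base_done D B -> (j <= s)%N -> D (F (o j) j) <> 0%N.
Proof.
move=> bd; rewrite leq_eqVlt => /orP[/eqP->|js]; first exact: bd_top bd.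
by rewrite (bd_dir bd js); case: ifP.
Qed.

Lemma base_zero D B i j : base_done D B -> (j <= s)%N -> T i j ->
  (D (F i j) == 0%N) = (o j < i).
Proof.
move=> bd js t; have [->|ne] := eqVneq i (o j).
  by rewrite ltxx; apply/eqP; apply: base_mark bd js.
have : o j < i by move: t; rewrite /in_tile; lia.
move=> ->; apply/eqP; case: (eqVneq (D (F i j)) 0%N) => // /eqP /(bd_zero bd t).
by case=> [[_ E]|[_ [E _]]]; [rewrite E eqxx in ne|lia].
Qed.

Lemma base_ready D B j : base_done D B -> (j < s)%N -> ready j (o j.+1) (o j) D.
Proof.
move=> bd js; have sh := good_sh good.
have t1 : T (o j) j by apply: tile_start; lia.
have t2 : T (o j) j.+1.
  have := rowend_base good js; have := rowstart_lo k js; rewrite /in_tile.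
  by case: ifP; lia.
have := rowstart_lo k js; have := bd_dir bd js; case: ifP => _ Dj oS; [right|left].
  split=> //.
  - by move=> i; lia.
  - by move=> i t; rewrite (base_zero bd) // ltnW.
  - by move=> i t; rewrite (base_zero bd) //; lia.
split=> //.
- by move=> i; lia.
- by move=> i t; rewrite (base_zero bd) // ltnW.
- by move=> i t; rewrite (base_zero bd) //; lia.
Qed.

(** The spine needs an edge of direction -1 from column o s + 1 to the border in row s. If the last
    border step is rho^2, the first insertion produces it; if it is rho, one finger step does. That
    step can only be blocked when s is the top row, and then there is no spine. *)
Lemma init_done D B j : base_done D B -> j.+1 = s ->
  let D1 := ins 2 1 3 (B j) D in
  let pD := if D1 (nb (B s) 0%N) == 0%N then finger_step nb (B j, D1) else (B j, D1) in
  exists c, [/\ pD.1 = F c j, front j (o s) c pD.2, only j D pD.2 &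
    ((s.+1 < h)%N -> c = o s + 1)].
Proof.
move=> bd js /=; have sh := good_sh good.
have jh : (j.+1 < h)%N by lia.
have js' : (j < s)%N by lia.
rewrite !(bd_B bd) ?(ltnW js') //; rewrite (tm0 TM).
have rd := base_ready bd js'; have [fr on] := ready_insert TM jh rd.
set D1 := ins 2 1 3 _ _ in fr on *; rewrite js in fr.
have t1 : T (o j) j by apply: tile_start; lia.
have /= [Eo|Eo] : o s = o j \/ o j = o s + 1.
- by have := rowstart_lo k js'; rewrite js; case: ifP; lia.
- have [/eqP D0|/eqP D0] := boolP (D1 (F (o s + 1) s) == 0%N).
    have ce : o j + 1 < e j.+1.
      rewrite js -Eo; have : o s + 1 <= e s.
        by have := rowstart_lt_rowend good sh; lia.
      rewrite le_eqVlt => /orP[/eqP E|//].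
      have [s1|s1] := ltnP s.+1 h.
        by have := rowend_spine good (leqnn s) s1; lia.
      (* Here s is the top row and has width one, so the node to the right of its start is the start
         of a row not above s, which the path already visits. *)
      have nx : (rownext a b s <= s)%N by have := rownext_lt sh; lia.
      case: (@insert_mono nb 2 1 3 (F (o j) j) D _ (base_mark bd nx)).
      by rewrite -(tm_wrap TM sh) -E -/D1.
    have lc : o s <= o j by rewrite Eo.
    have [g fr' on'] := front_step good TM jh lc fr ce.
    exists (o j + 1); rewrite /finger_step !(tm0 TM) !(tm1 TM) g; split=> //=.
      exact: only_trans on on'.
    by rewrite Eo.
  exists (o j); split=> // s1; exfalso; apply: D0; apply/eqP.
  have t2 : T (o s + 1) s by have := rowend_spine good (leqnn s) s1; rewrite /in_tile; lia.
  by case: fr => _ _ _ _; rewrite js => ->//; lia.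
have /negbTE -> : D1 (F (o s + 1) s) != 0%N.
  by case: (fr) => [[_]]; rewrite js -Eo => t3 _ _ _ ->; rewrite ?ltxx.
by exists (o j).
Qed.

(* Row j, j odd, stays exposed to the row above from the next column on. *)
Definition odd_low j : int := if (j < s)%N || (s.+1 == h)%N then o j else o s + 1.

(* The spine covers the rows s + 1, ..., t in the columns o s - 1, o s, o s + 1, and
   if [half] also the first two of these columns in row t + 1. *)
Record spine t (half : bool) D B : Prop := Spine {
  sp_top : D (F (o s + 1) t) = if half then 3 else 4;
  sp_mid : forall j, (s <= j < t)%N -> D (F (o s + 1) j) = 2%N;
  sp_left : forall j, (s < j <= t + half)%N ->
    D (F (o s - 1) j) <> 0%N /\ D (F (o s) j) <> 0%N;
  sp_row : forall i j, (s < j <= t)%N -> T i j -> o s + 1 < i -> D (F i j) = 0%N;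
  sp_above : forall i j, (t < j)%N -> T i j -> D (F i j) <> 0%N ->
    if half then j = t.+1 /\ i <= o s else ex /\ j = s.+1 /\ i = o s - 1;
  sp_low : forall j, ~~ odd j -> (j.+1 < s)%N ->
    B j = F (o j) j /\ ready j (o j.+1) (o j) D;
  sp_pair : forall j, j.+1 = s -> B j = F (o s + 1) j /\ front j (o s + 1) (o s + 1) D;
  sp_base : forall j, (j <= s)%N -> D (F (o j) j) <> 0%N;
  sp_B : forall j, (s < j < t + half)%N -> B j = F (o s + 1) j }.

(* Row b is too narrow for a finger when a = 1 and k = 0. *)
Definition stuck j l D : Prop :=
  [/\ a = 1%N, k = 0%N, j.+1 = b & [/\ l = o s + 1 /\ T l j, D (F l j) = 3%N,
    forall i, T i j -> (D (F i j) == 0%N) = (l < i)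
    & forall i, T i j.+1 -> D (F i j.+1) <> 0%N]].

(** The interface between border and fingers, reached through [spine_end], or through [ready_init]
    when row s is the top row. [ar_bar] provides the barriers at the right ends of the rows. *)
Record all_ready D B : Prop := AllReady {
  ar_bar : forall j, (j < h)%N -> D (F (o j) j) <> 0%N;
  ar_pair : forall j, ~~ odd j -> (j.+1 < h)%N -> exists l,
    [/\ B j = F l j, odd_low j.+1 <= l &
    ready j (odd_low j.+1) l D \/ stuck j l D];
  ar_last : odd h -> D (F (o s + 1) h.-2) = 3%N /\
    forall i, T i h.-1 -> (D (F i h.-1) == 0%N) = (o s < i) }.

Lemma spine_init D D2 B j : base_done D B -> j.+1 = s -> (s.+1 < h)%N ->
  front j (o s) (o s + 1) D2 -> only j D D2 ->
  spine s false D2 (update B j (F (o s + 1) j)).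
Proof.
move=> bd js s1 fr [on1 on2]; have od := good_odd good.
have [[t1 t2] Dc D4 Z0 Z1] := fr; rewrite js in t2 D4 Z1.
split.
- by rewrite D4 //; lia.
- by move=> j'; lia.
- by move=> j'; lia.
- by move=> i j'; lia.
- move=> i j' sj t; rewrite on2; [|by []|lia|lia].
  by case/(bd_zero bd t) => [[]|//]; lia.
- move=> j' ev js'; rewrite /update; have -> : (j' == j) = false by lia.
  split; first by rewrite (bd_B bd) //; lia.
  apply: ready_frame (base_ready bd _); last by lia.
  by move=> i j2 ej t; apply: on2 => //; case/orP: ej => /eqP ->; lia.
- move=> j' js'; have -> : j' = j by lia.
  rewrite /update eqxx; split=> //; apply: front_weaken fr; lia.
- move=> j' js'; have [j'j|jj'] := ltnP j' j.
    by rewrite on2; [exact: base_mark bd js'|apply: tile_start|lia|lia]; lia.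
  have [E|E] : j' = j \/ j' = s by lia.
    rewrite E; apply/eqP; rewrite Z0 ?tile_start //; last lia.
    by have := rowstartS good j; rewrite js; lia.
  by rewrite E; apply/eqP; rewrite Z1 ?tile_start //; lia.
- by move=> j'; lia.
Qed.

Lemma ready_init D D2 B j c : base_done D B -> j.+1 = s -> s.+1 = h ->
  front j (o s) c D2 -> only j D D2 -> all_ready D2 (update B j (F c j)).
Proof.
move=> bd js s1 fr [on1 on2]; have od := good_odd good.
have [[t1 t2] Dc D4 Z0 Z1] := fr; rewrite js in t2 D4 Z1.
split.
- move=> j' js'; have [j'j|jj'] := ltnP j' j.
    by rewrite on2; [apply: (base_mark bd)|apply: tile_start|lia|lia]; lia.
  have [E|E] : j' = j \/ j' = s by lia.
    rewrite E; apply/eqP; rewrite Z0 ?tile_start //; last lia.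
    by move: t1; rewrite /in_tile; lia.
  rewrite E; apply/eqP; rewrite Z1 ?tile_start //; last lia.
  by move: t2; rewrite /in_tile; lia.
- move=> j' ev jh; have [E|ne] := eqVneq j' j.
    exists c; rewrite E /update eqxx /odd_low js s1 eqxx orbT; split=> //.
      by move: t2; rewrite /in_tile; lia.
    by left; left.
  exists (o j'); rewrite /update (negbTE ne) /odd_low s1 eqxx orbT; split.
  + by apply: (bd_B bd); lia.
  + by have := rowstartS good j'; lia.
  left; apply: ready_frame (base_ready bd _); last by lia.
  by move=> i j2 ej t; apply: on2 => //; case/orP: ej => /eqP ->; lia.
- by rewrite -s1 /= od.
Qed.

Lemma tile_spine i j : (s < j < h)%N -> o s - 1 <= i <= o s -> T i j.
Proof.
move=> /andP[sj jh] oi; rewrite /in_tile jh (rowstart_hi good sj).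
by have := rowend_spine_top good sj jh; lia.
Qed.

Lemma tile_spine_right j : (s <= j)%N -> (j.+1 < h)%N -> T (o s + 1) j.
Proof.
move=> sj jh; have := rowend_spine good sj jh; rewrite /in_tile.
have : o j <= o s.
  have [->//|ne] := eqVneq j s; rewrite (rowstart_hi good); lia.
by lia.
Qed.

(** The edge -1 from (o s + 1, t) to (o s, t) is opened at (o s, t + 1). The resulting edge -rho
    back to (o s, t) is then opened at (o s - 1, t + 1), unless that point is already the end of the
    path, which happens for t = s if [ex] holds. *)
Lemma spine_half t D B : (s <= t)%N -> (t.+1 < h)%N -> spine t false D B ->
  spine t true (ins 4 3 5 (F (o s) t.+1) (ins 3 2 4 (F (o s + 1) t) D))
    (update B t (F (o s + 1) t)).
Proof.
move=> st th sp.
have tp : T (o s + 1) t by apply: tile_spine_right.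
have tz : T (o s) t.+1 by apply: tile_spine; lia.
have tl : T (o s - 1) t.+1 by apply: tile_spine; lia.
have z0 : D (F (o s) t.+1) = 0%N.
  apply/eqP; case: eqP => // /(sp_above sp (leqnn t.+1) tz) /= [_ [_ E]]; lia.
have tt : (t == t.+1) = false by lia.
have tt' : (t.+1 == t) = false by lia.
set D1 := ins 3 2 4 _ _.
have E1 : D1 = update (update D (F (o s) t.+1) 5) (F (o s + 1) t) 3.
  by rewrite /D1 insertT ?(tm2 TM) ?addrK //; exact: sp_top sp.
set D2 := ins 4 3 5 _ _.
have mono x : D x <> 0%N -> D2 x <> 0%N.
  by move=> Dx; apply: insert_mono; apply: insert_mono.
have D1z : D1 (F (o s) t.+1) = 5%N by rewrite E1 !(update_tile TM) // tt' !eqxx !andbF.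
have L0 : D2 (F (o s) t.+1) <> 0%N by apply: insert_mono; rewrite D1z.
have L1 : D2 (F (o s - 1) t.+1) <> 0%N.
  have [Dl|/eqP Dl] := eqVneq (D1 (F (o s - 1) t.+1)) 0%N; last exact: insert_mono.
  rewrite /D2 insertT ?(tm3 TM) // (update_tile TM) //.
  by case: ifP => //; rewrite (update_tile TM) // !eqxx.
have A i j : T i j -> ~ (j = t /\ i = o s + 1) -> ~ (j = t.+1 /\ i <= o s) ->
    D2 (F i j) = D (F i j).
  move=> tij n1 n2; rewrite /D2 insert_far ?(tm3 TM).
  - rewrite E1 !(update_tile TM) //; case: andP => [[/eqP ? /eqP ?]|_]; first by case: n1.
    by case: andP => [[/eqP ? /eqP ?]|_] //; case: n2; lia.
  - by move/(tm_inj TM tij tz) => [? ?]; case: n2; lia.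
  - by move/(tm_inj TM tij tl) => [? ?]; case: n2; lia.
split.
- rewrite /D2 insert_other.
  + by rewrite E1 (update_tile TM) // !eqxx.
  + by move/(tm_inj TM tp tz); lia.
  + by rewrite E1 (update_tile TM) // !eqxx.
- move=> j jt; rewrite A ?(sp_mid sp) //; try lia.
  by apply: tile_spine_right; lia.
- move=> j /andP[sj]; rewrite /= addn1 leq_eqVlt => /orP[/eqP->//|jt].
  have [] := sp_left sp (j := j); first by lia.
  by move=> /mono ? /mono ?.
- by move=> i j jt tij oi; rewrite A ?(sp_row sp jt) //; lia.
- move=> i j tj tij D2x /=; case: (boolP ((j == t.+1) && (i <= o s))) => [/andP[/eqP]//|N].
  move: D2x; rewrite A //; [|lia|by move=> [E1' E2]; rewrite E1' eqxx E2 in N].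
  by move=> /(sp_above sp tj tij) /= [_ [? ?]]; lia.
- move=> j ev js; have [Bj rj] := sp_low sp ev js; split.
    by rewrite /update; case: eqP => // ?; lia.
  by apply: ready_frame rj => i j' ej tij; rewrite A //; lia.
- move=> j js; have [Bj fj] := sp_pair sp js; split.
    by rewrite /update; case: eqP => // ?; lia.
  apply: front_frame fj _ _ _.
  + by move=> i tij; rewrite A //; lia.
  + by move=> i tij ne; rewrite A //; lia.
  + apply: mono; rewrite js; have [E|lt] : s = t \/ (s < t)%N by lia.
      by rewrite [X in F _ X]E (sp_top sp).
    by rewrite (sp_mid sp) //; lia.
- by move=> j js; apply/mono/(sp_base sp).
- move=> j jt; rewrite /update; case: eqP => [->//|ne]; apply: (sp_B sp); lia.
Qed.

(** The edge rho^2 leaving (o s + 1, t) is opened at (o s + 1, t + 1). This puts rho on the right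
    side of the spine and an edge -1 into row t + 1, from which the next row of the spine starts. *)
Lemma spine_full t D B : (s <= t)%N -> (t.+2 < h)%N -> spine t true D B ->
  spine t.+1 false (ins 2 1 3 (F (o s + 1) t) D) B.
Proof.
move=> st th sp.
have tp : T (o s + 1) t by apply: tile_spine_right; lia.
have tq : T (o s + 1) t.+1 by apply: tile_spine_right; lia.
have z0 : D (F (o s + 1) t.+1) = 0%N.
  apply/eqP; case: eqP => // /(sp_above sp (leqnn t.+1) tq) /= [_ E]; lia.
have tt : (t == t.+1) = false by lia.
have tt' : (t.+1 == t) = false by lia.
set D1 := ins 2 1 3 _ _.
have E1 : D1 = update (update D (F (o s + 1) t.+1) 4) (F (o s + 1) t) 2.
  by rewrite /D1 insertT ?(tm1 TM) //; exact: sp_top sp.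
have mono x : D x <> 0%N -> D1 x <> 0%N by exact: insert_mono.
have A i j : T i j -> ~ (j = t /\ i = o s + 1) -> ~ (j = t.+1 /\ i = o s + 1) ->
    D1 (F i j) = D (F i j).
  move=> tij n1 n2; rewrite E1 !(update_tile TM) //.
  case: andP => [[/eqP ? /eqP ?]|_]; first by case: n1.
  by case: andP => [[/eqP ? /eqP ?]|_] //; case: n2.
split.
- by rewrite E1 !(update_tile TM) // tt' !eqxx !andbF.
- move=> j /andP[sj]; rewrite ltnS leq_eqVlt => /orP[/eqP->|jt].
    by rewrite E1 (update_tile TM) // !eqxx.
  rewrite A ?(sp_mid sp) //; try lia.
  by apply: tile_spine_right; lia.
- move=> j jt; have [] := sp_left sp (j := j); first by rewrite /= in jt *; lia.
  by move=> /mono ? /mono ?.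
- move=> i j /andP[sj]; rewrite leq_eqVlt => /orP[/eqP->|jt] tij oi.
    rewrite A; [|by []|lia|lia].
    by apply/eqP; case: eqP => // /(sp_above sp (leqnn t.+1) tij) /= [_ E]; lia.
  by rewrite A ?(sp_row sp) //; lia.
- move=> i j tj tij; rewrite A; [|by []|lia|lia].
  by move=> /(sp_above sp (ltnW tj) tij) /= [? _]; lia.
- move=> j ev js; have [Bj rj] := sp_low sp ev js; split=> //.
  by apply: ready_frame rj => i j' ej tij; rewrite A //; lia.
- move=> j js; have [Bj fj] := sp_pair sp js; split=> //.
  apply: front_frame fj _ _ _.
  + by move=> i tij; rewrite A //; lia.
  + by move=> i tij ne; rewrite A //; lia.
  + apply: mono; rewrite js; have [E|lt] : s = t \/ (s < t)%N by lia.
      by rewrite [X in F _ X]E (sp_top sp).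
    by rewrite (sp_mid sp) //; lia.
- by move=> j js; apply/mono/(sp_base sp).
- by move=> j jt; apply: (sp_B sp); rewrite /= in jt *; lia.
Qed.

(** The top row gets only two columns, because it need not have a third. The edge rho^2 that remains
    below it starts the finger of the top pair if a + b is even, unless the pair is [stuck], and is
    kept for the unpaired top row if a + b is odd. *)
Lemma spine_end t D B : (s <= t)%N -> t.+2 = h -> spine t true D B -> all_ready D B.
Proof.
move=> st th sp; have od := good_odd good.
have bar j : (j < h)%N -> D (F (o j) j) <> 0%N.
  move=> jh; have [js|sj] := leqP j s; first exact: sp_base sp _ js.
  rewrite (rowstart_hi good sj); have [] // := sp_left sp (j := j).
  by rewrite /=; lia.
have row i j : (s < j <= t)%N -> T i j -> (D (F i j) == 0%N) = (o s + 1 < i).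
  move=> sjt tij; have [oi|io] := ltP (o s + 1) i.
    by apply/eqP; apply: (sp_row sp sjt).
  apply/eqP; have [L1 L2] := sp_left sp (j := j) ltac:(rewrite /=; lia).
  have [] : i = o s - 1 \/ i = o s \/ i = o s + 1.
    by move: tij; rewrite /in_tile (rowstart_hi good (j := j)); lia.
  - by move=> ->.
  case=> ->// ; have [E|lt] : j = t \/ (s <= j < t)%N by lia.
    by rewrite E (sp_top sp).
  by rewrite (sp_mid sp).
have row1 i : T i t.+1 -> (D (F i t.+1) == 0%N) = (o s < i).
  move=> tij; have [oi|io] := ltP (o s) i.
    by case: eqP => // /(sp_above sp (leqnn _) tij) /= [_]; lia.
  apply/eqP; have [L1 L2] := sp_left sp (j := t.+1) ltac:(rewrite /=; lia).
  have [] : i = o s - 1 \/ i = o s.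
    by move: tij; rewrite /in_tile (rowstart_hi good (j := t.+1)); lia.
  - by move=> ->.
  by move=> ->.
have s1h : (s.+1 == h) = false by lia.
split=> //.
- move=> j ev jh; have [js|[js|sj]] : (j.+1 < s)%N \/ j.+1 = s \/ (s < j)%N by lia.
  + have [Bj rj] := sp_low sp ev js; exists (o j); rewrite /odd_low js /=; split=> //.
      by have := rowstartS good j; lia.
    by left.
  + have [Bj rj] := sp_pair sp js; exists (o s + 1); rewrite /odd_low js ltnn s1h /=; split=> //.
    by left; left.
  exists (o s + 1); have -> : odd_low j.+1 = o s + 1.
    by rewrite /odd_low s1h orbF; case: ifP => //; lia.
  split=> //; first by apply: (sp_B sp); rewrite /=; lia.
  have [jt|jt] : (j < t)%N \/ j = t by lia.
    left; left; split.
    * by split; apply: tile_spine_right; lia.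
    * by rewrite (sp_mid sp) //; lia.
    * by move=> i; lia.
    * by move=> i tij; rewrite row //; lia.
    * by move=> i tij; rewrite row //; lia.
  rewrite {}jt in sj jh *; have [ce|[a1 [k0 tb]]] := rowend_spine_pair good sj jh.
    left; right; split.
    * split; first by apply: tile_spine_right; lia.
      by rewrite /in_tile jh (rowstart_hi good); lia.
    * exact: sp_top sp.
    * by move=> i; lia.
    * by move=> i tij; rewrite row //; lia.
    * by move=> i tij; rewrite row1 //; lia.
  right; split=> //; split=> //.
  * by split=> //; apply: tile_spine_right; lia.
  * exact: sp_top sp.
  * by move=> i tij; rewrite row //; lia.
  move=> i tij; apply/eqP; rewrite row1 //.
  have [_ et] := rowend_drop s k jh tb.
  by move: tij; rewrite /in_tile (rowstart_s good) et; lia.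
- move=> oh; have -> : h.-2 = t by lia.
  have -> : h.-1 = t.+1 by lia.
  by split; [exact: sp_top sp|exact: row1].
Qed.

End Growth2.

(** * Fingers and the final passes *)

Section Growth3.

Variables (a b s k : nat) (ex : bool).
Hypothesis good : good_params a b s k ex.
Variables (nb : nat -> nat -> nat) (F : int -> nat -> nat).
Hypothesis TM : tile_map a b s k nb F.

Local Notation h := (a + b)%N.
Local Notation o := (rowstart s k).
Local Notation e := (rowend a b s k).
Local Notation T := (in_tile a b s k).
Local Notation ins := (insert nb).
Local Notation front := (front a b s k F).
Local Notation only := (only a b s k F).
Local Notation ready := (ready a b s k F).
Local Notation stuck := (stuck a b s k F).
Local Notation odd_low := (odd_low a b s k).
Implicit Types (D B : nat -> nat) (i c low l : int) (j t : nat).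

Lemma finger_mono m p D x : D x <> 0%N ->
  (iter m (finger_step nb) (p, D)).2 x <> 0%N.
Proof.
move=> Dx; elim: m => //= m; case: (iter _ _ _) => q D' /= IH.
by case: ifP => // _; do 2!apply: insert_mono.
Qed.

Record growing J D B : Prop := Growing {
  gr_bar : forall j, (j < h)%N -> D (F (o j) j) <> 0%N;
  gr_done : forall j, ~~ odd j -> (j.+1 < h)%N -> (j < J)%N ->
    front j (odd_low j.+1) (e j.+1 - 1) D \/ exists l, stuck j l D;
  gr_pair : forall j, ~~ odd j -> (j.+1 < h)%N -> (J <= j)%N -> exists l,
    [/\ B j = F l j, odd_low j.+1 <= l & ready j (odd_low j.+1) l D \/ stuck j l D];
  gr_last : odd h -> D (F (o s + 1) h.-2) = 3%N /\
    forall i, T i h.-1 -> (D (F i h.-1) == 0%N) = (o s < i) }.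

Lemma growing0 D B : all_ready a b s k F D B -> growing 0 D B.
Proof. by case=> H1 H2 H3; split=> // j ev jh _; apply: H2. Qed.

Lemma front_only j j' low c D D' : ~~ odd j -> ~~ odd j' -> j != j' ->
  only j D D' -> front j' low c D -> front j' low c D'.
Proof.
move=> ev ev' ne [_ on] [[t1 t2] Dl D4 Z0 Z1].
have A i : T i j' -> D' (F i j') = D (F i j') by move=> t; apply: on => //; lia.
have A' i : T i j'.+1 -> D' (F i j'.+1) = D (F i j'.+1) by move=> t; apply: on => //; lia.
split=> //; first by rewrite A.
- by move=> i li t; rewrite A' ?D4.
- by move=> i t; rewrite A ?Z0.
- by move=> i t; rewrite A' ?Z1.
Qed.

Lemma ready_only j j' low l D D' : ~~ odd j -> ~~ odd j' -> j != j' ->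
  only j D D' -> ready j' low l D -> ready j' low l D'.
Proof.
move=> ev ev' ne [_ on]; apply: ready_frame => i j2 ej t.
by apply: on => //; case/orP: ej => /eqP ->; lia.
Qed.

Lemma stuck_only j j' l D D' : ~~ odd j -> ~~ odd j' -> j != j' ->
  only j D D' -> stuck j' l D -> stuck j' l D'.
Proof.
move=> ev ev' ne [_ on] [H1 H2 H3 [[H4 tl] H5 H6 H7]].
have A i : T i j' -> D' (F i j') = D (F i j') by move=> t; apply: on => //; lia.
have A' i : T i j'.+1 -> D' (F i j'.+1) = D (F i j'.+1) by move=> t; apply: on => //; lia.
split=> //; split=> //; first by rewrite A.
- by move=> i t; rewrite A ?H6.
- by move=> i t; rewrite A' //; exact: H7.
Qed.

(** By [tm_wrap] the point past the end of row J + 1 is the start of another row, hence visited, and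
    bounds the finger. In a stuck pair the same point is the apex of the only edge to be opened, so
    that nothing happens. *)
Lemma growing_step J D B : ~~ odd J -> (J.+1 < h)%N -> growing J D B ->
  growing J.+2 (iter h (finger_step nb) (B J, ins 2 1 3 (B J) D)).2 B.
Proof.
move=> ev Jh gr; have [l [BJ ll [rd|st]]] := gr_pair gr ev Jh (leqnn J).
  have bar : D (F (e J.+1) J.+1) <> 0%N.
    by rewrite (tm_wrap TM Jh); apply: (gr_bar gr); exact: rownext_lt.
  have [D' [E fr on]] := ready_grow good TM Jh ll rd bar; rewrite BJ E /=.
  have mono x : D x <> 0%N -> D' x <> 0%N.
    move=> Dx; have -> : D' = (iter h (finger_step nb) (F l J, ins 2 1 3 (F l J) D)).2 by rewrite E.
    by apply/finger_mono/insert_mono.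
  split.
  - by move=> j jh; apply/mono/(gr_bar gr).
  - move=> j evj jh jJ; have [->|ne] := eqVneq j J; first by left.
    have {}ne : J != j by rewrite eq_sym.
    have [fr'|[l' st]] := gr_done gr evj jh ltac:(lia); [left|right; exists l'].
      exact: front_only on fr'.
    exact: stuck_only on st.
  - move=> j evj jh Jj; have ne : J != j by lia.
    have [l' [Bj ll' rs]] := gr_pair gr evj jh ltac:(lia).
    exists l'; split=> //; case: rs => [rd'|st]; [left|right].
      exact: ready_only on rd'.
    exact: stuck_only on st.
  - move=> oh; have [L1 L2] := gr_last gr oh; case: on => on1 on2.
    have sh := good_sh good; have od := good_odd good.
    have tl : T (o s + 1) h.-2 by apply: (tile_spine_right good); lia.
    split.
      by rewrite on1 ?L1 // => i t /(tm_inj TM tl t)[_]; lia.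
    by move=> i t; rewrite on2 ?L2 //; lia.
have [a1 k0 Jb [[El _] Dl Z0 Z1]] := st.
have Es : l = e J.+1.
  by have [_ ->] := rowend_drop s k Jh Jb; rewrite El (rowstart_s good); lia.
have -> : ins 2 1 3 (B J) D = D.
  rewrite BJ insertF //; right; rewrite (tm1 TM) Es (tm_wrap TM Jh).
  by apply: (gr_bar gr); exact: rownext_lt.
have -> : iter h (finger_step nb) (B J, D) = (B J, D).
  by elim: (h) => //= m ->; rewrite /finger_step BJ Dl.
case: gr => H1 H2 H3 H4; split=> //=.
  move=> j evj jh jJ; have [->|ne] := eqVneq j J; first by right; exists l.
  by apply: H2 => //; lia.
by move=> j evj jh jJ; apply: H3 => //; lia.
Qed.

Variable n : nat.
Hypothesis F_lt : forall i j, (F i j < n)%N.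
Hypothesis nb_inj : forall d x y, (d < 3)%N -> (x < n)%N -> (y < n)%N ->
  nb x d = nb y d -> x = y.

(** In this order an edge -1 opened by the first pass leaves an edge rho^2 at its source for the
    second one, as [final_corner] requires, and edges rho are left alone until the last pass. *)
Definition final_passes D := pass nb 1 0 2 n (pass nb 2 1 3 n (pass nb 3 2 4 n D)).

Lemma final_mono D x : D x <> 0%N -> final_passes D x <> 0%N.
Proof. by move=> Dx; do 3!apply: pass_mono. Qed.

Lemma final32 D i j : D (F (i + 1) j) = 4%N -> final_passes D (F i j.+1) <> 0%N.
Proof.
move=> Dx; do 2!apply: pass_mono.
have [H _] := pass_apex 4 (fun x y => @nb_inj 2 x y isT) (F_lt (i + 1) j) Dx.
by move: H; rewrite (tm2 TM) addrK.
Qed.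

Lemma final21 D i j : D (F i j) = 3%N -> final_passes D (F i j.+1) <> 0%N.
Proof.
move=> Dx; apply: pass_mono; set D1 := pass nb 3 2 4 n D.
have D1x : D1 (F i j) = 3%N by rewrite /D1 pass_keep Dx.
have [H _] := pass_apex 3 (fun x y => @nb_inj 1 x y isT) (F_lt i j) D1x.
by move: H; rewrite (tm1 TM).
Qed.

Lemma final10 D i j : D (F i j) = 2%N -> final_passes D (F (i + 1) j) <> 0%N.
Proof.
move=> Dx; rewrite /final_passes; set D1 := pass nb 2 1 3 n _.
have D1x : D1 (F i j) = 2%N by rewrite /D1 !pass_keep ?Dx.
have [H _] := pass_apex 2 (fun x y => @nb_inj 0 x y isT) (F_lt i j) D1x.
by move: H; rewrite (tm0 TM).
Qed.

(** The first pass inserts (i - 1, j + 1) and leaves an edge rho^2 at (i, j), whose apex is (i, j +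
    1). This serves the last column of row j, where no edge -1 starts further to the right. *)
Lemma final_corner D i j : D (F i j) = 4%N -> D (F (i - 1) j.+1) = 0%N ->
  final_passes D (F i j.+1) <> 0%N.
Proof.
move=> Dx Dz; apply: pass_mono; set D1 := pass nb 3 2 4 n D.
have [_ H] := pass_apex 4 (fun x y => @nb_inj 2 x y isT) (F_lt i j) Dx.
have D1x : D1 (F i j) = 3%N by rewrite /D1 H // (tm2 TM).
have [H' _] := pass_apex 3 (fun x y => @nb_inj 1 x y isT) (F_lt i j) D1x.
by move: H'; rewrite (tm1 TM).
Qed.

(** Odd rows are already full. A free node of an even row is usually the apex of an edge -1 in the
    row below. Above the last column of that row it is reached from a corner, from the tip of the
    finger in its own row, or, in an unpaired top row, possibly from the edge rho^2 left by the
    spine. *)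
Lemma final_all D B i j : growing h D B -> T i j -> final_passes D (F i j) <> 0%N.
Proof.
move=> gr t; have sh := good_sh good; have od := good_odd good.
have [/eqP D0|/eqP] := boolP (D (F i j) == 0%N); last exact: final_mono.
have /eqP Z := D0.
have jh : (j < h)%N by case/andP: t.
have ie : i < e j by move: t; rewrite /in_tile; lia.
have io : o j < i.
  have : o j <= i by move: t; rewrite /in_tile; lia.
  by rewrite le_eqVlt => /orP[/eqP E|//]; case: (gr_bar gr jh); rewrite E.
have ev : ~~ odd j.
  apply/negP => oj; case: j => // j in t D0 Z jh ie io oj *.
  have [[_ _ _ _ Z1]|[l [_ _ _ [_ _ _ Z1]]]] := gr_done gr oj jh ltac:(lia).
    by rewrite Z1 // in Z; lia.
  by case: (Z1 i t).
have adj D1 low : front j low (e j.+1 - 1) D1 -> D1 = D -> i = e j.+1 ->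
    final_passes D (F i j) <> 0%N.
  by move=> [_ Dc _ _ _] E ->; rewrite -[e j.+1](subrK 1); apply: final10; rewrite -E.
(* For b = 1 row 0 is itself the long row b - 1, to which [rowendS] does not apply. *)
have e0 : b = 1%N -> (0 < a)%N -> e 0%N = 2.
  move=> b1 a0; have ab := good_ab good; have kb := good_kb good.
  have sb := good_sb good; have -> : a = 1%N by lia.
  have -> : k = 0%N by lia.
  have -> : s = 1%N by have := odd_gt0 od; lia.
  by rewrite b1.
have [j0|j0] := posnP j.
  rewrite {}j0 in t D0 Z jh ie io ev adj *.
  have h1 : (1 < h)%N by have := odd_gt0 od; lia.
  have [fr|[l [a1 k0 b1 [[El _] _ Z0 _]]]] := gr_done gr ev h1 ltac:(lia).
    apply: (adj D _ fr) => //; case: (fr) => _ _ _ Z0 _; rewrite Z0 // in Z.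
    have [b1|nb1] := eqVneq 1%N b; last by have := rowendS good h1 nb1; lia.
    have [a0 E1] := rowend_drop s k h1 b1.
    have := e0 (esym b1) a0; have := good_ab good; lia.
  rewrite Z0 // in Z; have := e0 (esym b1) ltac:(lia).
  by have := rowstart_s good; lia.
case: j j0 => // m _ in t D0 Z jh ie io ev adj *.
case: m => // m in t D0 Z jh ie io ev adj *.
have evm : ~~ odd m by lia.
have fr2 : front m (odd_low m.+1) (e m.+1 - 1) D.
  have [//|[l [a1 k0 b1 _]]] := gr_done gr evm ltac:(lia) ltac:(lia).
  by exfalso; lia.
have [t3 Dm D4 Zm Zm1] := fr2.
have em : e m.+2 <= e m.+1 by apply: (rowend_le good).
(* Unvisited nodes of row m.+2 lie above the exposed part of row m.+1. *)
have low i' : T i' m.+2 -> D (F i' m.+2) = 0%N -> odd_low m.+1 <= i'.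
  move=> ti' /eqP D0'; have oi' : o m.+2 < i'.
    have : o m.+2 <= i' by move: ti'; rewrite /in_tile; lia.
    rewrite le_eqVlt => /orP[/eqP E|//].
    by case: (gr_bar gr jh); rewrite E; apply/eqP.
  rewrite /odd_low; case: ifP => [_|ms].
    by have := rowstartS good m.+1; lia.
  have sm : (s < m.+2)%N by lia.
  have := rowstart_hi good sm => om.
  have [hm|hm] := ltnP m.+3 h; last first.
    have oh : odd h by have -> : h = m.+3 by lia.
    have := (gr_last gr oh).2 i'; have -> : h.-1 = m.+2 by lia.
    by move=> /(_ ti'); rewrite D0'; lia.
  have [[_ _ _ Z0 _]|[l [_ _ _ [[El _] _ Z0 _]]]] := gr_done gr ev hm ltac:(lia).
    rewrite Z0 // in D0'; have := rowend_spine_pair good sm hm.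
    case=> [?|[a1 [k0 mb]]]; first by lia.
    by have [_ E] := rowend_drop s k hm mb; have := rowstart_s good; lia.
  by rewrite Z0 // in D0'; lia.
have lowi := low i t D0.
have [ie1|ie1] := ltP (i + 1) (e m.+1).
  apply: final32; apply: D4; first by lia.
  rewrite /in_tile; have := rowstartS good m.+1; move: t; rewrite /in_tile; lia.
(* From here on the node lies above the last column of row m + 1, so an edge -1 with this apex would
   start outside that row. *)
have iX : i = e m.+1 - 1 by lia.
have corner : D (F (i - 1) m.+2) = 0%N -> T (i - 1) m.+2 -> final_passes D (F i m.+2) <> 0%N.
  move=> D1 ti; have lowi1 := low _ ti D1; apply: final_corner => //.
  apply: D4; first by lia.
  rewrite /in_tile; have := rowstartS good m.+1; move: t; rewrite /in_tile; lia.
have tpred : o m.+2 <= i - 1 -> T (i - 1) m.+2 by move: t; rewrite /in_tile; lia.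
(* First the case in which m + 2 is the unpaired top row. *)
have [hm|hm] := ltnP m.+3 h; last first.
  have oh : odd h by have -> : h = m.+3 by lia.
  have [L1 L2] := gr_last gr oh.
  have hm1 : h.-1 = m.+2 by lia.
  have hm2 : h.-2 = m.+1 by lia.
  rewrite hm2 in L1; rewrite hm1 in L2.
  have oi : o s < i by move: Z; rewrite L2.
  have [oi1|oi1] := ltP (o s) (i - 1).
    have ti : T (i - 1) m.+2 by apply: tpred; have := rowstart_ge good m.+2; have := rowstart_hi good (j := m.+2); lia.
    by apply: corner => //; apply/eqP; rewrite L2.
  have -> : i = o s + 1 by lia.
  exact: final21.
have [fr|[l [a1 k0 mb [[El tl] _ Z0 _]]]] := gr_done gr ev hm ltac:(lia); last first.
  rewrite Z0 // in Z.
  have eb : e m.+2 = b%:Z.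
    have sm : (s < b)%N by have := good_sb_lt good; lia.
    rewrite /rowend; have -> : (m.+2 < b)%N by lia.
    have -> : (m.+2 + a)%N = b by lia.
    by rewrite (rowstart_hi good sm) (rowstart_s good) k0 a1; lia.
  (* Here b = m + 3 is odd with m even, and b = 3 is excluded. Thus b >= 5, which makes the left
     neighbour of the node free as well, as the corner argument demands. *)
  have := good_exc good; rewrite a1 k0 => b3.
  have li : l < i - 1 by have := rowstart_s good; lia.
  have ti : T (i - 1) m.+2 by apply: tpred; move: tl; rewrite /in_tile; lia.
  by apply: corner => //; apply/eqP; rewrite Z0.
have [[tc1 _] _ _ Z0 _] := fr; rewrite Z0 // in Z.
have [mb|mb] := eqVneq m.+3 b; last first.
  by apply: (adj D _ fr) => //; have := rowendS good hm mb; lia.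
have [Ei|ne] := eqVneq i (e m.+3); first exact: (adj D _ fr).
have ti : T (i - 1) m.+2 by apply: tpred; move: tc1; rewrite /in_tile; lia.
by apply: corner => //; apply/eqP; rewrite Z0 //; lia.
Qed.

End Growth3.

(** * Laying the shortest path *)

Section Growth4.

Variables (a b s k : nat) (ex : bool).
Hypothesis good : good_params a b s k ex.
Variables (nb : nat -> nat -> nat) (F : int -> nat -> nat).
Hypothesis TM : tile_map a b s k nb F.

Local Notation h := (a + b)%N.
Local Notation o := (rowstart s k).
Local Notation T := (in_tile a b s k).
Implicit Types (D B : nat -> nat) (i : int) (j t v L : nat).

Record base_part t D B v L : Prop := BasePart {
  bp_dir : forall j, (j < t)%N -> D (F (o j) j) = if (j < k)%N then 3 else 2;
  bp_end : D (F (o t) t) = 7%N;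
  bp_zero : forall i j, T i j -> D (F i j) <> 0%N -> (j <= t)%N /\ i = o j;
  bp_v : v = F (o t) t;
  bp_B : forall j, (j <= t)%N -> B j = F (o j) j;
  bp_L : L = t }.

Lemma base_start B : B 0%N = F 0 0 ->
  base_part 0 (update (fun=> 0%N) (F 0 0) 7) B (F 0 0) 0.
Proof.
move=> B0; have o0 : o 0 = 0 := rowstart0 s k.
split=> //; rewrite ?o0 //.
- by rewrite /update eqxx.
- move=> i j t; rewrite /update; case: eqP => // E _.
  have t0 : T 0 0 by rewrite -{1}o0; apply: (tile_start good); case: good; lia.
  by have [-> ->] := tm_inj TM t t0 E.
- by move=> j; rewrite leqn0 => /eqP ->; rewrite o0.
Qed.

Lemma base_next t D B v L (d := if (t < k)%N then 2 else 1%N) : (t < s)%N ->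
  base_part t D B v L -> D (nb v d) = 0%N /\
  base_part t.+1 (update (update D v d.+1) (nb v d) 7) (update B t.+1 (nb v d)) (nb v d) L.+1.
Proof.
move=> ts bp; have sh := good_sh good.
have zE : nb v d = F (o t.+1) t.+1.
  rewrite (bp_v bp) (rowstart_lo k ts) /d; case: ifP => _; first by rewrite (tm2 TM).
  by rewrite (tm1 TM).
have t1 : T (o t) t by apply: (tile_start good); lia.
have t2 : T (o t.+1) t.+1 by apply: (tile_start good); lia.
have z0 : D (nb v d) = 0%N.
  by rewrite zE; apply/eqP; case: eqP => // /(bp_zero bp t2) []; lia.
split=> //; rewrite zE (bp_v bp).
have tt : (t == t.+1) = false by lia.
split=> //.
- move=> j; rewrite ltnS leq_eqVlt => /orP[/eqP->|jt].
    by rewrite !(update_tile TM) // tt andbF !eqxx /d; case: ifP.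
  have t3 : T (o j) j by apply: (tile_start good); lia.
  have -> : update (update D (F (o t) t) d.+1) (F (o t.+1) t.+1) 7 (F (o j) j) = D (F (o j) j).
    rewrite !(update_tile TM) //; have [-> ->] : (j == t) = false /\ (j == t.+1) = false by lia.
    by rewrite !andbF.
  exact: bp_dir bp _ jt.
- by rewrite /update eqxx.
- move=> i j t3; rewrite !(update_tile TM) //.
  case: andP => [[/eqP -> /eqP ->] //|_]; case: andP => [[/eqP -> /eqP ->] //|_].
  by move/(bp_zero bp t3) => [? ->]; split=> //; lia.
- move=> j jt; rewrite /update; case: eqP => [-> //|ne]; apply: (bp_B bp); lia.
- by rewrite (bp_L bp).
Qed.

Lemma base_end D B v L : ~~ ex -> base_part s D B v L -> base_done a b s k ex F D B.
Proof.
move=> nex [H1 H2 H3 H4 H5 H6]; split=> //.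
- by rewrite H2.
- by move=> e; rewrite e in nex.
- by move=> i j t /(H3 _ _ t) [? ?]; left.
Qed.

Lemma base_extra D B v L : ex -> base_part s D B v L -> D (nb v 2%N) = 0%N /\
  base_done a b s k ex F (update (update D v 3) (nb v 2%N) 7) B /\ nb v 2%N = F (o s - 1) s.+1.
Proof.
move=> hex bp; have sh := good_ex good hex.
have zE : nb v 2%N = F (o s.+1) s.+1.
  by rewrite (bp_v bp) (rowstart_hi good (ltnSn s)) (tm2 TM).
have t1 : T (o s) s by apply: (tile_start good); lia.
have t2 : T (o s.+1) s.+1 by apply: (tile_start good); lia.
have z0 : D (nb v 2%N) = 0%N.
  by rewrite zE; apply/eqP; case: eqP => // /(bp_zero bp t2) []; lia.
split=> //; split; last by rewrite zE (rowstart_hi good (ltnSn s)).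
rewrite zE (bp_v bp); have tt : (s == s.+1) = false by lia.
split=> //.
- move=> j js; have t3 : T (o j) j by apply: (tile_start good); lia.
  rewrite !(update_tile TM) //; have [-> ->] : (j == s) = false /\ (j == s.+1) = false by lia.
  rewrite !andbF; exact: bp_dir bp _ js.
- by rewrite !(update_tile TM) // tt andbF !eqxx.
- by rewrite -(rowstart_hi good (ltnSn s)) /update eqxx.
- move=> i j t3; rewrite !(update_tile TM) //.
  case: andP => [[/eqP -> /eqP ->] _|_].
    by right; split=> //; split=> //; rewrite (rowstart_hi good (ltnSn s)).
  case: andP => [[/eqP -> /eqP ->] _|_]; first by left.
  by move/(bp_zero bp t3) => ?; left.
- exact: bp_B bp.
Qed.

End Growth4.

(** * The hexagonal norm *)

(** The distance from 0 in the infinite triangular lattice: the elements of norm one are the six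
    units. *)
Definition hexnorm (z : EJint) : nat :=
  maxn (maxn `|EJre z| `|EJrho z|) `|EJre z + EJrho z|.

Lemma EJInt_add x y x' y' : EJInt x y + EJInt x' y' = EJInt (x + x') (y + y').
Proof. by []. Qed.

Lemma EJInt_sub x y x' y' : EJInt x y - EJInt x' y' = EJInt (x - x') (y - y').
Proof. by []. Qed.

Lemma rho_mul x y : rho * EJInt x y = EJInt (- y) (x + y).
Proof.
rewrite -[LHS]/(EJInt (0 * x - 1 * y) (0 * y + 1 * x + 1 * y)).
by congr EJInt; ring.
Qed.

Lemma rho3 : rho ^+ 3 = -1. Proof. by []. Qed.
Lemma rho6 : rho ^+ 6 = 1. Proof. by []. Qed.

Lemma rho_mod m : rho ^+ (m %% 6) = rho ^+ m.
Proof. by rewrite [in RHS](divn_eq m 6) exprD mulnC exprM rho6 expr1n mul1r. Qed.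

Lemma rho_tri m : rho ^+ m + rho ^+ m.+2 = rho ^+ m.+1.
Proof.
have E : 1 + rho * rho = rho by [].
by rewrite !exprSr -mulrA -{1}[rho ^+ m]mulr1 -mulrDr E.
Qed.

Lemma hexnorm_add (z w : EJint) :
  (hexnorm (z + w)%R <= hexnorm z + hexnorm w)%N.
Proof.
have tri (x y : int) : (absz (x + y)%R <= `|x| + `|y|)%N by lia.
case: z w => x y [x' y']; rewrite EJInt_add /hexnorm /= addrACA.
by rewrite !geq_max -!andbA; apply/and3P; split; apply: leq_trans (tri _ _) _;
  apply: leq_add; rewrite !leq_max leqnn ?orbT.
Qed.

Lemma hexnorm_rho z : hexnorm (rho * z) = hexnorm z.
Proof. by case: z => x y; rewrite rho_mul /hexnorm /=; lia. Qed.

Lemma hexnorm_rhoX m z : hexnorm (rho ^+ m * z) = hexnorm z.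
Proof. by elim: m => [|m IH]; rewrite ?mul1r // exprS -mulrA hexnorm_rho. Qed.

(** Since -x + y rho = x rho^2 + (y - x) rho, the condition 0 < x <= y describes the cone between
    rho and rho^2 with one boundary ray removed. The six rotations of this cone cover all nonzero
    elements. *)
Lemma hex_sector z : z <> 0 -> exists r (x y : nat),
  [/\ (r < 6)%N, (0 < x <= y)%N, y = hexnorm z & z = rho ^+ r * EJInt (- x%:Z) y].
Proof.
case: z => i j nz.
have E1 x y : rho ^+ 1 * EJInt x y = EJInt (- y) (x + y) by rewrite expr1 rho_mul.
have E2 x y : rho ^+ 2 * EJInt x y = EJInt (- (x + y)) x.
  by rewrite exprS -mulrA E1 rho_mul; congr EJInt; ring.
have E3 x y : rho ^+ 3 * EJInt x y = EJInt (- x) (- y).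
  by rewrite exprS -mulrA E2 rho_mul; congr EJInt; ring.
have E4 x y : rho ^+ 4 * EJInt x y = EJInt y (- (x + y)).
  by rewrite exprS -mulrA E3 rho_mul; congr EJInt; ring.
have E5 x y : rho ^+ 5 * EJInt x y = EJInt (x + y) (- x).
  by rewrite exprS -mulrA E4 rho_mul; congr EJInt; ring.
have nz' : (i != 0) || (j != 0).
  by apply/negPn; rewrite negb_or !negbK; apply/negP => /andP[/eqP i0 /eqP j0]; apply: nz; rewrite i0 j0.
rewrite /hexnorm /=.
have [c|[c|[c|[c|[c|c]]]]] : (i < 0) && (0 <= i + j) \/ (i + j < 0) && (0 <= j) \/
   (j < 0) && (i <= 0) \/ (0 < i) && (i + j <= 0) \/ (0 < i + j) && (j <= 0) \/
   (0 < j) && (0 <= i) by lia.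
- exists 0%N, `|i|%N, `|j|%N; split=> //; [lia|lia|rewrite mul1r; congr EJInt; lia].
- exists 1%N, (absz (i + j)%R), `|i|%N; split=> //; [lia|lia|rewrite E1; congr EJInt; lia].
- exists 2%N, `|j|%N, (absz (i + j)%R); split=> //; [lia|lia|rewrite E2; congr EJInt; lia].
- exists 3%N, `|i|%N, `|j|%N; split=> //; [lia|lia|rewrite E3; congr EJInt; lia].
- exists 4%N, (absz (i + j)%R), `|i|%N; split=> //; [lia|lia|rewrite E4; congr EJInt; lia].
- exists 5%N, `|j|%N, (absz (i + j)%R); split=> //; [lia|lia|rewrite E5; congr EJInt; lia].
Qed.

(** * Reduction modulo alpha and distances *)

Section Alpha.

Variables a b : nat.
Hypothesis b0 : (0 < b)%N.
Hypothesis ab : (a <= b)%N.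
Local Notation alpha := (EJalpha a b).
Local Notation cls := (EJclass alpha).

Lemma rho_alpha : rho * alpha = EJInt (- b%:Z) (a + b)%:Z.
Proof. by rewrite EJalphaE rho_mul. Qed.

Lemma EJclass_mulalpha z q : cls (z - q * alpha) = cls z.
Proof. by apply/EJclass_eq; exists (- q); rewrite mulNr addrAC subrr add0r. Qed.

Lemma EJclass0 : cls 0 = 0.
Proof. by have := EJclassB alpha 0 0; rewrite !subrr. Qed.

(* The multiple rho^(r+1) alpha lies in the same sector as z; subtracting it
   lowers the norm once the norm has reached b. *)
Lemma hex_reduce z : cls z <> 0 -> exists r (x y : nat),
  [/\ (r < 6)%N, (0 < x <= y)%N, (y <= hexnorm z)%N,
      (y < b)%N \/ a = b /\ y = b & cls z = cls (rho ^+ r * EJInt (- x%:Z) y)].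
Proof.
have [m] := ubnP (hexnorm z); elim: m z => // m IH z zm nz.
have z0 : z <> 0 by move=> E; apply: nz; rewrite E EJclass0.
have [r [x [y [r6 xy Ey Ez]]]] := hex_sector z0.
have [c|c] : ((y < b)%N \/ a = b /\ y = b) \/ (b <= y)%N && ((a < b)%N || (b < y)%N) by lia.
  by exists r, x, y; split=> //; [rewrite Ey|rewrite -Ez].
pose z' := z - rho ^+ r * rho * alpha.
have Ez' : z' = rho ^+ r * EJInt (b%:Z - x%:Z) (y%:Z - (a + b)%:Z).
  rewrite /z' {1}Ez -mulrA rho_alpha -mulrBr EJInt_sub; congr (_ * EJInt _ _); lia.
have lt : (hexnorm z' < hexnorm z)%N.
  by rewrite Ez' hexnorm_rhoX -Ey /hexnorm /=; lia.
have Ec : cls z' = cls z by exact: EJclass_mulalpha.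
have [||r' [x' [y' [H1 H2 H3 H4 H5]]]] := IH z'; [lia|by rewrite Ec|].
by exists r', x', y'; split=> //; [lia|rewrite -Ec].
Qed.

(** An odd norm y becomes s. An even one is split into s = y - 1 and a last step rho^2, which is
    available because x > 0. Two reduced representatives violate the conditions on the parameters
    and are replaced. *)
Lemma hex_params z : cls z <> 0 -> exists r s k (ex : bool),
  [/\ (r < 6)%N, good_params a b s k ex, (s + ex <= hexnorm z)%N &
    cls z = cls (rho ^+ r * (if ex then EJInt (rowstart s k s - 1) s.+1
                             else EJInt (rowstart s k s) s))].
Proof.
move=> nz; have [r [x [y [r6 xy yn yb ->]]]] := hex_reduce nz.
have rs s k : (k <= s)%N -> rowstart s k s = - k%:Z by rewrite /rowstart leqnn; lia.
have [oy|ey] := boolP (odd y).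
  have [xb|xb] := ltnP x b.
    exists r, y, x, false; split=> //; [|lia|by rewrite rs //; lia].
    by split=> //; lia.
  (* Here k = b would be too large; but -b + b rho = rho (b rho), so one more rotation gives k =
     0. *)
  have [Ex [Ey Ea]] : x = b /\ y = b /\ a = b by lia.
  exists ((r + 1) %% 6)%N, y, 0%N, false; split.
  - by rewrite ltn_mod.
  - by split=> //; lia.
  - by lia.
  - by rewrite rho_mod exprD expr1 -mulrA rs // oppr0 rho_mul add0r Ex Ey.
have [/and3P[/eqP a1 /eqP b3 /eqP x1]|exc] := boolP [&& a == 1, b == 3 & x == 1]%N.
  have y2 : y = 2%N by lia.
  (* For alpha = 1 + 3 rho the element -1 + 2 rho is congruent to rho^3 (-2 + 2 rho), which has the
     same norm and leads to k = 1. *)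
  exists ((r + 3) %% 6)%N, 1%N, 1%N, true; split.
  - by rewrite ltn_mod.
  - by split=> //; rewrite ?a1 ?b3.
  - by lia.
  rewrite rho_mod exprD -mulrA rho3 rs // mulN1r x1 y2.
  apply/EJclass_eq; exists (rho ^+ r * rho).
  rewrite -mulrA rho_alpha -mulrBr a1 b3; congr (_ * _).
exists r, y.-1, x.-1, true; split=> //.
- by split=> //; lia.
- by lia.
- by rewrite rs; [congr (cls (_ * EJInt _ _))|]; lia.
Qed.

Lemma path_hexnorm (w : EJnode alpha) l : path (@EJadj alpha) w l ->
  exists2 z, last w l - w = cls z & (hexnorm z <= size l)%N.
Proof.
elim: l w => [|y l IH] w /=; first by exists 0; rewrite ?subrr ?EJclass0.
move=> /andP[/mapP[e ein Ee] /IH[z Ez nz]]; exists (z - e).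
  by rewrite EJclassB -Ez -Ee opprB addrA subrK.
apply: leq_trans (hexnorm_add _ _) _; rewrite -addn1 leq_add //.
by move: ein; rewrite !inE => /or4P[|||/or3P[]] /eqP ->.
Qed.

(** Each edge changes the norm of a representative by at most one. This lower bound on the distance
    ensures that the grown paths start at a length not above D(u, v). *)
Lemma dist_hexnorm (u v : EJnode alpha) :
  exists2 z, v - u = cls z & (hexnorm z <= EJdist u v)%N.
Proof.
rewrite /EJdist; case: ex_minnP => l /asboolP[[|w s] [] // /and4P[/eqP -> P /eqP L _] El] _.
by have [z Ez nz] := path_hexnorm P; exists z; rewrite -?L // -El.
Qed.

End Alpha.

Local Close Scope ring_scope.

(** * Execution with bounded time *)

(** Total correctness with a time bound. The initial state is fixed rather than described by a
    precondition, so that Q may refer to it. *)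
Definition hoare (P : prog) (t : nat) (Q : state -> Prop) (s : state) : Prop :=
  exists t' s', [/\ exec P s t' s', t' <= t & Q s'].

Section Hoare.

Implicit Types (P : prog) (Q : state -> Prop) (s : state) (t : nat).

Lemma hoare_weak P t t' Q Q' s : hoare P t Q s -> t <= t' -> (forall s', Q s' -> Q' s') ->
  hoare P t' Q' s.
Proof.
by move=> [u [s' [H1 H2 H3]]] tt QQ; exists u, s'; split; [|exact: leq_trans tt|exact: QQ].
Qed.

Lemma hoare_le P t t' Q s : hoare P t Q s -> t <= t' -> hoare P t' Q s.
Proof. by move=> H tt; apply: hoare_weak H tt _. Qed.

Lemma hoare_skip Q s : Q s -> hoare Skip 1 Q s.
Proof. by move=> H; exists 1, s; split=> //; constructor. Qed.

Lemma hoare_set r e Q s : Q (State (update (regs s) r (eval s e)) (memory s) (tape s)) ->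
  hoare (SetReg r e) (expr_cost e).+1 Q s.
Proof. by move=> H; do 2 eexists; split; [constructor|by []|]. Qed.

Lemma hoare_mem e1 e2 Q s :
  Q (State (regs s) (update (memory s) (eval s e1) (eval s e2)) (tape s)) ->
  hoare (SetMem e1 e2) (expr_cost e1 + expr_cost e2).+1 Q s.
Proof. by move=> H; do 2 eexists; split; [constructor|by []|]. Qed.

Lemma hoare_emit e Q s : Q (State (regs s) (memory s) (rcons (tape s) (eval s e))) ->
  hoare (Emit e) (expr_cost e).+1 Q s.
Proof. by move=> H; do 2 eexists; split; [constructor|by []|]. Qed.

Lemma hoare_seq P1 P2 t1 t2 Q s : hoare P1 t1 (hoare P2 t2 Q) s ->
  hoare (Seq P1 P2) (t1 + t2) Q s.
Proof.
move=> [u1 [s1 [H1 H2 [u2 [s2 [H3 H4 H5]]]]]].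
by exists (u1 + u2), s2; split=> //; [econstructor; eassumption|exact: leq_add].
Qed.

Lemma hoare_if e P1 P2 t1 t2 Q s : (eval s e <> 0 -> hoare P1 t1 Q s) ->
  (eval s e = 0 -> hoare P2 t2 Q s) ->
  hoare (If e P1 P2) ((expr_cost e).+1 + (t1 + t2)) Q s.
Proof.
move=> H1 H2; have [E|/eqP E] := eqVneq (eval s e) 0.
  have [u [s' [X1 X2 X3]]] := H2 E; exists ((expr_cost e).+1 + u), s'; split=> //; last by lia.
  by constructor; rewrite E.
have [u [s' [X1 X2 X3]]] := H1 E; exists ((expr_cost e).+1 + u), s'; split=> //; last by lia.
by constructor; move/eqP: E => ->.
Qed.

Lemma hoare_while e P t N (I : nat -> state -> Prop) s :
  (forall i s, i < N -> I i s -> eval s e <> 0 /\ hoare P t (I i.+1) s) ->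
  (forall s, I N s -> eval s e = 0) -> I 0 s ->
  hoare (While e P) (N * ((expr_cost e).+1 + t) + (expr_cost e).+1) (I N) s.
Proof.
move=> step stop.
suff H m i s0 : i + m = N -> I i s0 ->
    hoare (While e P) (m * ((expr_cost e).+1 + t) + (expr_cost e).+1) (I N) s0.
  exact: H.
elim: m i s0 => [|m IH] i s0 Ei Is.
  exists (expr_cost e).+1, s0; rewrite addn0 in Ei; split=> //; last by rewrite -Ei.
  by constructor; apply: stop; rewrite -Ei.
have [ne [u1 [s1 [X1 X2 X3]]]] := step i s0 ltac:(lia) Is.
have [|u2 [s2 [Y1 Y2 Y3]]] := IH i.+1 s1 _ X3; first by lia.
exists ((expr_cost e).+1 + u1 + u2), s2; split=> //; last by lia.
by apply: ExecWhileStep; eassumption.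
Qed.

Definition count_up (r : nat) (e : expr) (P : prog) : prog :=
  While (Ltn (Reg r) e) (Seq P (SetReg r (Add (Reg r) (Lit 1)))).

Definition set_reg (s : state) (r v : nat) : state :=
  State (update (regs s) r v) (memory s) (tape s).

(** The final index [maxn m M] also covers a loop entered beyond its bound, as the spine loop is
    when s + 1 > a + b. *)
Lemma hoare_count_up r e P t m M (I : nat -> state -> Prop) s :
  (forall i s, I i s -> regs s r = i /\ eval s e = M) ->
  (forall i s, m <= i < M -> I i s ->
     hoare P t (fun s' => I i.+1 (set_reg s' r (regs s' r + 1))) s) ->
  I m s ->
  hoare (count_up r e P) ((M - m) * (expr_cost e + t + 8) + (expr_cost e + 3)) (I (maxn m M)) s.
Proof.
move=> Ir step I0.
have H := @hoare_while (Ltn (Reg r) e) (Seq P (SetReg r (Add (Reg r) (Lit 1)))) (t + 4) (M - m)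
  (fun i => I (m + i)) s.
apply: hoare_weak; first apply: H.
- move=> i s0 iN Is; have [E1 E2] := Ir _ _ Is; split.
    by rewrite /= E1 E2; have -> : m + i < M by lia.
  apply: hoare_seq; apply: hoare_weak (step _ _ _ Is) (leqnn t) _; first by lia.
  move=> s' H'; apply: hoare_le; first apply: hoare_set; last by [].
  by rewrite addnS.
- by move=> s0 Is; have [E1 E2] := Ir _ _ Is; rewrite /= E1 E2; have -> : m + (M - m) < M = false by lia.
- by rewrite addn0.
- by rewrite /=; lia.
by move=> s'; rewrite maxnE.
Qed.

End Hoare.

(** * The program *)

(* Registers: 0-3 hold a, b, n, a + b; 4 the rotation; 5 the first node u; 6-8 the
   parameters s, k, ex; 9 the last node v; 10 the length of the current path;
   11 the cursor of a finger or of the spine; 12 the argument of an insertion;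
   17 and 18 hold 6n and 7n; the others are scratch.  The cells 6n + p hold the
   encoding D of the current path, the cells 7n + j the node at which the finger
   in the rows j and j + 1 starts. *)
Definition times6 (e : expr) : expr := Add (Add e e) (Add (Add e e) (Add e e)).
Definition nb_expr (e : expr) (k : nat) : expr := Cell (Add (times6 e) (Lit k)).
Definition D_expr (e : expr) : expr := Cell (Add (Reg 17) e).
Definition B_expr (e : expr) : expr := Cell (Add (Reg 18) e).

(** The successor of p is the table entry at 6 p + D p - 1, because D stores directions shifted by
    one. Comparison by [Ltn] with 1 serves as negation. *)
Definition print_path : prog :=
  Seq (Emit (Reg 5)) (Seq (Emit (Reg 9)) (Seq (Emit (Reg 10))
  (Seq (SetReg 14 (Reg 5)) (Seq (Emit (Reg 14))
  (While (Ltn (Eqn (Reg 14) (Reg 9)) (Lit 1))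
    (Seq (SetReg 14 (Cell (Defs.Sub (Add (times6 (Reg 14)) (D_expr (Reg 14))) (Lit 1))))
         (Emit (Reg 14)))))))).

(** The conjunction in the test is coded as a sum of truth values. *)
Definition insert_prog (k1 k2 k3 : nat) : prog :=
  Seq (SetReg 13 (nb_expr (Reg 12) k2))
  (If (Eqn (Add (Eqn (D_expr (Reg 12)) (Lit k1.+1)) (Eqn (D_expr (Reg 13)) (Lit 0))) (Lit 2))
    (Seq (SetMem (Add (Reg 17) (Reg 13)) (Lit k3.+1))
    (Seq (SetMem (Add (Reg 17) (Reg 12)) (Lit k2.+1))
    (Seq (SetReg 10 (Add (Reg 10) (Lit 1))) print_path)))
    Skip).

Definition answer := (nat * nat * nat * seq nat)%type.

Definition answer_code (x : answer) : seq nat :=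
  let: (u, v, l, s) := x in [:: u, v, l & s].

Definition append_prog (d : nat) : prog :=
  Seq (SetReg 13 (nb_expr (Reg 9) d))
  (If (Ltn (D_expr (Reg 13)) (Lit 1))
    (Seq (SetMem (Add (Reg 17) (Reg 9)) (Lit d.+1))
    (Seq (SetMem (Add (Reg 17) (Reg 13)) (Lit 7))
    (Seq (SetReg 9 (Reg 13)) (SetReg 10 (Add (Reg 10) (Lit 1))))))
    Skip).

Definition step_prog : prog :=
  Seq (SetReg 19 (nb_expr (Reg 11) 0))
  (If (Eqn (Add (Add (Eqn (D_expr (Reg 11)) (Lit 2)) (Eqn (D_expr (Reg 19)) (Lit 0)))
                (Eqn (D_expr (nb_expr (Reg 19) 1)) (Lit 0))) (Lit 3))
    (Seq (SetReg 12 (Reg 11)) (Seq (insert_prog 1 0 2)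
    (Seq (SetReg 11 (Reg 19)) (Seq (SetReg 12 (Reg 19)) (insert_prog 2 1 3)))))
    Skip).

Definition finger_prog : prog :=
  Seq (SetReg 12 (Reg 11)) (Seq (insert_prog 2 1 3)
  (Seq (SetReg 16 (Lit 0)) (count_up 16 (Reg 3) step_prog))).

Definition init_prog : prog :=
  Seq (SetReg 11 (B_expr (Defs.Sub (Reg 6) (Lit 1))))
  (Seq (SetReg 12 (Reg 11)) (Seq (insert_prog 2 1 3)
  (Seq (SetReg 12 (nb_expr (B_expr (Reg 6)) 0))
  (Seq (If (Eqn (D_expr (Reg 12)) (Lit 0)) step_prog Skip)
       (SetMem (Add (Reg 18) (Defs.Sub (Reg 6) (Lit 1))) (Reg 11)))))).

Definition spine_body : prog :=
  Seq (SetMem (Add (Reg 18) (Defs.Sub (Reg 15) (Lit 1))) (Reg 11))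
  (Seq (SetReg 12 (Reg 11)) (Seq (insert_prog 3 2 4)
  (Seq (SetReg 12 (nb_expr (Reg 11) 2)) (Seq (insert_prog 4 3 5)
  (If (Ltn (Add (Reg 15) (Lit 1)) (Reg 3))
    (Seq (SetReg 12 (Reg 11)) (Seq (insert_prog 2 1 3) (SetReg 11 (nb_expr (Reg 11) 1))))
    Skip))))).

Definition spine_prog : prog :=
  Seq (SetReg 11 (nb_expr (B_expr (Reg 6)) 0))
  (Seq (SetReg 15 (Add (Reg 6) (Lit 1))) (count_up 15 (Reg 3) spine_body)).

Definition fingers_prog : prog :=
  Seq (SetReg 15 (Lit 0))
  (While (Ltn (Add (Reg 15) (Lit 1)) (Reg 3))
    (Seq (SetReg 11 (B_expr (Reg 15))) (Seq finger_prog (SetReg 15 (Add (Reg 15) (Lit 2)))))).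

Definition pass_prog (k1 k2 k3 : nat) : prog :=
  Seq (SetReg 16 (Lit 0))
  (count_up 16 (Reg 2) (Seq (SetReg 12 (Reg 16)) (insert_prog k1 k2 k3))).

Definition clear_prog : prog :=
  Seq (SetReg 16 (Lit 0))
  (Seq (count_up 16 (Reg 2) (SetMem (Add (Reg 17) (Reg 16)) (Lit 0)))
  (Seq (SetMem (Add (Reg 17) (Reg 5)) (Lit 7))
  (Seq (SetReg 9 (Reg 5)) (Seq (SetReg 10 (Lit 0))
       (SetMem (Add (Reg 18) (Lit 0)) (Reg 5)))))).

Definition base_body : prog :=
  Seq (If (Ltn (Reg 15) (Reg 7)) (append_prog 2) (append_prog 1))
      (SetMem (Add (Reg 18) (Add (Reg 15) (Lit 1))) (Reg 9)).

Definition base_prog : prog :=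
  Seq clear_prog
  (Seq (SetReg 15 (Lit 0)) (Seq (count_up 15 (Reg 6) base_body)
  (Seq (If (Reg 8) (append_prog 2) Skip) print_path))).

Definition inner_prog : prog :=
  Seq base_prog (Seq init_prog (Seq spine_prog (Seq fingers_prog
  (Seq (pass_prog 3 2 4) (Seq (pass_prog 2 1 3) (pass_prog 1 0 2)))))).

Definition for_prog (r : nat) (e : expr) (P : prog) : prog :=
  Seq (SetReg r (Lit 0)) (count_up r e P).

Definition sweep_prog : prog :=
  for_prog 5 (Reg 2) (for_prog 6 (Add (Reg 1) (Lit 1))
    (for_prog 7 (Add (Reg 1) (Lit 1)) (for_prog 8 (Lit 2) inner_prog))).

Definition keeps (l : seq nat) (s s' : state) : Prop :=
  forall r, r \notin l -> regs s' r = regs s r.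

Lemma keeps_trans l s1 s2 s3 : keeps l s1 s2 -> keeps l s2 s3 -> keeps l s1 s3.
Proof. by move=> H1 H2 r rl; rewrite H2 ?H1. Qed.

Lemma keeps_sub l l' s s' : all (mem l') l -> keeps l s s' -> keeps l' s s'.
Proof. by move=> /allP sl H r rl; apply: H; apply: contra rl => /sl. Qed.

Lemma keeps_set l s r x m tp : r \in l -> keeps l s (State (update (regs s) r x) m tp).
Proof. by move=> rl i il; rewrite /= /update; case: eqP => // E; rewrite E rl in il. Qed.

(** * Soundness and cost of the program on an abstract triangulated network *)

Section Network.

Variables (a b n : nat) (nb : nat -> nat -> nat) (adj : rel nat).
Hypothesis n0 : 0 < n.
Hypothesis nb_lt : forall p k, p < n -> k < 6 -> nb p k < n.
Hypothesis nb_adj : forall p k, p < n -> k < 6 -> adj p (nb p k).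
Hypothesis nb_tri : forall p k, p < n -> k < 4 -> nb (nb p k) k.+2 = nb p k.+1.
Hypothesis nb_inj : forall k p q, k < 6 -> p < n -> q < n -> nb p k = nb q k -> p = q.

Definition answer_ok (x : answer) : bool :=
  let: (u, v, l, s) := x in
  if s is w :: s' then
    [&& w == u, path adj w s', last w s' == v, uniq s, all (gtn n) s & size s' == l]
  else false.

(** [env_B] is demanded of every cell: for bad parameters the program may read entries that are
    initial zeros or left over from earlier runs, and these must still be node numbers. *)
Record env s : Prop := Env {
  env0 : regs s 0 = a; env1 : regs s 1 = b; env2 : regs s 2 = n; env3 : regs s 3 = a + b;
  env17 : regs s 17 = 6 * n; env18 : regs s 18 = 7 * n;
  env_nb : forall p k, p < n -> k < 6 -> memory s (6 * p + k) = nb p k;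
  env_B : forall j, memory s (7 * n + j) < n }.

Definition D_of s : nat -> nat := fun p => if p < n then memory s (6 * n + p) else 0.
Definition B_of s : nat -> nat := fun j => memory s (7 * n + j).

Lemma env_mem s rg m tp : env s -> rg = regs s ->
  (forall i, i < 6 * n -> m i = memory s i) -> (forall j, m (7 * n + j) < n) ->
  env (State rg m tp).
Proof.
move=> [E0 E1 E2 E3 E4 E5 E6 E7] -> Hm HB; split=> // p k pn k6 /=.
by rewrite Hm ?E6 //; lia.
Qed.

Lemma env_tape s tp : env s -> env (State (regs s) (memory s) tp).
Proof. by case. Qed.

Lemma env_setD s x v : env s -> x < n ->
  env (State (regs s) (update (memory s) (6 * n + x) v) (tape s)).
Proof.
move=> E xn; apply: (env_mem _ E) => // [i i6|j]; rewrite /update.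
  by case: eqP => //; lia.
by case: eqP => [|_]; [lia|exact: env_B E j].
Qed.

Lemma env_setB s j x : env s -> x < n ->
  env (State (regs s) (update (memory s) (7 * n + j) x) (tape s)).
Proof.
move=> E xn; apply: (env_mem _ E) => // [i i6|i]; rewrite /update.
  by case: eqP => //; lia.
by case: eqP => [//|_]; exact: env_B E i.
Qed.

Lemma env_regs s rg : env s -> (forall r, r \in [:: 0; 1; 2; 3; 17; 18] -> rg r = regs s r) ->
  env (State rg (memory s) (tape s)).
Proof. by move=> [E0 E1 E2 E3 E4 E5 E6 E7] H; split=> //=; rewrite H. Qed.

Lemma D_of_setD rg m tp x v : x < n ->
  D_of (State rg (update m (6 * n + x) v) tp) = update (D_of (State rg m tp)) x v.
Proof.
move=> xn; apply/funext => p; rewrite /D_of /update /= eqn_add2l.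
by case: eqP => [->|_]; rewrite ?xn.
Qed.

Lemma B_of_setD rg m tp x v : x < n ->
  B_of (State rg (update m (6 * n + x) v) tp) = B_of (State rg m tp).
Proof. by move=> xn; apply/funext => p; rewrite /B_of /update /=; case: eqP => //; lia. Qed.

Lemma D_of_setB rg m tp j v :
  D_of (State rg (update m (7 * n + j) v) tp) = D_of (State rg m tp).
Proof. by apply/funext => p; rewrite /D_of /update /=; case: ifP => // pn; case: eqP => //; lia. Qed.

Lemma B_of_setB rg m tp j v :
  B_of (State rg (update m (7 * n + j) v) tp) = update (B_of (State rg m tp)) j v.
Proof. by apply/funext => p; rewrite /B_of /update /= eqn_add2l. Qed.

Lemma nb_exprE s e k : env s -> eval s e < n -> k < 6 -> eval s (nb_expr e k) = nb (eval s e) k.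
Proof. by move=> E en k6; rewrite -(env_nb E) //=; congr memory; lia. Qed.

Lemma D_exprE s e : env s -> eval s e < n -> eval s (D_expr e) = D_of s (eval s e).
Proof. by move=> E en; rewrite /= (env17 E) /D_of en. Qed.

Lemma B_exprE s e : env s -> eval s (B_expr e) = B_of s (eval s e).
Proof. by move=> E; rewrite /= (env18 E). Qed.

(** This ties the encoding to a genuine simple path and does not refer to the tile; it is what keeps
    every printed answer correct for arbitrary parameters. *)
Record walk (D : nat -> nat) u v l : Prop := Walk {
  wk_path : path (fun x y => nb x (D x).-1 == y) u l;
  wk_last : last u l = v;
  wk_uniq : uniq (u :: l);
  wk_lt : all (gtn n) (u :: l);
  wk_end : D v = 7;
  wk_in : forall x, x \in u :: l -> x <> v -> 0 < D x <= 6;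
  wk_out : forall x, x < n -> x \notin u :: l -> D x = 0 }.

Lemma walk_size D u v l : walk D u v l -> size l < n.
Proof.
move=> W; have: {subset u :: l <= iota 0 n}.
  by move=> x /(allP (wk_lt W)); rewrite mem_iota.
by move/(uniq_leq_size (wk_uniq W)); rewrite size_iota.
Qed.

Lemma walk_full D u v l : walk D u v l -> (forall x, x < n -> D x <> 0) -> (size l).+1 = n.
Proof.
move=> W H; apply/eqP; rewrite eqn_leq (walk_size W) /=.
have: {subset iota 0 n <= u :: l}.
  move=> x; rewrite mem_iota => xn; apply/negPn/negP => xl.
  by case: (H x xn); apply: wk_out W _ xn xl.
by move/(uniq_leq_size (iota_uniq 0 n)); rewrite size_iota.
Qed.

Lemma walk_ends D u v l : walk D u v l -> u < n /\ v < n.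
Proof.
move=> W; have := allP (wk_lt W) => H; split; first by apply: H; rewrite mem_head.
by apply: H; rewrite -(wk_last W) mem_last.
Qed.

Lemma walk_adj D u v l : walk D u v l -> path adj u l.
Proof.
case=> P Lv U A _ I _; elim: l u P Lv U A I => //= y l IH u.
move=> /andP[/eqP Ey P] Lv /andP[ul U] /andP[un A] I.
have uv : u <> v by move=> E; move: ul; rewrite E -Lv mem_last.
rewrite IH ?andbT //; last by move=> x xl; apply: I; rewrite inE xl orbT.
have := I u (mem_head _ _) uv; rewrite -Ey => D6.
by apply: nb_adj => //; lia.
Qed.

(** The relation is only consulted at sources of edges, so an update of D at any other node does not
    disturb [path]. *)
Lemma path_source (T : eqType) (e e' : rel T) u l :
  (forall x, x \in belast u l -> e x =1 e' x) -> path e u l = path e' u l.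
Proof.
elim: l u => //= y l IH u H; rewrite H ?mem_head // IH // => x xl.
by apply: H; rewrite inE xl orbT.
Qed.

Lemma walk_append D u v l d : walk D u v l -> d < 6 -> D (nb v d) = 0 ->
  walk (update (update D v d.+1) (nb v d) 7) u (nb v d) (rcons l (nb v d)).
Proof.
move=> W d6 D0; have [un vn] := walk_ends W.
set z := nb v d; have zn : z < n by apply: nb_lt.
case: (W) => P Lv U A Dv I O.
have zl : z \notin u :: l.
  apply/negP => /I; rewrite -/z in D0; rewrite D0.
  by have [E|/eqP ne /(_ ne)//] := eqVneq z v; rewrite E Dv in D0.
have vl : v \in u :: l by rewrite -Lv mem_last.
have zv : (v == z) = false by apply: contraNF zl => /eqP <-.
have U' : v \notin belast u l.
  by move: U; rewrite lastI Lv rcons_uniq => /andP[].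
split.
- have D'v : update (update D v d.+1) z 7 v = d.+1 by rewrite /update zv eqxx.
  rewrite rcons_path Lv D'v eqxx andbT.
  rewrite (@path_source _ _ (fun x y => nb x (D x).-1 == y)) // => x xl y.
  have xul : x \in u :: l by apply: mem_belast.
  have xz : (x == z) = false by apply: contraNF zl => /eqP <-.
  have xv : (x == v) = false by apply: contraNF U' => /eqP <-.
  by rewrite /update xz xv.
- by rewrite last_rcons.
- by rewrite -rcons_cons rcons_uniq zl.
- by rewrite -rcons_cons all_rcons /= zn.
- by rewrite /update eqxx.
- move=> x; rewrite -rcons_cons mem_rcons inE => /orP[/eqP->//|xl] xz.
  rewrite /update; case: eqP => // _; case: eqP => [_|xv]; first by lia.
  exact: I.
- move=> x xn; rewrite -rcons_cons mem_rcons inE negb_or => /andP[xz xl].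
  rewrite /update (negbTE xz); case: eqP => [E|_]; last exact: O.
  by rewrite E vl in xl.
Qed.

Lemma walk_insert D u v l p k1 k2 k3 : walk D u v l -> p < n ->
  k1 < 6 -> k2 < 6 -> k3 < 6 -> nb (nb p k2) k3 = nb p k1 ->
  D p = k1.+1 -> D (nb p k2) = 0 ->
  exists2 l', walk (update (update D (nb p k2) k3.+1) p k2.+1) u v l' & size l' = (size l).+1.
Proof.
move=> W pn k16 k26 k36 tri Dp D0.
set z := nb p k2 in D0 tri *; have zn : z < n by apply: nb_lt.
case: (W) => P Lv U A Dv I O.
have zl : z \notin u :: l.
  apply/negP => /I; rewrite D0.
  by have [E|/eqP ne /(_ ne)//] := eqVneq z v; rewrite E Dv in D0.
have pl : p \in u :: l by apply/negPn/negP => /(O _ pn); rewrite Dp.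
have pv : p <> v by move=> E; rewrite E Dv in Dp; lia.
have pz : (z == p) = false by apply: contraNF zl => /eqP ->.
case/splitPl: pl P Lv U A I O zl => l1 [|q l2] Ep.
  by rewrite cats0 Ep => ? E; case: pv.
move=> P Lv U A I O zl; move: P Lv; rewrite cat_path last_cat /= Ep.
move=> /and3P[P1 /eqP Eq P2] Lv.
have Ezq : nb z k3 = q by rewrite tri -Eq Dp.
have perm : perm_eq (u :: l1 ++ [:: z, q & l2]) (z :: u :: l1 ++ q :: l2).
  by apply/permPl; exact: (perm_catCA (u :: l1) [:: z] (q :: l2)).
have memE x : (x \in u :: l1 ++ [:: z, q & l2]) = (x == z) || (x \in u :: l1 ++ q :: l2).
  by rewrite (perm_mem perm) inE.
exists (l1 ++ [:: z, q & l2]); last by rewrite !size_cat /= addnS.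
have U1 : p \notin belast u l1 /\ p \notin q :: l2.
  move: U; rewrite -cat_cons cat_uniq lastI Ep rcons_uniq => /and3P[/andP[H1 _] H2 _].
  by split=> //; apply: contraNN H2 => pq; apply/hasP; exists p => //=; rewrite mem_rcons mem_head.
have keep x : x \in u :: l1 ++ q :: l2 -> x <> p ->
    update (update D z k3.+1) p k2.+1 x = D x.
  move=> xl /eqP/negbTE xp; rewrite /update xp; case: eqP => // E.
  by rewrite -E xl in zl.
split.
- have Dp' : update (update D z k3.+1) p k2.+1 p = k2.+1 by rewrite /update eqxx.
  have Dz' : update (update D z k3.+1) p k2.+1 z = k3.+1 by rewrite /update pz eqxx.
  rewrite cat_path Ep /= Dp' Dz' /= Ezq !eqxx /=.
  apply/andP; split.
    rewrite (@path_source _ _ (fun x y => nb x (D x).-1 == y)) // => x xl y.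
    rewrite keep //; last by move=> E; case: U1; rewrite -E xl.
    by rewrite -cat_cons mem_cat (mem_belast xl).
  rewrite (@path_source _ _ (fun x y => nb x (D x).-1 == y)) // => x xl y.
  have xq : x \in q :: l2 by apply: mem_belast.
  rewrite keep //; last by move=> E; case: U1 => _; rewrite -E xq.
  by rewrite -cat_cons mem_cat xq orbT.
- by rewrite last_cat.
- by rewrite (perm_uniq perm) /= zl.
- by rewrite (perm_all _ perm) /= zn.
- rewrite keep //; last by move=> E; case: pv.
  by rewrite -Lv -cat_cons mem_cat mem_last orbT.
- move=> x; rewrite memE => /orP[/eqP->|xl] xv.
    by rewrite /update pz eqxx.
  have [E|/eqP xp] := eqVneq x p; first by rewrite E /update eqxx.
  by rewrite keep //; apply: I.
- move=> x xn; rewrite memE negb_or => /andP[xz xl].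
  have xp : x <> p.
    by move=> E; move: (O _ xn xl); rewrite E Dp.
  by move/eqP/negbTE: xp => xp; rewrite /update xp (negbTE xz); apply: O.
Qed.

Lemma update_update f r x y : update (update f r x) r y = update f r y.
Proof. by apply/funext => i; rewrite /update; case: eqP. Qed.

Lemma hoare_print s l : env s -> walk (D_of s) (regs s 5) (regs s 9) l -> regs s 10 = size l ->
  hoare print_path (100 * n) (fun s' => s' =
    State (update (regs s) 14 (regs s 9)) (memory s)
      (tape s ++ answer_code (regs s 5, regs s 9, size l, regs s 5 :: l))) s.
Proof.
move=> E W El; set u := regs s 5 in W *; set v := regs s 9 in W *.
have ln := walk_size W; have [un vn] := walk_ends W.
pose x i := nth 0 (u :: l) i.
have xn i : i <= size l -> x i < n by move=> il; apply: (allP (wk_lt W)); apply: mem_nth.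
have x_end : x (size l) = v by rewrite -(wk_last W); exact: (nth_last 0 (u :: l)).
pose I i s' := s' = State (update (regs s) 14 (x i)) (memory s)
  (tape s ++ [:: u, v, size l & take i.+1 (u :: l)]).
apply: hoare_le.
  do 3![apply: hoare_seq; apply: hoare_emit]; apply: hoare_seq; apply: hoare_set; apply: hoare_seq; apply: hoare_emit.
  apply: hoare_weak (leqnn _) _; first apply: (@hoare_while _ _ 30 (size l) I).
  - move=> i s1 il ->; split.
      rewrite /= {1 2}/update /=; case: eqP => // Ei.
      have := nth_uniq 0 (ltnW il : i < size (u :: l)) (leqnn _ : size l < size (u :: l)) (wk_uniq W).
      by rewrite -/(x i) -/(x (size l)) x_end Ei eqxx; lia.
    apply: hoare_le; first (apply: hoare_seq; apply: hoare_set; apply: hoare_emit); last by [].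
    rewrite /I /= update_update; have il' : i <= size l by lia.
    have xi_n := xn i il'.
    have xin : x i \in u :: l by apply: mem_nth; rewrite /=; lia.
    have xiv : x i <> v.
      move=> Ei; have := nth_uniq 0 (ltnW il : i < size (u :: l)) (leqnn _ : size l < size (u :: l)) (wk_uniq W).
      by rewrite -/(x i) -/(x (size l)) x_end Ei eqxx; lia.
    have D6 := wk_in W xin xiv.
    have Enext : memory s (update (regs s) 14 (x i) 14 + update (regs s) 14 (x i) 14 +
        (update (regs s) 14 (x i) 14 + update (regs s) 14 (x i) 14 +
         (update (regs s) 14 (x i) 14 + update (regs s) 14 (x i) 14)) +
        memory s (update (regs s) 14 (x i) 17 + update (regs s) 14 (x i) 14) - 1) = x i.+1.
      rewrite /update /= (env17 E); have Dx : memory s (6 * n + x i) = D_of s (x i).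
        by rewrite /D_of xi_n.
      have /(pathP 0) /(_ i il) /eqP := wk_path W; rewrite -/(x i) => Enx.
      rewrite Dx -[RHS]Enx -(env_nb E) //; last by lia.
      by congr memory; lia.
    rewrite Enext; congr State; rewrite {1}/update /= -cats1 -catA; congr (_ ++ _).
    by rewrite /= cats1 -take_nth //; rewrite /=; lia.
  - by move=> s1 -> /=; rewrite /update /= x_end eqxx.
  - by rewrite /I /= /update /= take0 -!cats1 -!catA /= El.
  - by move=> s' ->; rewrite /= x_end take_size.
rewrite /=; lia.
Qed.

(** Here y is the length of the first path printed in a run and L that of the current one. Each
    insertion lengthens the path by one and prints it, so no length in between is skipped. *)
Definition logged t0 u v y L (tp : seq nat) : Prop := exists ys,
  [/\ tp = t0 ++ flatten (map answer_code ys), all answer_ok ys &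
   forall l, y <= l <= L -> exists p, (u, v, l, p) \in ys].

Record core t0 y s : Prop := Core {
  co_env : env s;
  co_walk : exists2 l, walk (D_of s) (regs s 5) (regs s 9) l & size l = regs s 10;
  co_log : logged t0 (regs s 5) (regs s 9) y (regs s 10) (tape s) }.

Lemma walk_ok D u v l : walk D u v l -> answer_ok (u, v, size l, u :: l).
Proof.
move=> W; rewrite /answer_ok eqxx (walk_adj W) (wk_last W) eqxx (wk_uniq W) eqxx.
by rewrite (wk_lt W).
Qed.

Lemma logged_cons t0 D u v y l tp : walk D u v l ->
  (y < size l -> logged t0 u v y (size l).-1 tp) ->
  (size l <= y -> exists2 ys, tp = t0 ++ flatten (map answer_code ys) & all answer_ok ys) ->
  logged t0 u v y (size l) (tp ++ answer_code (u, v, size l, u :: l)).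
Proof.
move=> W H1 H2.
have [ys [-> ok cov]] : exists ys, [/\ tp = t0 ++ flatten (map answer_code ys), all answer_ok ys &
   forall l', y <= l' < size l -> exists p, (u, v, l', p) \in ys].
  have [yl|ly] := ltnP y (size l).
    have [ys [E1 E2 E3]] := H1 yl; exists ys; split=> // l' yl'; apply: E3; lia.
  by have [ys E1 E2] := H2 ly; exists ys; split=> // l'; lia.
exists (rcons ys (u, v, size l, u :: l)); split.
- by rewrite map_rcons flatten_rcons catA.
- by rewrite all_rcons ok (walk_ok W).
move=> l' /andP[yl]; rewrite leq_eqVlt => /orP[/eqP->|ll].
  by exists (u :: l); rewrite mem_rcons mem_head.
by have [|p pin] := cov l'; [rewrite yl|exists p; rewrite mem_rcons inE pin orbT].
Qed.

Lemma env_upd s r x : env s -> r \notin [:: 0; 1; 2; 3; 17; 18] ->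
  env (State (update (regs s) r x) (memory s) (tape s)).
Proof.
by move=> E rr; apply: env_regs => // i ir; rewrite /update; case: eqP => // Ei; rewrite -Ei ir in rr.
Qed.

Lemma core_upd t0 y s r x : core t0 y s -> r \notin [:: 0; 1; 2; 3; 5; 9; 10; 17; 18] ->
  core t0 y (State (update (regs s) r x) (memory s) (tape s)).
Proof.
move=> [E W L] rr.
have ne i : i \in [:: 0; 1; 2; 3; 5; 9; 10; 17; 18] -> update (regs s) r x i = regs s i.
  by rewrite /update; case: eqP => // ->; rewrite (negbTE rr).
split; [|by rewrite /= !ne|by rewrite /= !ne].
by apply: env_regs => // i ii; apply: ne; exact: (allP (isT : all (mem [:: 0; 1; 2; 3; 5; 9; 10; 17; 18]) [:: 0; 1; 2; 3; 17; 18])) ii.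
Qed.

Lemma hoare_insert k1 k2 k3 t0 y s : k1 < 6 -> k2 < 6 -> k3 < 6 ->
  (forall p, p < n -> nb (nb p k2) k3 = nb p k1) ->
  core t0 y s -> regs s 12 < n ->
  hoare (insert_prog k1 k2 k3) (200 * n) (fun s' =>
    [/\ core t0 y s', D_of s' = insert nb k1 k2 k3 (regs s 12) (D_of s),
        B_of s' = B_of s, regs s' 13 = nb (regs s 12) k2 &
        keeps [:: 10; 13; 14] s s']) s.
Proof.
move=> k16 k26 k36 tri C pn; have E := co_env C; set p := regs s 12 in pn *.
have zn : nb p k2 < n by apply: nb_lt.
apply: hoare_le.
  apply: hoare_seq; apply: hoare_set; rewrite (nb_exprE E) //.
  set s1 := State _ _ _; have C1 : core t0 y s1 by apply: core_upd.
  have E1 := co_env C1.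
  have r12 : regs s1 12 = p by [].
  have r13 : regs s1 13 = nb p k2 by [].
  have keep r : r \notin [:: 10; 13; 14] -> regs s1 r = regs s r.
    by rewrite /= /update !inE !negb_or => /and3P[_ /negbTE -> _].
  have cond : eval s1 (Eqn (Add (Eqn (D_expr (Reg 12)) (Lit k1.+1))
      (Eqn (D_expr (Reg 13)) (Lit 0))) (Lit 2)) =
      ((D_of s p == k1.+1) && (D_of s (nb p k2) == 0)) :> nat.
    have -> : D_of s p = eval s1 (D_expr (Reg 12)) by rewrite (D_exprE E1) //= r12.
    have -> : D_of s (nb p k2) = eval s1 (D_expr (Reg 13)) by rewrite (D_exprE E1) //= r13.
    by rewrite /=; case: (_ == k1.+1); case: (_ == 0).
  apply: hoare_if; rewrite cond /insert; case: ifP => //.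
    move=> /andP[/eqP Dp /eqP Dz] _.
    have [l W El] := co_walk C1.
    have [l' W' El'] := walk_insert W pn k16 k26 k36 (tri _ pn) Dp Dz.
    apply: hoare_seq; apply: hoare_mem; apply: hoare_seq; apply: hoare_mem; apply: hoare_seq; apply: hoare_set.
    set s2 := State _ _ _.
    have e17 : regs s1 17 = 6 * n := env17 E1.
    have Es2 : s2 = State (update (regs s1) 10 (size l'))
       (update (update (memory s1) (6 * n + nb p k2) k3.+1) (6 * n + p) k2.+1) (tape s1).
      have L1 : eval s1 (Add (Reg 10) (Lit 1)) = size l' by rewrite El' El /= addn1.
      have M1 : eval s1 (Add (Reg 17) (Reg 13)) = 6 * n + nb p k2 by rewrite -e17.
      have M2 : eval s1 (Add (Reg 17) (Reg 12)) = 6 * n + p by rewrite -e17.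
      by rewrite -L1 -M1 -M2.
    have E2 : env s2.
      have E2a := env_setD k2.+1 (env_setD k3.+1 E1 zn) pn.
      by rewrite Es2; exact: (@env_upd _ 10 (size l') E2a).
    have D2 : D_of s2 = update (update (D_of s1) (nb p k2) k3.+1) p k2.+1.
      by rewrite Es2 !D_of_setD.
    have B2 : B_of s2 = B_of s by rewrite Es2 !B_of_setD.
    have r5 : regs s2 5 = regs s1 5 by rewrite Es2.
    have r9 : regs s2 9 = regs s1 9 by rewrite Es2.
    have r10 : regs s2 10 = size l' by rewrite Es2.
    rewrite -D2 -r5 -r9 in W'.
    apply: hoare_weak (hoare_print E2 W' r10) (leqnn _) _ => s3 ->.
    have D3 : D_of (State (update (regs s2) 14 (regs s2 9)) (memory s2)
      (tape s2 ++ answer_code (regs s2 5, regs s2 9, size l', regs s2 5 :: l'))) = D_of s2 by [].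
    split.
    - split.
      + exact: (env_tape _ (@env_upd s2 14 (regs s2 9) E2 isT)).
      + by exists l'; rewrite ?D3 //= /update /= r10.
      + suff: logged t0 (regs s2 5) (regs s2 9) y (regs s2 10)
          (tape s2 ++ answer_code (regs s2 5, regs s2 9, size l', regs s2 5 :: l')) by [].
        rewrite r10; apply: logged_cons W' _ _.
          move=> _; rewrite El' El r5 r9; exact: co_log C1.
        by move=> _; have [ys [Ey ok _]] := co_log C1; exists ys => //; rewrite -Ey Es2.
    - by rewrite D3 D2.
    - exact: B2.
    - by rewrite Es2.
    - move=> r rr; rewrite -keep // Es2 /= /update.
      by move: rr; rewrite !inE !negb_or => /and3P[/negbTE -> _ /negbTE ->].
  move=> nc _; apply: hoare_skip; split=> //.
by rewrite /=; lia.
Qed.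

Lemma hoare_ins k t0 y s : k < 4 -> core t0 y s -> regs s 12 < n ->
  hoare (insert_prog k.+1 k k.+2) (200 * n) (fun s' =>
    [/\ core t0 y s', D_of s' = insert nb k.+1 k k.+2 (regs s 12) (D_of s),
        B_of s' = B_of s, regs s' 13 = nb (regs s 12) k &
        keeps [:: 10; 13; 14] s s']) s.
Proof. by move=> k4 C pn; apply: hoare_insert => //; [lia|lia|move=> p p'n; apply: nb_tri]. Qed.

(** The counterpart of [core] while the shortest path is being laid and nothing has yet been
    printed. *)
Definition seed t0 s : Prop := [/\ env s,
  exists2 l, walk (D_of s) (regs s 5) (regs s 9) l & size l = regs s 10 & tape s = t0].

Lemma seed_upd t0 s r x : seed t0 s -> r \notin [:: 0; 1; 2; 3; 5; 9; 10; 17; 18] ->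
  seed t0 (State (update (regs s) r x) (memory s) (tape s)).
Proof.
move=> [E W L] rr.
have ne i : i \in [:: 0; 1; 2; 3; 5; 9; 10; 17; 18] -> update (regs s) r x i = regs s i.
  by rewrite /update; case: eqP => // ->; rewrite (negbTE rr).
split; [|by rewrite /= !ne|by []].
by apply: env_regs => // i ii; apply: ne; exact: (allP (isT : all (mem [:: 0; 1; 2; 3; 5; 9; 10; 17; 18]) [:: 0; 1; 2; 3; 17; 18])) ii.
Qed.

Lemma hoare_append d t0 s : d < 6 -> seed t0 s -> hoare (append_prog d) 60 (fun s' =>
  [/\ seed t0 s', B_of s' = B_of s,
     D_of s (nb (regs s 9) d) = 0 ->
     [/\ D_of s' = update (update (D_of s) (regs s 9) d.+1) (nb (regs s 9) d) 7,
        regs s' 9 = nb (regs s 9) d & regs s' 10 = (regs s 10).+1] &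
     keeps [:: 9; 10; 13] s s']) s.
Proof.
move=> d6 S; have [E [l W El] _] := S.
have [un vn] := walk_ends W; set v := regs s 9 in W vn *.
have zn : nb v d < n by apply: nb_lt.
apply: hoare_le.
  apply: hoare_seq; apply: hoare_set; rewrite (nb_exprE E) //.
  set s1 := State _ _ _; have S1 : seed t0 s1 by apply: seed_upd.
  have [E1 [l1 W1 El1] T1] := S1.
  have keep r : r \notin [:: 9; 10; 13] -> regs s1 r = regs s r.
    by rewrite /= /update !inE !negb_or => /and3P[_ _ /negbTE ->].
  have cond : eval s1 (Ltn (D_expr (Reg 13)) (Lit 1)) = (D_of s (nb v d) == 0) :> nat.
    have -> : D_of s (nb v d) = eval s1 (D_expr (Reg 13)) by rewrite (D_exprE E1).
    by rewrite [LHS]/= ltnS leqn0.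
  apply: hoare_if; rewrite cond; case: eqP => // D0 _.
    do 2![apply: hoare_seq; apply: hoare_mem]; apply: hoare_seq; apply: hoare_set; apply: hoare_set.
    have W2 := walk_append W1 d6 D0.
    have E2 := env_setD 7 (env_setD d.+1 E1 vn) zn.
    have e17 : regs s1 17 = 6 * n := env17 E1.
    set s2 := State _ _ _.
    have Es2 : s2 = State (update (update (regs s1) 9 (nb v d)) 10 (regs s1 10 + 1))
       (update (update (memory s1) (6 * n + v) d.+1) (6 * n + nb v d) 7) (tape s1).
      by rewrite -e17.
    have D2 : D_of s2 = update (update (D_of s1) v d.+1) (nb v d) 7.
      by rewrite Es2 !D_of_setD.
    split.
    - split.
      + rewrite Es2; have E3 := @env_upd _ 9 (nb v d) E2 isT.
        exact: (@env_upd _ 10 (regs s1 10 + 1) E3 isT).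
      + exists (rcons l1 (nb v d)); first by rewrite D2.
        by rewrite size_rcons El1 Es2 /= /update /= addn1.
      + by rewrite Es2.
    - by rewrite Es2 !B_of_setD.
    - move=> _; split; first exact: D2.
        by rewrite Es2.
      by rewrite Es2 /= /update /= addn1.
    - move=> r rr; rewrite -keep // Es2 /= /update.
      by move: rr; rewrite !inE !negb_or => /and3P[/negbTE -> /negbTE -> _].
  by apply: hoare_skip; split.
by rewrite /=; lia.
Qed.

Lemma hoare_step t0 y s : core t0 y s -> regs s 11 < n ->
  hoare step_prog (500 * n) (fun s' =>
    [/\ core t0 y s', (regs s' 11, D_of s') = finger_step nb (regs s 11, D_of s),
        regs s' 11 < n, B_of s' = B_of s &
        keeps [:: 10; 11; 12; 13; 14; 19] s s']) s.
Proof.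
move=> C pn; have E := co_env C; set p := regs s 11 in pn *.
have zn : nb p 0 < n by apply: nb_lt.
have wn : nb (nb p 0) 1 < n by apply: nb_lt.
apply: hoare_le.
  apply: hoare_seq; apply: hoare_set; rewrite (nb_exprE E) //.
  set s1 := State _ _ _; have C1 : core t0 y s1 by apply: core_upd.
  have E1 := co_env C1.
  have keep r : r \notin [:: 10; 11; 12; 13; 14; 19] -> regs s1 r = regs s r.
    by rewrite /= /update !inE !negb_or; case: (r == 19); rewrite ?andbF.
  have cond : eval s1 (Eqn (Add (Add (Eqn (D_expr (Reg 11)) (Lit 2)) (Eqn (D_expr (Reg 19)) (Lit 0)))
                (Eqn (D_expr (nb_expr (Reg 19) 1)) (Lit 0))) (Lit 3)) =
      [&& D_of s p == 2, D_of s (nb p 0) == 0 & D_of s (nb (nb p 0) 1) == 0] :> nat.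
    have -> : D_of s p = eval s1 (D_expr (Reg 11)) by rewrite (D_exprE E1).
    have -> : D_of s (nb p 0) = eval s1 (D_expr (Reg 19)) by rewrite (D_exprE E1).
    have En : eval s1 (nb_expr (Reg 19) 1) = nb (nb p 0) 1 by rewrite (nb_exprE E1).
    have -> : D_of s (nb (nb p 0) 1) = eval s1 (D_expr (nb_expr (Reg 19) 1)).
      by rewrite (D_exprE E1) En.
    have c3 x1 x2 x3 : ((x1 == 2) + (x2 == 0) + (x3 == 0) == 3) =
        [&& x1 == 2, x2 == 0 & x3 == 0] :> nat.
      by case: (x1 == 2); case: (x2 == 0); case: (x3 == 0).
    exact: c3.
  apply: hoare_if; rewrite cond /finger_step; case: ifP => // c _.
    apply: hoare_seq; apply: hoare_set; set s2 := State _ _ _.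
    have C2 : core t0 y s2 by apply: core_upd.
    apply: hoare_seq; apply: hoare_weak (@hoare_ins 0 _ _ s2 isT C2 pn) (leqnn _) _ => s3 [C3 D3 B3 _ R3].
    apply: hoare_seq; apply: hoare_set; apply: hoare_seq; apply: hoare_set; set s4 := State _ _ _.
    have C4 : core t0 y s4.
      have := @core_upd _ _ _ 11 (regs s3 19) C3 isT; move/(@core_upd _ _ _ 12 (regs s3 19)); exact.
    have r19 : regs s3 19 = nb p 0 by rewrite R3.
    have r12 : regs s4 12 = nb p 0 by rewrite -r19.
    have l12 : regs s4 12 < n by rewrite r12.
    apply: hoare_weak (@hoare_ins 1 _ _ s4 isT C4 l12) (leqnn _) _ => s5 [C5 D5 B5 _ R5]; split=> //.
    - rewrite D5 r12 R5 // -[D_of s4]/(D_of s3) D3 -[regs s2 12]/p.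
      by rewrite -[regs s4 11]/(regs s3 19) r19.
    - by rewrite R5 // -[regs s4 11]/(regs s3 19) r19.
    - by rewrite B5 -[B_of s4]/(B_of s3) B3.
    - move=> r rr; rewrite -keep //.
      have [n10 n11 n12 n13 n14] : [/\ r != 10, r != 11, r != 12, r != 13 & r != 14].
        by move: rr; rewrite !inE !negb_or => /and5P[-> -> -> -> /andP[-> _]].
      rewrite R5; last by rewrite !inE !negb_or n10 n13 n14.
      rewrite /= /update (negbTE n11) (negbTE n12).
      rewrite R3; last by rewrite !inE !negb_or n10 n13 n14.
      by rewrite /= /update (negbTE n12).
  by apply: hoare_skip; split.
by rewrite /=; lia.
Qed.

Lemma hoare_finger t0 y s : core t0 y s -> regs s 11 < n ->
  hoare finger_prog (600 * n * (a + b).+1) (fun s' =>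
    [/\ core t0 y s', (regs s' 11, D_of s') = iter (a + b) (finger_step nb)
          (regs s 11, insert nb 2 1 3 (regs s 11) (D_of s)),
        B_of s' = B_of s & keeps [:: 10; 11; 12; 13; 14; 16; 19] s s']) s.
Proof.
move=> C pn; set p := regs s 11 in pn *; set L := [:: 10; 11; 12; 13; 14; 16; 19].
pose I i s' := [/\ core t0 y s' /\ regs s' 11 < n, regs s' 16 = i,
  (regs s' 11, D_of s') = iter i (finger_step nb) (p, insert nb 2 1 3 p (D_of s)),
  B_of s' = B_of s & keeps L s s'].
apply: hoare_le.
  apply: hoare_seq; apply: hoare_set; set s1 := State _ _ _.
  have C1 : core t0 y s1 by apply: core_upd.
  apply: hoare_seq; apply: hoare_weak (@hoare_ins 1 _ _ s1 isT C1 pn) (leqnn _) _ => s2 [C2 D2 B2 _ R2].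
  apply: hoare_seq; apply: hoare_set; set s3 := State _ _ _.
  have K1 : keeps L s s1 by apply: keeps_set.
  have K2 : keeps L s1 s2 by apply: keeps_sub R2.
  have K3 : keeps L s2 s3 by apply: keeps_set.
  apply: hoare_weak (leqnn _) _; first apply: (@hoare_count_up 16 (Reg 3) step_prog (500 * n) 0 (a + b) I).
  - by move=> i s' [[C' _] -> _ _ _]; split=> //=; exact: env3 (co_env C').
  - move=> i s' iN [[C' p'n] E16 ED EB K']; apply: hoare_weak (hoare_step C' p'n) (leqnn _) _.
    move=> s4 [C4 D4 p4 B4 K4]; split.
    + by split; [apply: core_upd|].
    + by rewrite /= /update /= K4 // E16 addn1.
    + by rewrite iterS -ED -D4.
    + by rewrite -EB -B4.
    + apply: keeps_trans K' _; apply: keeps_trans (keeps_sub _ K4) _ => //.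
      exact: keeps_set.
  - split=> //.
    + split; first exact: core_upd.
      by rewrite -[regs s3 11]/(regs s2 11) R2.
    + by rewrite -[regs s3 11]/(regs s2 11) R2 // -[D_of s3]/(D_of s2) D2.
    + apply: keeps_trans K1 _; exact: keeps_trans K2 K3.
  - by move=> s' [[C' _] _]; rewrite max0n.
rewrite subn0 /=; nia.
Qed.

Lemma hoare_init t0 y s (j := regs s 6 - 1) (B := B_of s)
    (D1 := insert nb 2 1 3 (B j) (D_of s))
    (pD := if D1 (nb (B (regs s 6)) 0) == 0 then finger_step nb (B j, D1) else (B j, D1)) :
  core t0 y s -> hoare init_prog (1000 * n) (fun s' =>
    [/\ core t0 y s', D_of s' = pD.2, B_of s' = update B j pD.1 &
        keeps [:: 10; 11; 12; 13; 14; 19] s s']) s.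
Proof.
move=> C; set L := [:: 10; 11; 12; 13; 14; 19].
have E := co_env C; have Bn i : B i < n := env_B E i.
apply: hoare_le.
  apply: hoare_seq; apply: hoare_set; rewrite (B_exprE _ E); set s1 := State _ _ _.
  apply: hoare_seq; apply: hoare_set; set s2 := State _ _ _.
  have C2 : core t0 y s2.
    by have := @core_upd _ _ _ 11 (B j) C isT; move/(@core_upd _ _ _ 12 (B j)); exact.
  have r12 : regs s2 12 < n by exact: Bn.
  apply: hoare_seq; apply: hoare_weak (@hoare_ins 1 _ _ s2 isT C2 r12) (leqnn _) _ => s3 [C3 D3 B3 _ R3].
  have E3 := co_env C3.
  have e6 : regs s3 6 = regs s 6 by rewrite R3.
  have e11 : regs s3 11 = B j by rewrite R3.
  have q3 : eval s3 (B_expr (Reg 6)) = B (regs s 6) by rewrite (B_exprE _ E3) /= e6 B3.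
  apply: hoare_seq; apply: hoare_set; rewrite (nb_exprE E3) // q3 //.
  set s4 := State _ _ _.
  have C4 : core t0 y s4 by apply: core_upd.
  have E4 := co_env C4.
  have zn : regs s4 12 < n by apply: nb_lt.
  have D4 : D_of s4 = D1 by rewrite -[D_of s4]/(D_of s3) D3.
  have p4 : regs s4 11 < n by rewrite -[regs s4 11]/(regs s3 11) e11.
  have K4 : keeps L s s4.
    have K1 : keeps L s s1 by apply: keeps_set.
    have K2 : keeps L s1 s2 by apply: keeps_set.
    apply: keeps_trans K1 (keeps_trans K2 _).
    apply: (@keeps_trans _ _ s3); first by apply: keeps_sub R3.
    exact: keeps_set.
  pose Q s5 := [/\ core t0 y s5, (regs s5 11, D_of s5) = pD, B_of s5 = B, regs s5 11 < n & keeps L s s5].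
  apply: hoare_seq; apply: (@hoare_weak _ _ _ Q); [|exact: leqnn|]; last first.
    move=> s5 [C5 D5 B5 p5 K5]; apply: hoare_mem.
    have E5 := co_env C5; have M5 : eval s5 (Add (Reg 18) (Defs.Sub (Reg 6) (Lit 1))) = 7 * n + j.
      by rewrite /= (env18 E5) K5.
    rewrite M5; split.
    - case: C5 => _ W5 L5; split=> //; first exact: env_setB.
      by rewrite D_of_setB.
    - by rewrite D_of_setB -D5.
    - by rewrite B_of_setB -D5 -B5.
    - exact: K5.
  apply: hoare_if.
    move=> c; apply: hoare_weak (hoare_step C4 p4) (leqnn _) _ => s5 [C5 D5 p5 B5 K5].
    split=> //.
    + rewrite D5 D4 -[regs s4 11]/(regs s3 11) e11 /pD.
      suff -> : D1 (nb (B (regs s 6)) 0) == 0 by [].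
      move: c; rewrite -D4 /=; rewrite -[D_of s4 _]/(D_of s4 (eval s4 (Reg 12))) -(D_exprE E4) //=.
      by case: eqP.
    + by rewrite B5 -[B_of s4]/(B_of s3) B3.
    + by apply: keeps_trans K4 _; apply: keeps_sub K5.
  move=> c; apply: hoare_skip; split=> //.
  - rewrite D4 -[regs s4 11]/(regs s3 11) e11 /pD.
    suff /negbTE -> : D1 (nb (B (regs s 6)) 0) != 0 by [].
    move: c; rewrite -D4 /=; rewrite -[D_of s4 _]/(D_of s4 (eval s4 (Reg 12))) -(D_exprE E4) //=.
    by case: eqP.
by rewrite /=; lia.
Qed.

Lemma hoare_pass k t0 y s : k < 4 -> core t0 y s ->
  hoare (pass_prog k.+1 k k.+2) (300 * n * n) (fun s' =>
    [/\ core t0 y s', D_of s' = pass nb k.+1 k k.+2 n (D_of s) &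
        keeps [:: 10; 12; 13; 14; 16] s s']) s.
Proof.
move=> k4 C; set L := [:: 10; 12; 13; 14; 16].
pose I i s' := [/\ core t0 y s', regs s' 16 = i,
  D_of s' = pass nb k.+1 k k.+2 i (D_of s) & keeps L s s'].
apply: hoare_le.
  apply: hoare_seq; apply: hoare_set; set s1 := State _ _ _.
  have K1 : keeps L s s1 by apply: keeps_set.
  apply: hoare_weak (leqnn _) _.
    apply: (@hoare_count_up 16 (Reg 2) _ (200 * n + 2) 0 n I).
    - by move=> i s' [C' -> _ _]; split=> //=; exact: env2 (co_env C').
    - move=> i s' iN [C' E16 ED K']; apply: hoare_le.
        apply: hoare_seq; apply: hoare_set; set s2 := State _ _ _.
        have C2 : core t0 y s2 by apply: core_upd.
        have r12 : regs s2 12 < n by rewrite -[regs s2 12]/(regs s' 16) E16; lia.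
        apply: hoare_weak (hoare_ins k4 C2 r12) (leqnn _) _ => s3 [C3 D3 _ _ K3]; split.
        + exact: core_upd.
        + by rewrite /= /update /= K3 // -[regs s2 16]/(regs s' 16) E16 addn1.
        + rewrite passS -ED -[D_of _]/(D_of s3) D3; congr insert; exact: E16.
        + have K2 : keeps L s' s2 by apply: keeps_set.
          have K3' : keeps L s2 s3 by apply: keeps_sub K3.
          apply: keeps_trans K' (keeps_trans K2 (keeps_trans K3' _)); exact: keeps_set.
      by rewrite /=; lia.
    - by split=> //; exact: core_upd.
  by move=> s' [C' _ D' K']; rewrite max0n in D'.
by rewrite subn0 /=; nia.
Qed.

(** * The stages of one run *)

Section Good.

Variables (sp kp : nat) (ex : bool) (F : int -> nat -> nat).
(** Only the geometric conclusions are guarded by G. Soundness of the output and the time bounds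
    hold without it, so that the sweep may also try bad parameters. *)
Let G : Prop := good_params a b sp kp ex /\ tile_map a b sp kp nb F.
Local Notation o := (rowstart sp kp).

Let spineD t half D B := spine a b sp kp ex F t half D B.
Let readyD D B := all_ready a b sp kp F D B.
Let growD t D B := growing a b sp kp F t D B.

Lemma hoare_spine t0 y s : core t0 y s -> regs s 6 = sp ->
  (G -> [/\ sp.+1 < a + b -> spineD sp false (D_of s) (B_of s),
    sp.+1 = a + b -> readyD (D_of s) (B_of s) & B_of s sp = F (o sp) sp]) ->
  hoare spine_prog (1000 * n * (a + b).+1) (fun s' =>
    [/\ core t0 y s', G -> readyD (D_of s') (B_of s') &
        keeps [:: 10; 11; 12; 13; 14; 15] s s']) s.
Proof.
move=> C E6 HG; set L := [:: 10; 11; 12; 13; 14; 15].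
have E := co_env C; have Bn i : B_of s i < n := env_B E i.
(* The iteration with counter i builds row i, so before it the spine reaches row i - 1. *)
pose I i s' := [/\ core t0 y s' /\ regs s' 11 < n, regs s' 15 = i, sp < i, keeps L s s' &
  G -> if i < a + b then spineD i.-1 false (D_of s') (B_of s') /\
    regs s' 11 = F (o sp + 1)%R i.-1 else readyD (D_of s') (B_of s')].
apply: hoare_le.
  apply: hoare_seq; apply: hoare_set; rewrite (nb_exprE E) // (B_exprE _ E) /= E6 //.
  set s1 := State _ _ _; have C1 : core t0 y s1 by apply: core_upd.
  apply: hoare_seq; apply: hoare_set; set s2 := State _ _ _.
  have C2 : core t0 y s2 by apply: core_upd.
  have K1 : keeps L s s1 by apply: keeps_set.
  have K2 : keeps L s1 s2 by apply: keeps_set.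
  apply: hoare_weak (leqnn _) _.
    apply: (@hoare_count_up 15 (Reg 3) spine_body (700 * n) sp.+1 (a + b) I).
    - by move=> i s' [[C' _] -> _ _ _]; split=> //=; exact: env3 (co_env C').
    - move=> i s' iN [[C' p'n] E15 spi K' H']; have E' := co_env C'.
      set p := regs s' 11 in p'n H' *.
      apply: hoare_le.
        have M' : eval s' (Add (Reg 18) (Defs.Sub (Reg 15) (Lit 1))) = 7 * n + i.-1.
          by rewrite /= (env18 E') E15 subn1.
        apply: hoare_seq; apply: hoare_mem; rewrite M' -[eval s' (Reg 11)]/p.
        set s3 := State _ _ _.
        have C3 : core t0 y s3.
          by case: C' => _ W L'; split=> //; [exact: env_setB|rewrite D_of_setB].
        have D3 : D_of s3 = D_of s' by rewrite D_of_setB.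
        have B3 : B_of s3 = update (B_of s') i.-1 p by rewrite B_of_setB.
        apply: hoare_seq; apply: hoare_set; set s4 := State _ _ _.
        have C4 : core t0 y s4 by apply: core_upd.
        have r12 : regs s4 12 < n by [].
        apply: hoare_seq; apply: hoare_weak (@hoare_ins 2 _ _ s4 isT C4 r12) (leqnn _) _ => s5 [C5 D5 B5 _ K5].
        have E5 := co_env C5.
        have r11 : regs s5 11 = p by rewrite K5.
        have n5 : eval s5 (nb_expr (Reg 11) 2) = nb p 2.
          have e11 : eval s5 (Reg 11) = p by exact: r11.
          by rewrite (nb_exprE E5) ?e11.
        apply: hoare_seq; apply: hoare_set; rewrite n5.
        set s6 := State _ _ _; have C6 : core t0 y s6 by apply: core_upd.
        have r12' : regs s6 12 < n by apply: nb_lt.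
        apply: hoare_seq; apply: hoare_weak (@hoare_ins 3 _ _ s6 isT C6 r12') (leqnn _) _ => s7 [C7 D7 B7 _ K7].
        have D7' : D_of s7 = insert nb 4 3 5 (nb p 2) (insert nb 3 2 4 p (D_of s')).
          by rewrite D7 -D3 -[D_of s3]/(D_of s4) -D5.
        have B7' : B_of s7 = update (B_of s') i.-1 p by rewrite B7 -B3 -[B_of s3]/(B_of s4) -B5.
        have K37 : keeps L s' s7.
          have X3 : keeps L s' s4 by apply: (@keeps_set _ s3).
          have X5 : keeps L s4 s5 by apply: keeps_sub K5.
          have X6 : keeps L s5 s6 by apply: keeps_set.
          have X7 : keeps L s6 s7 by apply: keeps_sub K7.
          exact: keeps_trans X3 (keeps_trans X5 (keeps_trans X6 X7)).
        have r15 : regs s7 15 = i by rewrite K7 // -[regs s6 15]/(regs s5 15) K5.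
        have r11' : regs s7 11 = p by rewrite K7 // -[regs s6 11]/(regs s5 11) r11.
        have H7 : G -> spineD i.-1 true (D_of s7) (B_of s7) /\ p = F (o sp + 1)%R i.-1.
          move=> g; have := H' g; have iab : i < a + b by lia.
          rewrite iab => -[S1 Ep]; split=> //; rewrite D7' B7' Ep.
          case: g => gd TM; rewrite (tm2 TM) GRing.addrK.
          have := spine_half gd TM (t := i.-1) (D := D_of s') (B := B_of s').
          have -> : i.-1.+1 = i by lia.
          by apply=> //; lia.
        have E7 := co_env C7.
        apply: hoare_if; rewrite /= r15 (env3 E7) addn1.
          move=> c; have i1 : i.+1 < a + b by case: (i.+1 < a + b) c.
          apply: hoare_seq; apply: hoare_set; set s8 := State _ _ _.
          have C8 : core t0 y s8 by apply: core_upd.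
          have r128 : regs s8 12 = p by rewrite -r11'.
          have r128n : regs s8 12 < n by rewrite r128.
          apply: hoare_seq; apply: hoare_weak (@hoare_ins 1 _ _ s8 isT C8 r128n) (leqnn _) _ => s9 [C9 D9 B9 _ K9].
          have E9 := co_env C9.
          have r119 : regs s9 11 = p by rewrite K9 // -r11'.
          have n9 : eval s9 (nb_expr (Reg 11) 1) = nb p 1.
            have e11 : eval s9 (Reg 11) = p by exact: r119.
            by rewrite (nb_exprE E9) ?e11.
          apply: hoare_set; rewrite n9.
          set s10 := State _ _ _; have C10 : core t0 y s10 by apply: core_upd.
          split=> //.
          + split; first exact: core_upd.
            exact: nb_lt.
          + by rewrite /= /update /= K9 // -[regs s8 15]/(regs s7 15) r15 addn1.
          + by rewrite ltnW.
          + apply: keeps_trans K' (keeps_trans K37 _).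
            have X8 : keeps L s7 s8 by apply: keeps_set.
            have X9 : keeps L s8 s9 by apply: keeps_sub K9.
            have X10 : keeps L s9 s10 by apply: keeps_set.
            apply: keeps_trans X8 (keeps_trans X9 (keeps_trans X10 _)); exact: keeps_set.
          + move=> g; rewrite i1 /=; have [S7 Ep] := H7 g; case: g => gd TM.
            rewrite -[D_of _]/(D_of s9) -[B_of _]/(B_of s9) D9 B9 r128.
            rewrite -[D_of s8]/(D_of s7) -[B_of s8]/(B_of s7).
            split; last by rewrite /= /update /= Ep (tm1 TM); congr F; lia.
            have := spine_full gd TM (t := i.-1) _ _ S7; rewrite -Ep.
            have -> : i.-1.+1 = i by lia.
          by apply=> //; lia.
        move=> c; have i1 : (i.+1 < a + b) = false by case: (i.+1 < a + b) c.
        apply: hoare_skip; split=> //.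
        + by split; [exact: core_upd|rewrite -[regs _ 11]/(regs s7 11) r11'].
        + by rewrite /= /update /= r15 addn1.
        + by rewrite ltnW.
        + apply: keeps_trans K' (keeps_trans K37 _); exact: keeps_set.
        + move=> g; rewrite i1 /=; have [S7 Ep] := H7 g; case: g => gd TM.
          have st : sp <= i.-1 by lia.
          have th : i.-1.+2 = a + b by lia.
          exact: (spine_end gd st th S7).
      by rewrite /=; lia.
    - split=> //.
      + by split=> //; exact: nb_lt.
      + by rewrite -[regs s2 15]/(regs s 6 + 1) E6 addn1.
      + exact: keeps_trans K1 K2.
      + move=> g; have [G1 G2 G3] := HG g; case: ifP => sh /=.
          split; first exact: G1.
          suff: nb (B_of s sp) 0 = F (o sp + 1)%R sp by [].
          by rewrite G3; case: g => _ TM; rewrite (tm0 TM).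
        by apply: G2; case: g => gd _; have := good_sh gd; lia.
  move=> s' [[C' _] _ _ K' H']; split=> // g; have := H' g.
  by have -> : (maxn sp.+1 (a + b) < a + b) = false by lia.
rewrite /=; nia.
Qed.

Lemma hoare_fingers t0 y s : core t0 y s ->
  (G -> readyD (D_of s) (B_of s)) ->
  hoare fingers_prog (700 * n * (a + b).+1 * (a + b).+1) (fun s' =>
    [/\ core t0 y s', G -> growD (a + b) (D_of s') (B_of s') &
        keeps [:: 10; 11; 12; 13; 14; 15; 16; 19] s s']) s.
Proof.
move=> C HG; set L := [:: 10; 11; 12; 13; 14; 15; 16; 19].
pose I i s' := [/\ core t0 y s', regs s' 15 = i.*2, keeps L s s' &
  G -> growD i.*2 (D_of s') (B_of s')].
apply: hoare_le.
  apply: hoare_seq; apply: hoare_set; set s1 := State _ _ _.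
  apply: hoare_weak (leqnn _) _.
    apply: (@hoare_while _ _ (600 * n * (a + b).+1 + 20) (a + b)./2 I).
    - move=> i s' iN [C' E15 K' H']; have E' := co_env C'.
      have i2 : i.*2 + 1 < a + b by lia.
      split; first by rewrite /= E15 (env3 E') i2.
      apply: hoare_le.
        apply: hoare_seq; apply: hoare_set; rewrite (B_exprE _ E') /= E15.
        set s2 := State _ _ _; have C2 : core t0 y s2 by apply: core_upd.
        have p2 : regs s2 11 < n by apply: (env_B E').
        apply: hoare_seq; apply: hoare_weak (hoare_finger C2 p2) (leqnn _) _ => s3 [C3 D3 B3 K3].
        have K2 : keeps L s' s2 by apply: keeps_set.
        have K3' : keeps L s2 s3 by apply: keeps_sub K3.
        apply: hoare_set; split.
        + exact: core_upd.
        + by rewrite /= /update /= K3 // -[regs s2 15]/(regs s' 15) E15; lia.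
        + apply: keeps_trans K' (keeps_trans K2 (keeps_trans K3' _)); exact: keeps_set.
        + move=> g; have gr := H' g; case: g => gd TM.
          rewrite -[D_of _]/(D_of s3) -[B_of _]/(B_of s3) B3 -[B_of s2]/(B_of s').
          have -> : D_of s3 = (iter (a + b) (finger_step nb)
             (B_of s' i.*2, insert nb 2 1 3 (B_of s' i.*2) (D_of s'))).2 by exact: (congr1 snd D3).
          rewrite doubleS; apply: (growing_step gd TM) => //; lia.
      by rewrite /=; lia.
    - move=> s' [C' E15 _ _]; rewrite /= E15 (env3 (co_env C')).
      by have -> : ((a + b)./2.*2 + 1 < a + b) = false by lia.
    - split=> //.
      + exact: core_upd.
      + exact: keeps_set.
      + by move=> g; apply: growing0; exact: HG.
  move=> s' [C' _ K' H']; split=> // g; case: (H' g) => g1 g2 g3 g4; split=> // j ev jh jJ.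
    by apply: g2 => //; lia.
  by apply: g3 => //; lia.
rewrite /=; nia.
Qed.

Lemma hoare_clear s : env s -> regs s 5 < n ->
  hoare clear_prog (50 * n) (fun s' =>
    [/\ seed (tape s) s' /\ D_of s' = update (fun=> 0) (regs s 5) 7,
      B_of s' 0 = regs s 5, regs s' 9 = regs s 5, regs s' 10 = 0 & keeps [:: 9; 10; 16] s s']) s.
Proof.
move=> E un; set u := regs s 5 in un *.
pose I i s' := [/\ env s', regs s' 16 = i, keeps [:: 16] s s', tape s' = tape s &
  forall p, p < i -> D_of s' p = 0].
apply: hoare_le.
  apply: hoare_seq; apply: hoare_set; set s1 := State _ _ _.
  have E1 : env s1 by apply: env_upd.
  apply: hoare_seq; apply: hoare_weak (leqnn _) _.
    apply: (@hoare_count_up 16 (Reg 2) _ 10 0 n I).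
    - by move=> i s' [E' -> _ _ _]; split=> //=; exact: env2 E'.
    - move=> i s' iN [E' E16 K' T' D']; apply: hoare_le.
        apply: hoare_mem; have -> : eval s' (Add (Reg 17) (Reg 16)) = 6 * n + i.
          by rewrite /= (env17 E') E16.
        have i_n : i < n by lia.
        split=> //.
        + exact: (@env_upd _ 16 _ (env_setD 0 E' i_n) isT).
        + by rewrite /= /update /= E16 addn1.
        + by apply: keeps_trans K' _; apply: keeps_set.
        + move=> p; rewrite -[D_of _]/(D_of (State (regs s') _ (tape s'))) D_of_setD // /update.
          by case: eqP => // ne pi; apply: D'; lia.
      by [].
    - by split=> //; exact: keeps_set.
  move=> s2; rewrite max0n => -[E2 _ K2 T2 D2].
  have D2' : D_of s2 = fun=> 0.
    apply/funext => p; have [pn|pn] := ltnP p n; first exact: D2.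
    by rewrite /D_of ltnNge pn.
  have u2 : regs s2 5 = u by rewrite K2.
  apply: hoare_seq; apply: hoare_mem.
  have -> : eval s2 (Add (Reg 17) (Reg 5)) = 6 * n + u by rewrite /= (env17 E2) u2.
  set s3 := State _ _ _; have E3 : env s3 by apply: env_setD.
  have D3 : D_of s3 = update (fun=> 0) u 7 by rewrite D_of_setD // -[D_of _]/(D_of s2) D2'.
  do 2![apply: hoare_seq; apply: hoare_set]; apply: hoare_mem; set s5 := State _ _ _.
  have e18 : regs s3 18 = 7 * n := env18 E3.
  have Es5 : s5 = State (update (update (regs s3) 9 u) 10 0) (update (memory s3) (7 * n + 0) u) (tape s3).
    rewrite /s5; congr State.
      by rewrite -u2.
    by rewrite -u2 -e18.
  have D5 : D_of s5 = update (fun=> 0) u 7 by rewrite Es5 D_of_setB.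
  split.
  - split; last exact: D5.
    have Eb : env s5.
      rewrite Es5; have E4 := env_setB 0 E3 un.
      exact: (@env_upd _ 10 0 (@env_upd _ 9 u E4 isT) isT).
    have r5 : regs s5 5 = u by rewrite -u2.
    have r9 : regs s5 9 = u by rewrite Es5.
    split=> //.
    exists [::]; last by rewrite Es5.
    rewrite r5 r9 D5; split=> //=; rewrite ?andbT //.
    + by rewrite /update eqxx.
    + by move=> x; rewrite inE => /eqP.
    + by move=> x _; rewrite inE /update => /negbTE ->.
  - by rewrite Es5 B_of_setB /update.
  - by rewrite Es5.
  - by rewrite Es5.
  - have X2 : keeps [:: 9; 10; 16] s s2 by apply: keeps_sub K2.
    apply: keeps_trans X2 _; rewrite Es5 => r rr.
    by move: rr; rewrite !inE !negb_or /= /update => /and3P[/negbTE -> /negbTE -> _].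
by rewrite subn0 /=; lia.
Qed.

Lemma hoare_base s : env s -> regs s 5 < n -> regs s 6 = sp -> regs s 7 = kp ->
  regs s 8 = ex -> sp <= n ->
  hoare base_prog (500 * n) (fun s' =>
    [/\ core (tape s) (regs s' 10) s', keeps [:: 9; 10; 13; 14; 15; 16] s s' &
      G -> F 0%R 0 = regs s 5 ->
      [/\ base_done a b sp kp ex F (D_of s') (B_of s'),
        regs s' 9 = (if ex then F (o sp - 1)%R sp.+1 else F (o sp) sp) & regs s' 10 = sp + ex]]) s.
Proof.
move=> E un E6 E7 E8 spn; set L := [:: 9; 10; 13; 14; 15; 16].
pose I i s' := [/\ seed (tape s) s', regs s' 15 = i, keeps L s s' &
  G -> F 0%R 0 = regs s 5 ->
  base_part a b sp kp F i (D_of s') (B_of s') (regs s' 9) (regs s' 10)].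
apply: hoare_le.
  apply: hoare_seq; apply: hoare_weak (hoare_clear E un) (leqnn _) _ => s1 [[S1 D1] B1 r9 r10 K1].
  apply: hoare_seq; apply: hoare_set; set s2 := State _ _ _.
  have S2 : seed (tape s) s2 by apply: seed_upd.
  have X1 : keeps L s s1 by apply: keeps_sub K1.
  have X2 : keeps L s1 s2 by apply: keeps_set.
  apply: hoare_seq; apply: hoare_weak (leqnn _) _.
    apply: (@hoare_count_up 15 (Reg 6) _ 200 0 sp I).
    - by move=> i s' [S' -> K' _]; split=> //=; rewrite K'.
    - move=> i s' isp [S' E15 K' H'].
      pose d := if i < kp then 2 else 1.
      pose Q s3 := [/\ seed (tape s) s3, B_of s3 = B_of s',
         D_of s' (nb (regs s' 9) d) = 0 ->
         [/\ D_of s3 = update (update (D_of s') (regs s' 9) d.+1) (nb (regs s' 9) d) 7,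
            regs s3 9 = nb (regs s' 9) d & regs s3 10 = (regs s' 10).+1] &
         keeps [:: 9; 10; 13] s' s3].
      apply: hoare_le.
        apply: hoare_seq; apply: (@hoare_weak _ _ _ Q); [|exact: leqnn|]; last first.
          move=> s3 [S3 B3 H3 K3]; have [E3 [l W3 El3] T3] := S3.
          have [_ v3] := walk_ends W3.
          have K3' : keeps L s' s3 by apply: keeps_sub K3.
          apply: hoare_mem; have -> : eval s3 (Add (Reg 18) (Add (Reg 15) (Lit 1))) = 7 * n + i.+1.
            by rewrite /= (env18 E3) K3 // E15 addn1.
          rewrite -[eval s3 (Reg 9)]/(regs s3 9); split.
          + have S4 : seed (tape s) (State (regs s3) (update (memory s3) (7 * n + i.+1) (regs s3 9)) (tape s3)).
              by split=> //; [exact: env_setB|exists l => //; rewrite D_of_setB].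
            exact: (@seed_upd _ _ 15 _ S4 isT).
          + by rewrite /= /update /= K3 // E15 addn1.
          + by apply: keeps_trans K' (keeps_trans K3' _); apply: keeps_set.
          + move=> g F0; have bp := H' g F0; case: g => gd TM.
            have [z0 bp'] := base_next gd TM (isp : i < sp) bp.
            have [D3 r93 r103] := H3 z0.
            rewrite -[D_of _]/(D_of (State (regs s3) _ (tape s3))) D_of_setB.
            rewrite -[B_of _]/(B_of (State (regs s3) _ (tape s3))) B_of_setB.
            rewrite -[D_of _]/(D_of s3) -[B_of _]/(B_of s3).
            suff: base_part a b sp kp F i.+1 (D_of s3) (update (B_of s3) i.+1 (regs s3 9)) (regs s3 9) (regs s3 10) by [].
            by rewrite D3 B3 r93 r103.
        have c1 : eval s' (Ltn (Reg 15) (Reg 7)) = (i < kp) :> nat by rewrite /= E15 K' // E7.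
        apply: hoare_if; rewrite c1 /Q /d; case: (i < kp) => // _.
          exact: hoare_append.
        exact: hoare_append.
      by rewrite /=; lia.
    - split=> //.
      + exact: keeps_trans X1 X2.
      + move=> g F0; case: g => gd TM.
        have := base_start gd TM (B := B_of s1); rewrite F0 => /(_ B1) bp0.
        suff: base_part a b sp kp F 0 (D_of s1) (B_of s1) (regs s1 9) (regs s1 10) by [].
        by rewrite D1 r9 r10.
  move=> s3; rewrite max0n => -[S3 E15 K3 H3].
  pose Q s4 := [/\ seed (tape s) s4, keeps L s s4 & G -> F 0%R 0 = regs s 5 ->
      [/\ base_done a b sp kp ex F (D_of s4) (B_of s4),
        regs s4 9 = (if ex then F (o sp - 1)%R sp.+1 else F (o sp) sp) & regs s4 10 = sp + ex]].
  apply: hoare_seq; apply: (@hoare_weak _ _ _ Q); [|exact: leqnn|]; last first.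
    move=> s4 [S4 K4 H4]; have [E4 [l W4 El4] T4] := S4.
    apply: hoare_weak (hoare_print E4 W4 (esym El4)) (leqnn _) _ => s5 ->; split.
    + split.
      * exact: (env_tape _ (@env_upd s4 14 (regs s4 9) E4 isT)).
      * by exists l.
      * suff: logged (tape s) (regs s4 5) (regs s4 9) (regs s4 10) (regs s4 10)
          (tape s4 ++ answer_code (regs s4 5, regs s4 9, size l, regs s4 5 :: l)) by [].
        rewrite -El4; apply: logged_cons W4 _ _; first by rewrite ltnn.
        by move=> _; exists [::] => //; rewrite cats0.
    + by apply: keeps_trans K4 _; apply: keeps_set.
    + exact: H4.
  apply: hoare_if; rewrite [eval _ _]/= K3 // E8.
    move=> hex; have {}hex : ex by case: ex hex.
    apply: hoare_weak (hoare_append (isT : 2 < 6) S3) (leqnn _) _ => s4 [S4 B4 H4 K4]; split=> //.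
      by apply: keeps_trans K3 _; apply: keeps_sub K4.
    move=> g F0; have bp := H3 g F0; case: g => gd TM.
    have [z0 [bd zE]] := base_extra gd TM hex bp.
    have [D4 r94 r104] := H4 z0; rewrite D4 B4 r94 r104 hex zE; split=> //.
      by move: bd; rewrite hex zE.
    by rewrite (bp_L bp) addn1.
  move=> hex; have {}hex : ~~ ex by case: ex hex.
  apply: hoare_skip; split=> // g F0; have bp := H3 g F0.
  rewrite (negbTE hex) addn0 (bp_L bp) (bp_v bp); split=> //.
  by have := base_end hex bp; rewrite (negbTE hex).
by rewrite subn0 /=; nia.
Qed.

Definition covers (S : nat -> nat -> nat -> Prop) (ys : seq answer) : Prop :=
  forall u v l, S u v l -> exists p, (u, v, l, p) \in ys.

Definition emits (S : nat -> nat -> nat -> Prop) (s s' : state) : Prop := exists ys,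
  [/\ tape s' = tape s ++ flatten (map answer_code ys), all answer_ok ys & covers S ys].

Definition scratch : seq nat := [:: 9; 10; 11; 12; 13; 14; 15; 16; 19].

(** By [final_all] the last path visits all n nodes and thus has n - 1 edges; the log then contains
    every length from the initial one to n - 1. *)
Lemma hoare_inner s : env s -> regs s 5 < n -> regs s 6 = sp -> regs s 7 = kp ->
  regs s 8 = ex -> sp <= n -> (a + b).+1 * (a + b).+1 <= 7 * n ->
  (good_params a b sp kp ex -> [/\ tile_map a b sp kp nb F, F 0%R 0 = regs s 5,
     (forall i j, F i j < n) & forall x, x < n -> exists i j, in_tile a b sp kp i j /\ x = F i j]) ->
  hoare inner_prog (4000 * 5 * n * n) (fun s' => [/\ env s', keeps scratch s s' &
    emits (fun u v l => [/\ good_params a b sp kp ex, u = regs s 5,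
      v = (if ex then F (o sp - 1)%R sp.+1 else F (o sp) sp) & sp + ex <= l <= n.-1]) s s']) s.
Proof.
move=> E un E6 E7 E8 spn hn HF.
have HG : good_params a b sp kp ex -> G by move=> gd; split=> //; case: (HF gd).
apply: hoare_le.
  apply: hoare_seq; apply: hoare_weak (hoare_base E un E6 E7 E8 spn) (leqnn _) _ => s1 [C1 K1 G1].
  have X1 : keeps scratch s s1 by apply: keeps_sub K1.
  apply: hoare_seq; apply: hoare_weak (hoare_init C1) (leqnn _) _ => s2 [C2 D2 B2 K2].
  have X2 : keeps scratch s1 s2 by apply: keeps_sub K2.
  have e61 : regs s1 6 = sp by rewrite X1.
  have e62 : regs s2 6 = sp by rewrite X2.
  rewrite e61 in D2 B2.
  have G2 : G -> F 0%R 0 = regs s 5 -> [/\ sp.+1 < a + b -> spineD sp false (D_of s2) (B_of s2),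
    sp.+1 = a + b -> readyD (D_of s2) (B_of s2) & B_of s2 sp = F (o sp) sp].
    move=> g F0; have [bd _ _] := G1 g F0; case: g => gd TM.
    have spj : (sp - 1).+1 = sp by have := odd_gt0 (good_odd gd); lia.
    have [c /= [Ep fr on hc]] := init_done gd TM bd spj.
    rewrite D2 B2 Ep; split.
    - by move=> s1h; move: fr on; rewrite (hc s1h) => fr on; exact: (spine_init gd bd spj s1h fr on).
    - by move=> s1h; exact: (ready_init gd bd spj s1h fr on).
    - rewrite /update; have -> : (sp == sp - 1) = false by lia.
      exact: (bd_B bd).
  have GF : G -> F 0%R 0 = regs s 5 by case=> gd _; case: (HF gd).
  apply: hoare_seq; apply: hoare_weak (hoare_spine C2 e62 (fun g => G2 g (GF g))) (leqnn _) _ => s3 [C3 G3 K3].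
  have X3 : keeps scratch s2 s3 by apply: keeps_sub K3.
  apply: hoare_seq; apply: hoare_weak (hoare_fingers C3 G3) (leqnn _) _ => s4 [C4 G4 K4].
  have X4 : keeps scratch s3 s4 by apply: keeps_sub K4.
  apply: hoare_seq; apply: hoare_weak (@hoare_pass 2 _ _ s4 isT C4) (leqnn _) _ => s5 [C5 D5 K5].
  have X5 : keeps scratch s4 s5 by apply: keeps_sub K5.
  apply: hoare_seq; apply: hoare_weak (@hoare_pass 1 _ _ s5 isT C5) (leqnn _) _ => s6 [C6 D6 K6].
  have X6 : keeps scratch s5 s6 by apply: keeps_sub K6.
  apply: hoare_weak (@hoare_pass 0 _ _ s6 isT C6) (leqnn _) _ => s7 [C7 D7 K7].
  have X7 : keeps scratch s6 s7 by apply: keeps_sub K7.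
  have X : keeps scratch s s7.
    exact: keeps_trans X1 (keeps_trans X2 (keeps_trans X3 (keeps_trans X4 (keeps_trans X5 (keeps_trans X6 X7))))).
  split=> //; first exact: co_env C7.
  have [ys [Ey ok cov]] := co_log C7.
  exists ys; split=> // u v l [gd -> -> /andP[l1 l2]].
  have g := HG gd; have [bd v1 L1] := G1 g (GF g).
  have [TM F0 Flt Fsurj] := HF gd.
  have r5 : regs s7 5 = regs s 5 by rewrite X.
  have r9 : regs s7 9 = regs s1 9.
    by rewrite K7 // K6 // K5 // K4 // K3 // K2.
  rewrite -r5 -v1 -r9; apply: cov; rewrite L1 l1 /=.
  apply: leq_trans l2 _; have [w W <-] := co_walk C7.
  suff /(walk_full W) <- : forall x, x < n -> D_of s7 x <> 0 by [].
  move=> x /Fsurj [i [j [t ->]]].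
  have -> : D_of s7 = final_passes nb n (D_of s4) by rewrite D7 D6 D5.
  apply: (final_all gd TM Flt _ (G4 g)) => // d p q d3; apply: nb_inj; lia.
(* The fingers take about (a + b)^2 steps of cost O(n), and the passes 3 n insertions of cost O(n).
   Both are O(n^2) because (a + b + 1)^2 <= 7 n. *)
move: hn; set H := (a + b).+1 => hn.
have H7 : H <= 7 * n by apply: leq_trans hn; rewrite leq_pmulr.
have m1 : n <= n * n by rewrite leq_pmulr.
have m2 : n * H <= 7 * (n * n) by rewrite [7 * _]mulnCA leq_mul2l H7 orbT.
have m3 : n * (H * H) <= 7 * (n * n) by rewrite [7 * _]mulnCA leq_mul2l hn orbT.
by rewrite -!mulnA; lia.
Qed.

End Good.

(** * The sweep over start nodes and parameters *)

Lemma emits_sub (S S' : nat -> nat -> nat -> Prop) s s' :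
  (forall u v l, S' u v l -> S u v l) -> emits S s s' -> emits S' s s'.
Proof. by move=> SS [ys [E ok c]]; exists ys; split=> // u v l /SS; apply: c. Qed.

Lemma emits_trans (S S' : nat -> nat -> nat -> Prop) s1 s2 s3 :
  emits S s1 s2 -> emits S' s2 s3 -> emits (fun u v l => S u v l \/ S' u v l) s1 s3.
Proof.
move=> [ys [E ok c]] [ys' [E' ok' c']]; exists (ys ++ ys'); split.
- by rewrite E' E map_cat flatten_cat catA.
- by rewrite all_cat ok ok'.
- move=> u v l [/c|/c'] [p pin]; exists p; rewrite mem_cat pin ?orbT //.
Qed.

Lemma hoare_for r e P t N L (S : nat -> nat -> nat -> nat -> Prop) s0 :
  r \notin [:: 0; 1; 2; 3; 17; 18] -> r \notin L -> env s0 ->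
  (forall s, env s -> keeps (r :: L) s0 s -> eval s e = N) ->
  (forall i s, i < N -> env s -> keeps (r :: L) s0 s -> regs s r = i ->
     hoare P t (fun s' => [/\ env s', keeps L s s' & emits (S i) s s']) s) ->
  hoare (for_prog r e P) (N * (expr_cost e + t + 8) + expr_cost e + 5)
    (fun s' => [/\ env s', keeps (r :: L) s0 s' &
      emits (fun u v l => exists2 i, i < N & S i u v l) s0 s']) s0.
Proof.
move=> r1 rL E0 He step.
pose I i s := [/\ env s, regs s r = i, keeps (r :: L) s0 s &
  emits (fun u v l => exists2 i', i' < i & S i' u v l) s0 s].
have rin : r \in r :: L by rewrite mem_head.
apply: hoare_le.
  apply: hoare_seq; apply: hoare_set; apply: hoare_weak (leqnn _) _.
    apply: (@hoare_count_up r e P t 0 N I).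
    - by move=> i s [E -> K _]; split=> //; apply: He.
    - move=> i s iN [E Er K [ys [Ey ok c]]]; apply: hoare_weak (step i s iN E K Er) (leqnn _) _.
      move=> s' [E' K' em']; have K2 : keeps (r :: L) s s'.
        by move=> q; rewrite inE negb_or => /andP[_]; exact: K'.
      split.
      + exact: env_upd.
      + by rewrite /= /update eqxx K' // Er addn1.
      + by apply: keeps_trans K (keeps_trans K2 _); apply: keeps_set.
      + have em : emits (fun u v l => exists2 i', i' < i & S i' u v l) s0 s by exists ys.
        have [zs [Ez okz cz]] := emits_trans em em'; exists zs; split=> // u v l [i'].
        rewrite ltnS leq_eqVlt => /orP[/eqP->|i'i] Si'; apply: cz; [by right|left].
        by exists i'.
    - split.
      + exact: env_upd.
      + by rewrite /= /update eqxx.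
      + exact: keeps_set.
      + by exists [::]; split=> //; [rewrite cats0|move=> u v l []].
  by move=> s; rewrite max0n => -[].
by rewrite subn0 /=; lia.
Qed.

Variable Fu : nat -> int -> nat -> nat.
Hypothesis Fu_map : forall u sp kp ex, u < n -> good_params a b sp kp ex ->
  [/\ tile_map a b sp kp nb (Fu u), Fu u 0%R 0 = u, (forall i j, Fu u i j < n) &
     forall x, x < n -> exists i j, in_tile a b sp kp i j /\ x = Fu u i j].
Hypothesis bn : b <= n.
Hypothesis hn : (a + b).+1 * (a + b).+1 <= 7 * n.

(** B stands for b + 1 and X for the cost of a run. Each start node has 2 B^2 runs, B^2 is at most 7
    m, and the factor 79 absorbs the overhead of the loops. *)
Lemma sweep_time m B X : 0 < B -> B * B <= 7 * m -> 0 < X ->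
  m * (1 + (B * ((1 + 1).+1 + (B * ((1 + 1).+1 + (2 * (1 + X + 8) + 1 + 5) + 8) +
    (1 + 1).+1 + 5) + 8) + (1 + 1).+1 + 5) + 8) + 1 + 5 <= m * (7 * m * (79 * X)).
Proof.
move=> B0 BB X0.
set c8 := 2 * (1 + X + 8) + 1 + 5; have H8 : c8 + 11 <= 37 * X by rewrite /c8; lia.
set c7 := B * ((1 + 1).+1 + c8 + 8) + (1 + 1).+1 + 5.
have H7 : c7 <= B * (37 * X) + 8.
  by rewrite /c7 -addnA leq_add // leq_mul2l; apply/orP; right; lia.
set c6 := B * ((1 + 1).+1 + c7 + 8) + (1 + 1).+1 + 5.
have H6 : c6 <= B * (B * (37 * X) + 19) + 8.
  by rewrite /c6 -addnA leq_add // leq_mul2l; apply/orP; right; lia.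
have H6' : c6 + 15 <= B * B * (79 * X).
  have Y1 : 0 < B * B by rewrite muln_gt0 B0.
  have YB : B <= B * B by rewrite leq_pmulr.
  apply: leq_trans (_ : B * B * (37 * X + 42) <= _).
    by rewrite mulnDr; rewrite mulnDr mulnA in H6; lia.
  by rewrite leq_mul2l; apply/orP; right; lia.
have m0 : 0 < m by rewrite lt0n; apply/eqP => m0; move: BB; rewrite m0 muln0 leqn0 muln_eq0; lia.
apply: leq_trans (_ : m * (B * B * (79 * X)) <= _).
  apply: leq_trans (_ : m * (c6 + 15) <= _); last by rewrite leq_mul2l H6' orbT.
  by rewrite !mulnDr; lia.
by rewrite leq_mul2l leq_mul2r BB !orbT.
Qed.

Lemma hoare_sweep s : env s ->
  hoare sweep_prog (n * (7 * n * (79 * (4000 * 5 * n * n)))) (fun s' => [/\ env s',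
    keeps (5 :: 6 :: 7 :: 8 :: scratch) s s' & emits (fun u v l => u < n /\
      exists sp kp (ex : bool), [/\ good_params a b sp kp ex,
        v = (if ex then Fu u (rowstart sp kp sp - 1)%R sp.+1 else Fu u (rowstart sp kp sp) sp)
        & sp + ex <= l <= n.-1]) s s']) s.
Proof.
move=> E.
pose S0 u sp kp (x : nat) u' v l := [/\ good_params a b sp kp (x == 1), u' = u,
  v = (if x == 1 then Fu u (rowstart sp kp sp - 1)%R sp.+1 else Fu u (rowstart sp kp sp) sp)
  & sp + (x == 1) <= l <= n.-1].
pose S1 u sp kp u' v l := exists2 x, x < 2 & S0 u sp kp x u' v l.
pose S2 u sp u' v l := exists2 kp, kp < b + 1 & S1 u sp kp u' v l.
pose S3 u u' v l := exists2 sp, sp < b + 1 & S2 u sp u' v l.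
apply: hoare_weak.
- apply: (@hoare_for 5 _ _ _ n (6 :: 7 :: 8 :: scratch) S3) => //.
    by move=> s1 E1 _ /=; exact: env2 E1.
  move=> u s1 un E1 _ R5.
  apply: (@hoare_for 6 _ _ _ (b + 1) (7 :: 8 :: scratch) (S2 u)) => //.
    by move=> s2 E2 _ /=; rewrite (env1 E2).
  move=> sp s2 spb E2 K2 R6.
  apply: (@hoare_for 7 _ _ _ (b + 1) (8 :: scratch) (S1 u sp)) => //.
    by move=> s3 E3 _ /=; rewrite (env1 E3).
  move=> kp s3 kpb E3 K3 R7.
  apply: (@hoare_for 8 _ _ _ 2 scratch (S0 u sp kp)) => //.
  move=> x s4 x2 E4 K4 R8.
  have r5 : regs s4 5 = u by rewrite K4 // K3 // K2.
  have r6 : regs s4 6 = sp by rewrite K4 // K3.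
  have r7 : regs s4 7 = kp by rewrite K4.
  have r8 : regs s4 8 = (x == 1) by rewrite R8; move: x2; case: (x) => [|[]].
  have spn : sp <= n by lia.
  have u4 : regs s4 5 < n by rewrite r5.
  have H4 : good_params a b sp kp (x == 1) -> [/\ tile_map a b sp kp nb (Fu u), Fu u 0%R 0 = regs s4 5,
     (forall i j, Fu u i j < n) & forall x, x < n -> exists i j, in_tile a b sp kp i j /\ x = Fu u i j].
    by rewrite r5; exact: Fu_map.
  apply: hoare_weak (hoare_inner E4 u4 r6 r7 r8 spn hn H4) (leqnn _) _ => s5 [E5 K5 em5].
  by split=> //; apply: emits_sub em5 => u' v l [gd -> -> ll]; rewrite r5.
- apply: sweep_time.
  + by lia.
  + by apply: leq_trans hn; rewrite leq_mul //; lia.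
  + by rewrite !muln_gt0 !n0.
move=> s' [E' K' em]; split=> //; apply: emits_sub em => u v l [un [sp [kp [ex [gd -> ll]]]]].
exists u => //; exists sp; first by case: gd; lia.
exists kp; first by case: gd; lia.
by exists ex; [case: (ex)|split; rewrite ?eqb1 //; case: (ex) gd ll].
Qed.

End Network.

(* Rotates the table of neighbours, so that afterwards rho plays the role of 1. *)
Definition move_prog (k : nat) : prog :=
  SetMem (Add (times6 (Reg 16)) (Lit k)) (nb_expr (Reg 16) k.+1).

Definition rotate_prog : prog :=
  for_prog 16 (Reg 2)
    (Seq (SetReg 13 (nb_expr (Reg 16) 0))
    (Seq (move_prog 0) (Seq (move_prog 1) (Seq (move_prog 2) (Seq (move_prog 3)
    (Seq (move_prog 4) (SetMem (Add (times6 (Reg 16)) (Lit 5)) (Reg 13)))))))).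

Definition path_prog : prog :=
  Seq (SetReg 3 (Add (Reg 0) (Reg 1)))
  (Seq (SetReg 17 (times6 (Reg 2)))
  (Seq (SetReg 18 (Add (times6 (Reg 2)) (Reg 2)))
  (for_prog 4 (Lit 6) (Seq sweep_prog rotate_prog)))).

(** * Correctness of the rotation of the table *)

Section Rotate.

Variables (a b n : nat) (nb : nat -> nat -> nat).
Hypothesis n0 : 0 < n.

Lemma hoare_move i k (Q : state -> Prop) s : regs s 16 = i ->
  Q (State (regs s) (update (memory s) (6 * i + k) (memory s (6 * i + k.+1))) (tape s)) ->
  hoare (move_prog k) 30 Q s.
Proof.
move=> r16 HQ; apply: hoare_le; first apply: hoare_mem; last by [].
have addr l : eval s (Add (times6 (Reg 16)) (Lit l)) = 6 * i + l by rewrite /= r16; lia.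
by rewrite addr -[eval s (nb_expr _ _)]/(memory s (eval s (Add (times6 (Reg 16)) (Lit k.+1)))) addr.
Qed.

Lemma hoare_move_last i (Q : state -> Prop) s : regs s 16 = i ->
  Q (State (regs s) (update (memory s) (6 * i + 5) (regs s 13)) (tape s)) ->
  hoare (SetMem (Add (times6 (Reg 16)) (Lit 5)) (Reg 13)) 30 Q s.
Proof.
move=> r16 HQ; apply: hoare_le; first apply: hoare_mem; last by [].
have -> : eval s (Add (times6 (Reg 16)) (Lit 5)) = 6 * i + 5 by rewrite /= r16; lia.
exact: HQ.
Qed.

Lemma hoare_rotate s : env a b n nb s ->
  hoare rotate_prog (300 * n) (fun s' =>
    [/\ env a b n (fun p k => nb p ((k + 1) %% 6)) s', keeps [:: 13; 16] s s' & tape s' = tape s]) s.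
Proof.
move=> E.
(* Halfway through, exactly the nodes below i have rotated entries. *)
pose nbi i p k := if p < i then nb p ((k + 1) %% 6) else nb p k.
pose I i s' := [/\ env a b n (nbi i) s', regs s' 16 = i, keeps [:: 13; 16] s s' & tape s' = tape s].
apply: hoare_le.
  apply: hoare_seq; apply: hoare_set; apply: hoare_weak (leqnn _) _.
    apply: (@hoare_count_up 16 (Reg 2) _ 200 0 n I).
    - by move=> i s' [E' -> _ _]; split=> //=; exact: env2 E'.
    - move=> i s' iN [E' E16 K' T']; have i_n : i < n by lia.
      have nbE k : k < 6 -> memory s' (6 * i + k) = nb i k.
        by move=> k6; rewrite (env_nb E') // /nbi ltnn.
      apply: hoare_le.
        apply: hoare_seq; apply: hoare_set; set rg := update _ _ _.
        have r16 : rg 16 = i by rewrite /rg /update /= E16.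
        have r13 : rg 13 = nb i 0.
          rewrite -nbE // /rg /update /=; congr memory; rewrite /= E16; lia.
        do 5![apply: hoare_seq; apply: (@hoare_move i); first exact: r16].
        apply: (@hoare_move_last i); first exact: r16.
        set s2 := State _ _ _.
        have ms2 k : k < 6 -> memory s2 (6 * i + k) = nb i ((k + 1) %% 6).
          rewrite /s2 /= r13 /update !eqn_add2l /=.
          by do 6![case: k => [|k] /=; first by rewrite ?nbE].
        have mo x : (x < 6 * i) || (6 * i + 6 <= x) -> memory s2 x = memory s' x.
          move=> xi; rewrite /s2 /= /update.
          have ne k : k < 6 -> (x == 6 * i + k) = false by lia.
          by rewrite !ne.
        have K2 : keeps [:: 13; 16] s' (set_reg s2 16 (regs s2 16 + 1)).
          move=> r; rewrite !inE negb_or /= /rg /update => /andP[/negbTE -> /negbTE ->] //.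
        split.
        + case: E' => F0 F1 F2 F3 F4 F5 F6 F7.
          split=> //; try by rewrite K2.
            move=> p k pn k6; rewrite -[memory _]/(memory s2); have [->|ne] := eqVneq p i.
              by rewrite ms2 // /nbi ltnSn.
            rewrite mo; last by lia.
            by rewrite F6 // /nbi; have -> : (p < i.+1) = (p < i) by lia.
          by move=> j; rewrite -[memory _]/(memory s2) mo ?F7 //; lia.
        + by rewrite /= /update /= r16 addn1.
        + exact: keeps_trans K' K2.
        + exact: T'.
      by rewrite /=; lia.
    - split=> //.
      + have E1 : env a b n (nbi 0) s by case: E => *; split.
        exact: (@env_upd _ _ _ _ s 16 _ E1 isT).
      + exact: keeps_set.
  move=> s'; rewrite max0n => -[E' _ K' T']; split=> //.
  case: E' => F0 F1 F2 F3 F4 F5 F6 F7; split=> // p k pn k6.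
  by rewrite F6 // /nbi pn.
rewrite subn0 /=; lia.
Qed.

End Rotate.

Local Open Scope ring_scope.

(** * Correctness *)

Section Correct.

Variables a b : nat.
Hypothesis b0 : (0 < b)%N.
Hypothesis ab : (a <= b)%N.
Local Notation n := (EJorder a b).
Local Notation alpha := (EJalpha a b).
Local Notation cls := (EJclass alpha).
Variables (nu : 'I_n -> EJnode alpha) (g : EJnode alpha -> 'I_n).
Hypotheses (nuK : cancel nu g) (gK : cancel g nu).

Lemma order_ge : (b <= n)%N.
Proof. by rewrite /EJorder -!mulnn; nia. Qed.

Lemma order_gt0 : (0 < n)%N.
Proof. exact: leq_trans b0 order_ge. Qed.

Lemma order_sq : ((a + b).+1 * (a + b).+1 <= 7 * n)%N.
Proof. by rewrite /EJorder -!mulnn; nia. Qed.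

(** Numbers outside the range fall back to node 0. *)
Definition to_ord (x : nat) : 'I_n := insubd (Ordinal order_gt0) x.
Definition node (x : nat) : EJnode alpha := nu (to_ord x).
Definition number (w : EJnode alpha) : nat := g w.

Lemma to_ordK x : (x < n)%N -> to_ord x = x :> nat.
Proof. by move=> xn; rewrite /to_ord insubdK. Qed.

Lemma to_ord_val (u : 'I_n) : to_ord u = u.
Proof. by rewrite /to_ord valKd. Qed.

Lemma number_lt w : (number w < n)%N. Proof. exact: ltn_ord. Qed.

Lemma nodeK x : (x < n)%N -> number (node x) = x.
Proof. by move=> xn; rewrite /number /node nuK to_ordK. Qed.

Lemma numberK w : node (number w) = w.
Proof. by rewrite /node /number to_ord_val gK. Qed.

Lemma number_inj w w' : number w = number w' -> w = w'.
Proof. by move=> E; rewrite -[w]numberK E numberK. Qed.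

Definition rot_nb (r p k : nat) : nat := number (node p + cls (rho ^+ (k + r))).

(** The covering map based at u and turned by rho^r; it is the F of [tile_map] for the rotated table
    [rot_nb]. *)
Definition sheet (r u : nat) (i : int) (j : nat) : nat :=
  number (node u + cls (rho ^+ r * EJInt i j)).

Lemma table_nb p k : (p < n)%N -> (k < 6)%N -> EJtable nu (6 * p + k)%N = rot_nb 0 p k.
Proof.
move=> pn k6; rewrite /EJtable.
have -> : ((6 * p + k) %/ 6 = p)%N by lia.
have -> : ((6 * p + k) %% 6 = k)%N by lia.
rewrite (insubT (fun x => x < n)%N pn) /EJneighbour /rot_nb addn0.
have -> : node p = nu (Sub p pn) by rewrite /node; congr nu; apply: val_inj; rewrite /= to_ordK.
case: pickP => [v /eqP <-|/(_ (g (nu (Sub p pn) + cls (rho ^+ k))))]; first by rewrite /number nuK.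
by rewrite gK eqxx.
Qed.

Lemma table_out i : (6 * n <= i)%N -> EJtable nu i = 0%N.
Proof. by move=> ni; rewrite /EJtable insubF //; apply/negbTE; rewrite -leqNgt; lia. Qed.

Lemma rot_nbS r p k : rot_nb r p ((k + 1) %% 6) = rot_nb r.+1 p k.
Proof. by rewrite /rot_nb [in LHS]exprD rho_mod -exprD addn1 addSnnS. Qed.

Lemma cls_nb r p k l : node (rot_nb r p k) + cls l = node p + cls (rho ^+ (k + r) + l).
Proof. by rewrite numberK EJclassD addrA. Qed.

Lemma rot_nb_tri r p k : rot_nb r (rot_nb r p k) k.+2 = rot_nb r p k.+1.
Proof. by rewrite {1}/rot_nb cls_nb !addSn rho_tri. Qed.

Lemma rot_nb_inj r k p q : (p < n)%N -> (q < n)%N -> rot_nb r p k = rot_nb r q k -> p = q.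
Proof.
move=> pn qn /number_inj /addIr E.
by rewrite -(nodeK pn) E nodeK.
Qed.

Lemma sheet_nb r u i (j : nat) k l i' (j' : nat) : rho ^+ k = l -> EJInt i j + l = EJInt i' j' ->
  rot_nb r (sheet r u i j) k = sheet r u i' j'.
Proof.
move=> Ek El; rewrite /rot_nb /sheet numberK -addrA -EJclassD addnC exprD -mulrDr Ek.
by rewrite El.
Qed.

Lemma lattice_cls r (i i' j j' : int) :
  cls (rho ^+ r * EJInt i j) = cls (rho ^+ r * EJInt i' j') <-> lattice a b (i - i') (j - j').
Proof.
have lat x y : lattice a b x y <-> exists q, EJInt x y = q * alpha.
  rewrite EJideal_alphaE; split=> [[p [q [-> ->]]]|[p [q [-> ->]]]].
    by exists (p + q), (- p); split; rewrite ?PoszD; ring.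
  by exists (- q), (p + q); split; rewrite ?PoszD; ring.
rewrite lat EJclass_eq -mulrBr EJInt_sub; split=> [[q E]|[q E]].
  (* rho^(5 r) is the inverse of rho^r. *)
  exists (rho ^+ (5 * r) * q).
  by rewrite -mulrA -E mulrA -exprD -mulSnr exprM rho6 expr1n mul1r.
by exists (rho ^+ r * q); rewrite E mulrA.
Qed.

Lemma sheet_eq r u i i' (j j' : nat) :
  sheet r u i j = sheet r u i' j' <-> lattice a b (i - i') (j%:Z - j'%:Z).
Proof.
rewrite -(lattice_cls r); split=> [/number_inj/addrI //|E].
by rewrite /sheet E.
Qed.

Lemma sheet_map r u s k ex : (u < n)%N -> good_params a b s k ex ->
  [/\ tile_map a b s k (rot_nb r) (sheet r u), sheet r u 0 0 = u,
     forall i j, (sheet r u i j < n)%N &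
     forall x, (x < n)%N -> exists i j, in_tile a b s k i j /\ x = sheet r u i j].
Proof.
move=> un gd; split.
- split.
  + by move=> i j; apply: (@sheet_nb r u _ _ _ (EJInt 1 0)) => //; rewrite EJInt_add addr0.
  + by move=> i j; apply: (@sheet_nb r u _ _ _ (EJInt 0 1)) => //; rewrite EJInt_add addr0; congr EJInt; lia.
  + by move=> i j; apply: (@sheet_nb r u _ _ _ (EJInt (-1) 1)) => //; rewrite EJInt_add; congr EJInt; lia.
  + by move=> i j; apply: (@sheet_nb r u _ _ _ (EJInt (-1) 0)) => //; rewrite EJInt_add addr0.
  + by move=> i j i' j' t t' /sheet_eq; apply: (tile_inj gd).
  + move=> j jh; apply/sheet_eq; exact: lattice_next.
- by rewrite /sheet mulr0 EJclass0 addr0 nodeK.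
- by move=> i j; apply: number_lt.
move=> x xn; have [z Ez] := EJclass_surj (node x - node u).
case E : (rho ^+ (5 * r) * z) => [i j].
have [i' [j' [t L]]] := tile_surj gd i j.
exists i', j'; split=> //.
rewrite -(nodeK xn) /sheet; congr number.
have -> : node x = node u + cls z by rewrite -Ez addrC subrK.
congr (_ + _); move/(lattice_cls r): L => <-; rewrite -E mulrA -exprD.
by rewrite -mulSn exprM rho6 expr1n mul1r.
Qed.

Definition node_adj : rel nat := fun x y => EJadj (node x) (node y).

Lemma rot_nb_adj r p k : node_adj p (rot_nb r p k).
Proof.
rewrite /node_adj /EJadj numberK opprD addrA subrr add0r.
have -> : rho ^+ (k + r) = rho ^+ ((k + r) %% 6) by rewrite rho_mod.
have : ((k + r) %% 6 < 6)%N by rewrite ltn_mod.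
have N w : - cls w = cls (- w) by rewrite -[- cls w]add0r -EJclass0 -EJclassB sub0r.
rewrite N; move: (_ %% 6)%N => m m6; apply: map_f.
by move: m m6; do 6![case=> //]; rewrite !inE ?opprK ?eqxx ?orbT.
Qed.

Definition to_answer (x : answer) : EJanswer a b :=
  let: (u, v, l, s) := x in (to_ord u, to_ord v, l, map to_ord s).

Lemma answer_valid x : answer_ok n node_adj x ->
  EJvalid nu (to_answer x) /\ EJencode (to_answer x) = answer_code x.
Proof.
case: x => [[[u v] l] [//|w s]] /= /and5P[/eqP -> P /eqP L U /andP[A /eqP El]].
have [un sn] : (u < n)%N /\ all (gtn n) s by move: A => /andP.
have vn : (v < n)%N.
  have := mem_last u s; rewrite L inE => /orP[/eqP->//|/(allP sn)//].
split; last first.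
  rewrite /EJencode /= !to_ordK //; congr [:: _, _, _, _ & _].
  rewrite -map_comp -[RHS]map_id; apply/eq_in_map => x xs /=.
  by rewrite to_ordK //; apply: (allP sn).
rewrite /EJvalid /EJpath /path_length /= eqxx /= !size_map El eqxx andbT.
apply/and3P; split.
- by move: P; rewrite -map_comp path_map.
- by rewrite -map_comp -[nu (to_ord u)]/((nu \o to_ord) u) last_map L.
rewrite -[_ && _]/(uniq (map nu (map to_ord (u :: s)))).
rewrite (map_inj_uniq (can_inj nuK)) map_inj_in_uniq //.
have {}A : all (gtn n) (u :: s) by [].
move=> x y /(allP A) /= xn /(allP A) /= yn E.
by rewrite -(to_ordK xn) E to_ordK.
Qed.

Lemma env_ext nb nb' s : (forall p k, (p < n)%N -> (k < 6)%N -> nb p k = nb' p k) ->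
  env a b n nb s -> env a b n nb' s.
Proof. by move=> H [E0 E1 E2 E3 E4 E5 E6 E7]; split=> // p k pn k6; rewrite E6 ?H. Qed.

Definition covered (r u v l : nat) : Prop := (u < n)%N /\ exists s k (ex : bool),
  [/\ good_params a b s k ex,
    v = (if ex then sheet r u (rowstart s k s - 1) s.+1 else sheet r u (rowstart s k s) s)
    & (s + ex <= l <= n.-1)%N].

Lemma covered_all (u v : 'I_n) l : u != v -> (EJdist (nu u) (nu v) <= l <= n.-1)%N ->
  exists2 r, (r < 6)%N & covered r u v l.
Proof.
move=> uv /andP[dl ln]; have [z Ez nz] := dist_hexnorm (nu u) (nu v).
have z0 : cls z <> 0.
  by rewrite -Ez => /eqP; rewrite subr_eq0 => /eqP /(can_inj nuK) E; rewrite E eqxx in uv.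
have [r [s [k [ex [r6 gd sl E]]]]] := hex_params b0 ab z0.
exists r => //; split; first exact: ltn_ord.
exists s, k, ex; split=> //; last by rewrite ln andbT; lia.
have En : v = number (node u + cls z) :> nat.
  rewrite -Ez /node to_ord_val [nu u + _]addrC subrK; rewrite /number nuK //.
by rewrite En E /sheet; case: (ex).
Qed.

Lemma hoare_path_prog : hoare path_prog (7 * (n * (7 * n * (79 * (4000 * 5 * n * n)))) + 3000 * n)
  (fun s' => emits n node_adj (fun u v l => exists2 r, (r < 6)%N & covered r u v l)
     (EJinput nu) s') (EJinput nu).
Proof.
have n0 := order_gt0.
set W := (n * (7 * n * (79 * (4000 * 5 * n * n))))%N.
pose I r s := [/\ env a b n (rot_nb r) s, regs s 4 = r &
  emits n node_adj (fun u v l => exists2 r', (r' < r)%N & covered r' u v l) (EJinput nu) s].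
apply: hoare_le.
  do 3![apply: hoare_seq; apply: hoare_set]; apply: hoare_seq; apply: hoare_set.
  set s0 := State _ _ _.
  have E0 : env a b n (rot_nb 0) s0.
    split=> //.
    - by rewrite -[RHS]/(6 * EJorder a b)%N /s0 /= /update /=; lia.
    - by rewrite /s0 /= /update /=; lia.
    - by move=> p k pn k6; apply: table_nb.
    - by move=> j; rewrite -[memory _ _]/(EJtable nu _) table_out //; lia.
  apply: hoare_weak (leqnn _) _.
    apply: (@hoare_count_up 4 (Lit 6) _ (W + 300 * n) 0 6 I).
    - by move=> i s [_ -> _].
    - move=> r s r6 [E R em].
      have Hs := hoare_sweep n0 (fun p k _ _ => number_lt _) (fun p k _ _ => rot_nb_adj r p k)
        (fun p k _ _ => rot_nb_tri r p k) (fun k p q _ pn qn => @rot_nb_inj r k p q pn qn)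
        (fun u s k ex => @sheet_map r u s k ex) order_ge order_sq E.
      apply: hoare_seq; apply: hoare_weak Hs (leqnn _) _ => s1 [E1 K1 em1].
      apply: hoare_weak (hoare_rotate n0 E1) (leqnn _) _ => s2 [E2 K2 T2].
      split.
      + apply: (@env_upd _ _ _ _ s2 4 _ _ isT).
        by apply: env_ext E2 => p k _ _; exact: rot_nbS.
      + by rewrite /= /update /= K2 // K1 // R addn1.
      + have [ys [Ey ok c]] := emits_trans em em1.
        exists ys; split=> //; first by rewrite -Ey -T2.
        move=> u v l [r']; rewrite ltnS leq_eqVlt => /orP[/eqP->|r'r] cv; apply: c.
          by right.
        by left; exists r'.
    - split=> //.
      by exists [::]; split=> // u v l [].
  by move=> s; rewrite max0n => -[].
by rewrite /=; lia.
Qed.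

Lemma emits_solution s : emits n node_adj
    (fun u v l => exists2 r, (r < 6)%N & covered r u v l) (EJinput nu) s ->
  EJsolution nu (tape s).
Proof.
move=> [ys [E ok c]]; exists (map to_answer ys); split.
- rewrite E /= -map_comp; congr flatten; apply/eq_in_map => x xs /=.
  by have [_ ->] := answer_valid (allP ok _ xs).
- by apply/allP => _ /mapP[x xs ->]; have [] := answer_valid (allP ok _ xs).
move=> u v l uv dl; have [p pin] := c _ _ _ (covered_all uv dl).
exists (map to_ord p); apply/mapP; exists (val u, val v, l, p) => //=.
by rewrite !to_ord_val.
Qed.

End Correct.

Lemma path_prog_time K m : (0 < m)%N ->
  (7 * (m * (7 * m * (79 * (K * m * m)))) + 3000 * m <= (7 * 7 * 79 * K + 3000) * m ^ 4)%N.
Proof.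
move=> m0; rewrite mulnDl leq_add //; last by rewrite leq_mul2l /= -[X in (X <= _)%N]expn1 leq_pexp2l.
apply: eq_leq; rewrite !expnS expn0 muln1 -!mulnA [(K * _)%N]mulnCA; congr (7 * _)%N.
lia.
Qed.

Theorem mainTheorem2 :
  exists (P : prog) (C : nat),
  forall a b : nat, EJalpha a b != 0 -> (a <= b)%N ->
  forall nu : 'I_(EJorder a b) -> EJnode (EJalpha a b), bijective nu ->
  exists (t : nat) (s : state),
    [/\ exec P (EJinput nu) t s,
        (t <= C * EJorder a b ^ 4)%N &
        EJsolution nu (tape s)].
Proof.
(* The first 7 rounds up the six rotations and absorbs their bookkeeping, the second comes from
   [order_sq], 79 from the loops of the sweep and 4000 * 5 from one run. The summand 3000 pays for
   the setup and for rotating the table. *)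
exists path_prog, (7 * 7 * 79 * (4000 * 5) + 3000)%N => a b nz ab nu [g nuK gK].
have b0 : (0 < b)%N.
  rewrite lt0n; apply: contraNneq nz => b0; move: ab; rewrite b0 leqn0 => /eqP ->.
  by rewrite EJalphaE.
have [t [s [ex tle em]]] := hoare_path_prog b0 ab nuK gK.
exists t, s; split=> //; last exact (emits_solution nuK em).
exact: leq_trans tle (path_prog_time _ (order_gt0 b0 ab)).
Qed.
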